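(* Let $n\ge 2$, let $B\subseteq\mathbb{R}^n$ be the open unit ball for the supremum norm $|\cdot|$, and let $\mathbb{T}^n=\mathbb{R}^n/\mathbb{Z}^n$. Let $H:\mathbb{T}^n\times B\to\mathbb{R}$ be a Hamiltonian of class $C^3$ of the form $$H(\theta,I)=h(I)+\varepsilon f(\theta,I),\qquad \varepsilon\ge 0,$$ with $$|h|_{C^2(B)}\le 1,\qquad |f|_{C^3(\mathbb{T}^n\times B)}\le 1 .$$ Assume, with $I^*=0\in B$: (1) the vector $\omega:=\partial_I h(I^* )$ is resonant but non-zero, that is, $k\cdot\omega=0$ for some, but not all, $k\in\mathbb{Z}^n\setminus\{0\}$; (2) the function $f_\omega^*$ on $\mathbb{T}^n$ (the average of $f(\cdot,I^* )$ along $\omega$) is non-constant, that is, there exists $\theta^*\in\mathbb{T}^n$ such that $|\partial_\theta f_\omega^*(\theta^* )|=\lambda>0$. Let $\Lambda$ be the real subspace of $\mathbb{R}^n$ spanned by $\{k\in\mathbb{Z}^n : k\cdot\omega=0\}$. Then there exist positive constants $\kappa$ depending only on $(n,|\omega|,\Lambda)$, $\mu_0$ depending only on $(n,|\omega|,\Lambda,\lambda)$, and $c$ and $\delta$ depending only on $(\lambda,\Lambda)$, such that if $$0<\mu(\sqrt{\varepsilon}):=\left(\Delta_\omega\!\left(\kappa\,\sqrt{\varepsilon}^{\,-1}\right)\right)^{-1}\le\mu_0,$$ then there exists a solution $(\theta(t),I(t))$, $0\le t\le\tau$, of the Hamiltonian system associated to $H$ such that $$|I(\tau)-I(0)|\ge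 c\sqrt{\varepsilon},\qquad \tau:=\delta/\sqrt{\varepsilon}.$$ Moreover, there exists a positive constant $C$ depending only on $(n,|\omega|,\Lambda)$ such that this solution satisfies $$d(I(0),I^* )\le C\sqrt{\varepsilon}\,\mu(\sqrt{\varepsilon}),\qquad d(I(t)-I(0),\Lambda)\le C\sqrt{\varepsilon}\,\mu(\sqrt{\varepsilon})\quad\text{for } 0\le t\le\tau,$$ where $d$ is the distance induced by the supremum norm.
   Context: The norm $|\cdot|$ on $\mathbb{R}^n$ is the supremum norm, and $\cdot$ between vectors denotes the Euclidean scalar product. $|\cdot|_{C^2(B)}$ and $|\cdot|_{C^3(\mathbb{T}^n\times B)}$ are the standard $C^2$-norm for functions on $B$ and the standard $C^3$-norm for functions on $\mathbb{T}^n\times B$. The Hamiltonian system associated to $H$ is $$\dot\theta(t)=\partial_I h(I(t))+\varepsilon\,\partial_I f(\theta(t),I(t)),\qquad \dot I(t)=-\varepsilon\,\partial_\theta f(\theta(t),I(t)).$$ Averaged perturbation: $$f_\omega(\theta,I):=\lim_{t\to+\infty}\frac1t\int_0^t f(\theta+s\omega,I)\,ds,\qquad f_\omega^*(\theta):=f_\omega(\theta,I^* )=f_\omega(\theta,0).$$ Equivalently, if $f(\theta,I)=\sum_{k\in\mathbb{Z}^n}f_k(I)e^{i2\pi k\cdot\theta}$ is the Fourier expansion of $f$, then $f_\omega^*(\theta)=\sum_{k\in\mathbb{Z}^n\cap\Lambda}f_k(0)e^{i2\pi k\cdot\theta}$. The functions $\Psi_\omega$ and $\Delta_\omega$: let $\Lambda^\perp$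 be the orthogonal complement of $\Lambda$ in $\mathbb{R}^n$ (the minimal rational subspace of $\mathbb{R}^n$ containing $\omega$). Define $$\Psi_\omega(Q)=\max\{|k\cdot\omega|^{-1} : k\in\Lambda^\perp\cap\mathbb{Z}^n,\ 0<|k|\le Q\}\qquad\text{for } Q\ge Q_\omega,$$ where $Q_\omega\ge 1$ is a constant depending on $\omega$ such that this is well-defined for $Q\ge Q_\omega$; one takes $Q_\omega$ to be the smallest $Q\ge1$ for which there is $k\in\Lambda^\perp\cap\mathbb{Z}^n$ with $0<|k|\le Q$. For $x\ge Q_\omega\Psi_\omega(Q_\omega)$ define $$\Delta_\omega(x)=\sup\{Q\ge Q_\omega : Q\,\Psi_\omega(Q)\le x\}.$$ The smallness condition on $\mu(\sqrt\varepsilon)$ is understood to include that $\varepsilon>0$ and that $\kappa\sqrt{\varepsilon}^{\,-1}\ge Q_\omega\Psi_\omega(Q_\omega)$, so that $\Delta_\omega(\kappa\sqrt{\varepsilon}^{\,-1})$ is defined. For $x\in\mathbb{R}^n$ and a subset $S\subseteq\mathbb{R}^n$, $d(x,S)=\inf_{y\in S}|x-y|$. *)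

(* Defs.v *)
From HB Require Import structures.
From mathcomp Require Import all_boot all_order all_algebra.
From mathcomp Require Import all_classical all_reals all_analysis.

Set Implicit Arguments.
Unset Strict Implicit.
Unset Printing Implicit Defensive.

Import Order.TTheory GRing.Theory Num.Theory.
Import numFieldNormedType.Exports.

Local Open Scope classical_set_scope.
Local Open Scope ring_scope.

(* Throughout, the library norm `|x| on 'rV[R]_n is the supremum norm. *)

Section CkFunctions.
Context {R : realType} {V : normedModType R} {J : Type}.

(* Iterated partial derivatives along the coordinate directions e. The word s
   plays the role of a multi-index of length size s; on C^k functions the order
   of the letters is irrelevant. *)
Definition iter_partial (e : J -> V) (s : seq J) (g : V -> R) : V -> R :=
  foldr (fun j u x => 'D_(e j) u x) g s.

(* Meaningful for D open and e a basis of the finite-dimensional space V. *)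
Definition Ck (e : J -> V) (k : nat) (D : set V) (g : V -> R) : Prop :=
  forall s : seq J, (size s <= k)%N -> forall x, D x ->
    {for x, continuous (iter_partial e s g)} /\
    ((size s < k)%N -> forall j, derivable (iter_partial e s g) x (e j)).

(* The maximum over the partial derivatives of order at most k of their
   supremum on D. *)
Definition Ck_norm (e : J -> V) (k : nat) (D : set V) (g : V -> R) : \bar R :=
  ereal_sup [set r | exists s x,
    [/\ (size s <= k)%N, D x & r = `|iter_partial e s g x|%:E]].

End CkFunctions.

Section Vectors.
Context {R : realType} {n : nat}.
Local Notation Rn := 'rV[R]_n.

Definition scal (u v : Rn) : R := \sum_i u 0 i * v 0 i.

Definition Zn : set Rn := range (map_mx intr : 'rV[int]_n -> Rn).

Definition real_span (A : set Rn) : set Rn :=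
  [set v | exists (m : nat) (a : 'I_m -> R) (w : 'I_m -> Rn),
    (forall j, A (w j)) /\ v = \sum_j a j *: w j].

Definition orthc (A : set Rn) : set Rn :=
  [set v | forall w, A w -> scal v w = 0].

Definition set_dist (x : Rn) (S : set Rn) : R := inf [set `|x - y| | y in S].

Definition unit_ball : set Rn := [set x | `|x| < 1].

Definition basis1 (i : 'I_n) : Rn := delta_mx 0 i.

Definition basis2 (j : 'I_n + 'I_n) : Rn * Rn :=
  match j with inl i => (basis1 i, 0) | inr i => (0, basis1 i) end.

Definition grad (g : Rn -> R) (x : Rn) : Rn := \row_i 'D_(basis1 i) g x.

Definition grad_theta (g : Rn * Rn -> R) (x : Rn * Rn) : Rn :=
  \row_i 'D_(basis2 (inl i)) g x.

Definition grad_I (g : Rn * Rn -> R) (x : Rn * Rn) : Rn :=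
  \row_i 'D_(basis2 (inr i)) g x.

(* A function on T^n x B is encoded by its lift to R^n x B, Z^n-periodic in the
   first variable; only the values at points of R^n x B are meaningful. *)
Definition torus_ball : set (Rn * Rn) := [set: Rn] `*` unit_ball.

Definition torus_periodic (g : Rn * Rn -> R) : Prop :=
  forall theta k I, Zn k -> unit_ball I -> g (theta + k, I) = g (theta, I).

End Vectors.

Section Frequency.
Context {R : realType} {n : nat} (omega : 'rV[R]_n).

Definition resonant : Prop :=
  (exists k, [/\ Zn k, k != 0 & scal k omega = 0]) /\
  ~ (forall k, Zn k -> k != 0 -> scal k omega = 0).

Definition Lambda_omega : set 'rV[R]_n :=
  real_span [set k | Zn k /\ scal k omega = 0].

Definition low_modes (Q : R) : set 'rV[R]_n :=
  [set k | [/\ orthc Lambda_omega k, Zn k, 0 < `|k| & `|k| <= Q]].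

(* The infimum is attained, since norms of integer vectors are integers. *)
Definition Q_omega : R := inf [set Q | 1 <= Q /\ low_modes Q !=set0].

(* A maximum: low_modes Q is finite, and nonempty for Q >= Q_omega. *)
Definition Psi_omega (Q : R) : R :=
  sup [set `|scal k omega|^-1 | k in low_modes Q].

Definition Delta_omega (x : R) : R :=
  sup [set Q | Q_omega <= Q /\ Q * Psi_omega Q <= x].

Definition mu_omega (kappa eps : R) : R :=
  (Delta_omega (kappa * (Num.sqrt eps)^-1))^-1.

(* Q_omega * Psi_omega Q_omega is the left end of the domain of Delta_omega. *)
Definition Delta_defined (kappa eps : R) : Prop :=
  0 < eps /\ Q_omega * Psi_omega Q_omega <= kappa * (Num.sqrt eps)^-1.

(* The limit exists for f continuous and periodic in the first variable. *)
Definition average (f : 'rV[R]_n * 'rV[R]_n -> R) (x : 'rV[R]_n * 'rV[R]_n) : R :=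
  lim ((t^-1 * \int[lebesgue_measure]_(s in `[0, t]) f (x.1 + s *: omega, x.2))
         @[t --> +oo]).

Definition average0 (f : 'rV[R]_n * 'rV[R]_n -> R) (theta : 'rV[R]_n) : R :=
  average f (theta, 0).

End Frequency.

Section HamiltonianSystem.
Context {R : realType} {n : nat}.
Local Notation Rn := 'rV[R]_n.

Definition hamiltonian (h : Rn -> R) (f : Rn * Rn -> R) (eps : R)
  (x : Rn * Rn) : R := h x.2 + eps * f x.

(* theta is lifted from T^n to R^n. Requiring two-sided derivatives at the
   endpoints 0 and tau is harmless: values outside [0, tau] are free. *)
Definition solution (h : Rn -> R) (f : Rn * Rn -> R) (eps tau : R)
    (theta I : R -> Rn) : Prop :=
  forall t, 0 <= t <= tau ->
    [/\ unit_ball (I t),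
        is_derive t 1 theta
          (grad h (I t) + eps *: grad_I f (theta t, I t)) &
        is_derive t 1 I (- (eps *: grad_theta f (theta t, I t)))].

End HamiltonianSystem.

(* Main.v *)
Require Import Defs.
From HB Require Import structures.
From mathcomp Require Import all_boot all_order all_algebra.
From mathcomp Require Import all_classical all_reals all_analysis.
From mathcomp Require Import ring lra zify.

Set Implicit Arguments.
Unset Strict Implicit.
Unset Printing Implicit Defensive.

Import Order.TTheory GRing.Theory Num.Theory.
Import numFieldNormedType.Exports.

Local Open Scope classical_set_scope.
Local Open Scope ring_scope.

(** Write [s] for the square root of [eps], [f0] for [f (_, 0)], [G] for its
    gradient and [Lambda^perp] for the orthogonal complement of the resonance
    space. Start at [I 0 = 0] and [theta 0 = theta_star]. During the time
    [tau = delta / s] the actions move by at most [eps * tau = delta * s], hence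
    the velocity of the angle stays within [O(s)] of [omega], and
    [I t - I 0] is [- eps] times the integral of [G] along a curve that leaves
    the line of direction [omega] by [O(delta ^ 2 + delta * s)] only. So both
    conclusions are statements on averages of a [C^2] function of the torus
    along [omega], over times of order [1 / s].

    The core is [exists_time_average]: for each [Q >= Q_omega] there are
    finitely many delays [r j] with weights [w j] of sum [1], of mean size
    [O(Psi Q)], such that the averaged function
    [\sum_j w j * f0 (th - r j *: omega)] is invariant under all translations by
    [Lambda^perp] up to [O(Q ^ -2)]. Indeed [f0] is within [O(Q ^ -2)] of a
    trigonometric polynomial of degree proportional to [Q] (the Jackson theorem
    [jackson]); a harmonic [k] of that polynomial either lies in [Lambda], and
    is then invariant under [Lambda^perp], or has [`|scal k omega|] at least of
    order [1 / Psi Q] ([small_divisor]); and harmonics of the second kind are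
    removed by a kernel in time whose Fourier transform vanishes above that
    threshold ([high_frequency_killer], [bohr_average]). This is the argument
    behind the Bohr-Favard inequality: it costs the largest inverse divisor once,
    instead of a sum of inverse divisors over all harmonics, which would lose
    powers of [Q] in low regularity. All kernels are finite sums, sampled from
    one positive trigonometric kernel.

    Replacing a quantity by its average over the delays costs its speed times
    the mean delay ([delay_increment]). Two consequences follow, as [Lambda^perp]
    contains [omega].

    - Along [Lambda]: the averages of [f0] along [omega] converge to
      [average0 omega f] with the rate [average0_rate]. Comparing finite
      differences, the time average of [G] over [[0, tau]] keeps at least half of
      the gradient of the limit ([drift_lower_bound]), and this moves [I] by a
      multiple of [eps * tau = delta * s] ([drift_along]).

    - Across [Lambda]: for [v] in [Lambda^perp] the finite difference
      [(f0 (th + Q^-1 *: v) - f0 th) / Q^-1], which is [scal v (G th)] up to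
      [O(1 / Q)], has delayed averages of size [O(1 / Q)]. Hence
      [scal v (I t - I 0)] is at most [eps * O(Psi Q + tau / Q + 1)]
      ([drift_across]).

    With [Q] half of [Delta_omega (kappa / s)] or more, [1 / Q] and [s * Psi Q]
    are both [O(mu)] ([exists_cutoff]), which is what the two estimates need.
    The solution itself comes from [global_flow], applied to the vector field
    with clamped actions. *)

(** * Supremum norms and scalar products of row vectors *)

Section Vectors.
Context {R : realType}.

Lemma entry_le_norm n (x : 'rV[R]_n) i : `|x 0 i| <= `|x|.
Proof.
rewrite [leRHS]/Num.norm /= mx_normrE.
by apply/bigmax_geP; right => /=; exists (0, i).
Qed.

Lemma norm_le_entries n (x : 'rV[R]_n) (a : R) :
  0 <= a -> (forall i, `|x 0 i| <= a) -> `|x| <= a.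
Proof.
move=> a0 xa; rewrite [leLHS]/Num.norm /= mx_normrE bigmax_le// => -[i j] _ /=.
by rewrite (ord1 i).
Qed.

Lemma norm_lt_entries n (x : 'rV[R]_n) (a : R) :
  0 < a -> (forall i, `|x 0 i| < a) -> `|x| < a.
Proof.
move=> a0 xa; rewrite [ltLHS]/Num.norm /= mx_normrE bigmax_lt// => -[i j] _ /=.
by rewrite (ord1 i).
Qed.

Lemma norm_attained n (x : 'rV[R]_n) :
  0 < `|x| -> exists i, `|x| = `|x 0 i|.
Proof.
move=> x0; have /mx_norm_neq0[[i j] /=] : mx_norm x != 0.
  by rewrite -[mx_norm x]/(`|x|) gt_eqF.
by rewrite -[mx_norm x]/(`|x|) (ord1 i) => ->; exists j.
Qed.

Lemma norm_scal_le n (u v : 'rV[R]_n) : `|scal u v| <= n%:R * (`|u| * `|v|).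
Proof.
rewrite /scal (le_trans (ler_norm_sum _ _ _))//.
have -> : n%:R * (`|u| * `|v|) = \sum_(i < n) `|u| * `|v|.
  by rewrite sumr_const card_ord mulr_natl.
by apply: ler_sum => i _; rewrite normrM ler_pM// entry_le_norm.
Qed.

Lemma scalC n (u v : 'rV[R]_n) : scal u v = scal v u.
Proof. by apply: eq_bigr => i _; rewrite mulrC. Qed.

Lemma scalDl n (u v w : 'rV[R]_n) : scal (u + v) w = scal u w + scal v w.
Proof.
by rewrite /scal -big_split; apply: eq_bigr => i _; rewrite mxE mulrDl.
Qed.

Lemma scalZl n a (u w : 'rV[R]_n) : scal (a *: u) w = a * scal u w.
Proof. by rewrite /scal mulr_sumr; apply: eq_bigr => i _; rewrite mxE mulrA. Qed.

Lemma scalNl n (u w : 'rV[R]_n) : scal (- u) w = - scal u w.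
Proof. by rewrite -scaleN1r scalZl mulN1r. Qed.

Lemma scalBl n (u v w : 'rV[R]_n) : scal (u - v) w = scal u w - scal v w.
Proof. by rewrite scalDl scalNl. Qed.

Lemma scalDr n (u v w : 'rV[R]_n) : scal w (u + v) = scal w u + scal w v.
Proof. by rewrite scalC scalDl !(scalC w). Qed.

Lemma scalZr n a (u w : 'rV[R]_n) : scal w (a *: u) = a * scal w u.
Proof. by rewrite scalC scalZl (scalC w). Qed.

Lemma scalBr n (u v w : 'rV[R]_n) : scal w (u - v) = scal w u - scal w v.
Proof. by rewrite scalC scalBl !(scalC w). Qed.

Lemma scal0l n (w : 'rV[R]_n) : scal 0 w = 0.
Proof. by rewrite /scal big1// => i _; rewrite mxE mul0r. Qed.

Lemma scal_basis1 n (u : 'rV[R]_n) i : scal u (basis1 i) = u 0 i.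
Proof.
rewrite /scal (bigD1 i)//= big1 ?addr0.
  by rewrite /basis1 mxE !eqxx mulr1.
by move=> j ji; rewrite /basis1 mxE (negbTE ji) andbF mulr0.
Qed.

Lemma norm_basis1 n (i : 'I_n) : `|basis1 i : 'rV[R]_n| <= 1.
Proof.
apply: norm_le_entries => // j; rewrite mxE eqxx /=.
by case: (j == i); rewrite ?normr1 ?normr0.
Qed.

(** The Euclidean norm dominates the supremum norm. *)
Lemma norm_sq_le_scal n (v : 'rV[R]_n) : `|v| ^+ 2 <= scal v v.
Proof.
have s0 : 0 <= scal v v by apply: sumr_ge0 => i _; rewrite -expr2 sqr_ge0.
have [->|v0] := eqVneq `|v| 0; first by rewrite expr0n.
have [i ->] : exists i, `|v| = `|v 0 i|.
  by apply: norm_attained; rewrite lt_neqAle eq_sym v0 normr_ge0.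
rewrite real_normK ?num_real// /scal (bigD1 i)//= -expr2 lerDl.
by apply: sumr_ge0 => j _; rewrite -expr2 sqr_ge0.
Qed.

Lemma scal_self_eq0 n (v : 'rV[R]_n) : scal v v = 0 -> v = 0.
Proof.
move=> v0; apply/eqP; rewrite -normr_eq0 -sqrf_eq0 eq_le sqr_ge0 andbT.
by rewrite (le_trans (norm_sq_le_scal v))// v0.
Qed.

End Vectors.

(** * Calculus on the real line *)

Section Calculus.
Context {R : realType}.

Lemma is_derive_continuous (f : R -> R) (x df : R) :
  is_derive x 1 f df -> {for x, continuous f}.
Proof. by move=> [fx _]; exact/differentiable_continuous/derivable1_diffP. Qed.

Lemma mean_value (f df : R -> R) (a b : R) :
  a <= b -> (forall x, a <= x <= b -> is_derive x 1 f (df x)) ->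
  exists2 c, a <= c <= b & f b - f a = df c * (b - a).
Proof.
move=> ab fdf; have [||c cab ->] := @MVT_segment _ f df a b ab.
- by move=> x; rewrite in_itv/= => /andP[/ltW ax /ltW xb]; apply: fdf; rewrite ax.
- apply: derivable_within_continuous => x; rewrite in_itv/= => xab.
  by have [] := fdf _ xab.
- by exists c.
Qed.

Lemma mean_value_le (f df : R -> R) (M a b : R) :
  a <= b -> (forall x, a <= x <= b -> is_derive x 1 f (df x)) ->
  (forall x, a <= x <= b -> `|df x| <= M) -> `|f b - f a| <= M * (b - a).
Proof.
move=> ab fdf dfM; have [c cab ->] := mean_value ab fdf.
by rewrite normrM (ger0_norm (_ : 0 <= b - a)) ?subr_ge0// ler_wpM2r ?subr_ge0// dfM.
Qed.

Lemma lipschitz_of_derive (f df : R -> R) (M : R) :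
  (forall x : R, is_derive x 1 f (df x)) -> (forall x, `|df x| <= M) ->
  forall x y, `|f x - f y| <= M * `|x - y|.
Proof.
move=> fdf dfM x y; wlog xy : x y / y <= x.
  move=> h; case: (leP y x) => [|/ltW] /h//.
  by rewrite distrC (distrC x).
by rewrite [`|x - y|]ger0_norm ?subr_ge0//; apply: (mean_value_le (df := df)).
Qed.

Lemma homo_of_derive_ge0 (f df : R -> R) :
  (forall x : R, is_derive x 1 f (df x)) -> (forall x, 0 <= df x) ->
  {homo f : x y / x <= y}.
Proof.
move=> fdf df0 x y xy; rewrite -subr_ge0.
have [c _ ->] := @mean_value f df x y xy (fun z _ => fdf z).
by rewrite mulr_ge0// subr_ge0.
Qed.

(** A quadratic first-order error is the form in which derivatives pass to
    uniform limits and to the components of a vector. *)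
Lemma is_derive_of_quadratic {V : normedModType R} (f : R -> V) (t C : R) (v : V) :
  (forall s, `|f (t + s) - f t - s *: v| <= C * s ^+ 2) -> is_derive t 1 f v.
Proof.
move=> fC.
have C0 : 0 <= C.
  by have := le_trans (normr_ge0 _) (fC 1); rewrite expr1n mulr1.
suff cv : h^-1 *: (f (h *: (1:R) + t) - f t) @[h --> 0^'] --> v.
  by split; [apply/cvg_ex; exists v|apply: cvg_lim].
apply/cvgrPdist_le => e e0; near=> h.
have h0 : h != 0 by near: h; exact: nbhs_dnbhs_neq.
have -> : v - h^-1 *: (f (h *: (1:R) + t) - f t) =
    - (h^-1 *: (f (t + h) - f t - h *: v)).
  rewrite [h *: 1]mulr1 (addrC h t) (scalerBr _ _ (h *: v)) scalerA mulVf//.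
  by rewrite scale1r opprB.
rewrite normrN normrZ normfV ler_pdivrMl ?normr_gt0//.
apply: (le_trans (fC h)).
rewrite -(real_normK (num_real h)) expr2 mulrA mulrC ler_wpM2l//.
apply: (@le_trans _ _ ((C + 1) * `|h|)); first by rewrite ler_wpM2r// lerDl.
rewrite -ler_pdivlMl; last by rewrite ltr_wpDl.
near: h; apply: dnbhs0_le.
by apply: mulr_gt0 => //; rewrite invr_gt0; apply: ltr_wpDl.
Unshelve. all: by end_near. Qed.

Lemma is_derive_translate (f : R -> R) (t r v : R) :
  is_derive (t - r) 1 f v -> is_derive t 1 (fun s => f (s - r)) v.
Proof.
move=> [fd fv].
have e : (fun h : R => h^-1 *: (((fun s => f (s - r)) \o shift t) (h *: (1:R)) - f (t - r)))
    = (fun h : R => h^-1 *: ((f \o shift (t - r)) (h *: (1:R)) - f (t - r))).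
  by apply/funext => h /=; rewrite addrA.
split; first by rewrite /derivable e.
by rewrite -fv /derive e.
Qed.

Lemma is_derive_opp_arg (f : R -> R) (t v : R) :
  is_derive (- t) 1 f v -> is_derive t 1 (fun s => f (- s)) (- v).
Proof.
move=> fv; have -> : - v = v * -1 by rewrite mulrN1.
exact: (@is_derive1_comp _ f (fun s => - s)).
Qed.

Lemma is_derive_wsum m (w : 'I_m -> R) (f : 'I_m -> R -> R) (t : R) (df : 'I_m -> R) :
  (forall j, is_derive t 1 (f j) (df j)) ->
  is_derive t 1 (fun s => \sum_j w j * f j s) (\sum_j w j * df j).
Proof.
move=> fdf.
have -> : (fun s => \sum_j w j * f j s) = \sum_j (w j \*: f j).
  by apply/funext => s; rewrite fct_sumE.
apply: is_derive_sum => j; have -> : w j * df j = w j *: df j by [].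
Qed.

Lemma integrable_itv (f : R -> R) a b : continuous f ->
  lebesgue_measure.-integrable `[a, b] (EFin \o f).
Proof.
move=> cf; apply: continuous_compact_integrable; first exact: segment_compact.
exact: continuous_subspaceT.
Qed.

(** The integral from [-1] has derivative [f] beyond [-1], and it vanishes on the
    negative axis. *)
Lemma half_primitive (f : R -> R) : continuous f -> (forall x, x <= 0 -> f x = 0) ->
  exists F : R -> R, forall t : R, is_derive t 1 F (f t).
Proof.
move=> cf f0; pose F t := (\int[lebesgue_measure]_(s in `[-1, t]) f s).
exists F => t; have [t1|t1] := ltP (-1) t.
  have tt1 : t < t + 1 by rewrite ltrDl.
  have [Fd Ff] := continuous_FTC1_closed tt1 (integrable_itv (-1) (t + 1) cf) t1 (cf t).
  by split=> //; rewrite -derive1E.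
have -> : f t = 0 by apply: f0; lra.
have F0 x : x < 0 -> F x = 0.
  move=> x0; rewrite /F [X in _ = X](_ : 0 = \int[lebesgue_measure]_(s in `[-1, x]) cst 0 s).
    apply: eq_Rintegral => s; rewrite inE/= in_itv/= => /andP[_ sx].
    by apply: f0; lra.
  by rewrite Rintegral_cst//= mul0r.
apply: (@near_eq_is_derive _ _ _ (cst 0)).
by near=> x; rewrite F0//=; near: x; apply: lt_nbhsl; lra.
Unshelve. all: by end_near. Qed.

(** [f] is the sum of a constant and of two functions vanishing on a half-line. *)
Lemma exists_primitive (f : R -> R) : continuous f ->
  exists F : R -> R, forall t : R, is_derive t 1 F (f t).
Proof.
move=> cf.
have cmax : continuous (fun x : R => Num.max x 0).
  by move=> x; apply: continuous_max; [exact: cvg_id|exact: cvg_cst].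
pose f1 x := f (Num.max x 0) - f 0; pose f2 x := f (- Num.max x 0) - f 0.
have [||F1 dF1] := @half_primitive f1.
- move=> x; apply: cvgB; last exact: cvg_cst.
  exact: (continuous_comp (cmax x) (cf _)).
- by move=> x x0; rewrite /f1 max_r// subrr.
have [||F2 dF2] := @half_primitive f2.
- move=> x; apply: cvgB; last exact: cvg_cst.
  have cNmax : {for x, continuous (fun x : R => - Num.max x 0)}.
    exact: cvgN (cmax x).
  exact: (continuous_comp cNmax (cf _)).
- by move=> x x0; rewrite /f2 max_r// oppr0 subrr.
exists (F1 - (F2 \o -%R) + f 0 \*: id) => t.
have -> : f t = f1 t - - f2 (- t) + f 0 *: 1.
  rewrite /f1 /f2 [_ *: 1]mulr1; have [t0|/ltW t0] := leP 0 t.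
    by rewrite max_r ?oppr_le0// oppr0; ring.
  by rewrite max_l ?oppr_ge0// (opprK t); ring.
apply: is_deriveD; apply: is_deriveB.
exact: is_derive_opp_arg.
Qed.

Lemma Rintegral_of_primitive (f F : R -> R) (a b : R) : a < b -> continuous f ->
  (forall t : R, is_derive t 1 F (f t)) ->
  \int[lebesgue_measure]_(s in `[a, b]) f s = F b - F a.
Proof.
move=> ab cf dF; rewrite /Rintegral.
rewrite (@continuous_FTC2 R f F a b ab)//.
- exact: continuous_subspaceT.
- have cF x : {for x, continuous F} := is_derive_continuous (dF x).
  split=> [x _||]; first by have [] := dF x.
  + by apply: cvg_at_right_filter; exact: cF.
  + by apply: cvg_at_left_filter; exact: cF.
- by move=> x _; rewrite derive1E derive_val.
Qed.

End Calculus.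

(** * Bounded Lipschitz vector fields have global solutions *)

Section Flow.
Context {R : realType}.

Lemma mean_value_from0 (f df : R -> R) (M s : R) :
  (forall r : R, is_derive r 1 f (df r)) ->
  (forall r, `|r| <= `|s| -> `|df r| <= M) -> `|f s - f 0| <= M * `|s|.
Proof.
move=> fdf dfM; have [s0|/ltW s0] := leP 0 s.
  rewrite (ger0_norm s0) -{2}(subr0 s).
  apply: (mean_value_le (df := df)) => // x /andP[x0 xs].
  by rewrite dfM// !ger0_norm// (le_trans x0).
rewrite (ler0_norm s0) distrC -(sub0r s).
apply: (mean_value_le (df := df)) => // x /andP[sx x0].
by rewrite dfM// !ler0_norm// ?lerN2// (le_trans sx).
Qed.

Lemma exists_half_pow_lt (C e : R) : 0 < e -> exists k, C / 2 ^+ k < e.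
Proof.
move=> e0; exists (Num.bound `|C / e|).
rewrite ltr_pdivrMr ?exprn_gt0// mulrC -ltr_pdivrMr//.
apply: (le_lt_trans (ler_norm _)).
apply: (lt_le_trans (archi_boundP (normr_ge0 _))).
by rewrite -natrX ler_nat; apply/ltnW/ltn_expl.
Qed.

Lemma le_of_half_pow (A D C : R) : (forall k, A <= D + C / 2 ^+ k) -> A <= D.
Proof.
move=> h; rewrite leNgt; apply/negP => DA.
have [|k Ck] := @exists_half_pow_lt C (A - D); first by rewrite subr_gt0.
by have := h k; lra.
Qed.

(** The limit is the supremum of the lower bounds [a k - 2 * c / 2 ^+ k]. *)
Lemma geometric_limit (a : nat -> R) (c : R) :
  (forall k, `|a k.+1 - a k| <= c / 2 ^+ k) ->
  exists l, forall k, `|a k - l| <= 2 * c / 2 ^+ k.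
Proof.
move=> ac; pose b k := 2 * c / 2 ^+ k.
have bS k : b k.+1 = b k - c / 2 ^+ k.
  by rewrite /b exprS; field; rewrite expf_neq0.
have lo : {homo (fun k => a k - b k) : j k / (j <= k)%N >-> j <= k}.
  apply: homo_leq => [//|y x z|k]; first exact: le_trans.
  by have := ac k; rewrite bS ler_norml => /andP[]; lra.
have hi : {homo (fun k => a k + b k) : j k / (j <= k)%N >-> k <= j}.
  apply: homo_leq => [//|y x z xy yz|k]; first exact: le_trans yz xy.
  by have := ac k; rewrite bS ler_norml => /andP[]; lra.
have b0 k : 0 <= b k.
  have := le_trans (normr_ge0 _) (ac k); rewrite /b -mulrA => h.
  by rewrite mulr_ge0.
have lohi j k : a j - b j <= a k + b k.
  apply: (le_trans (lo _ _ (leq_maxl j k))).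
  apply: le_trans (hi _ _ (leq_maxr j k)).
  by have := b0 (maxn j k); lra.
exists (sup (range (fun j => a j - b j))) => k; rewrite -/(b k) ler_norml.
have ubk j : ubound (range (fun j => a j - b j)) (a j + b j).
  by move=> _ [i _ <-]; exact: lohi.
have h1 : a k - b k <= sup (range (fun j => a j - b j)).
  by apply: ub_le_sup; [exists (a 0%N + b 0%N); exact: ubk|exists k].
have h2 : sup (range (fun j => a j - b j)) <= a k + b k.
  by apply: ge_sup; [exists (a 0%N - b 0%N), 0%N|exact: ubk].
by apply/andP; split; lra.
Qed.

(** Here [E] is [2 cosh (2 L t)]. Weighted by [E], the Picard operator of an
    [L]-Lipschitz field halves distances on the whole line at once, so that no
    local solutions have to be glued. *)
Lemma derive_cosh_weight (L : R) : 0 < L ->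
  exists E : R -> R, [/\ forall t, 1 <= E t &
    forall (f df : R -> R) (a : R), (forall t : R, is_derive t 1 f (df t)) ->
      (forall t, `|df t| <= a * E t) -> f 0 = 0 ->
      forall t, `|f t| <= a * E t / (2 * L)].
Proof.
move=> L0; pose E t := expR (2 * L * t) + expR (- (2 * L) * t).
pose S t := (2 * L)^-1 * expR (2 * L * t) - (2 * L)^-1 * expR (- (2 * L) * t).
have dexp (k t : R) : is_derive t 1 (fun s => expR (k * s)) (expR (k * t) * k).
  apply: (@is_derive1_comp _ expR ( *%R k)).
  by rewrite -[X in is_derive _ _ _ X]mulr1; exact: (@is_deriveZ _ _ _ id).
have dS (t : R) : is_derive t 1 S (E t).
  have -> : S = (2 * L)^-1 \*: (fun s => expR (2 * L * s)) -
                (2 * L)^-1 \*: (fun s => expR (- (2 * L) * s)) by [].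
  apply: is_derive_eq.
  have sE (a b : R) : a *: b = a * b by [].
  by rewrite !sE /E; field; rewrite gt_eqF.
exists E; split=> [t|f df a fdf dfa f0 t].
  rewrite /E; have [t0|/ltW t0] := leP 0 t.
    rewrite -[leLHS]addr0 lerD ?expR_ge0// -expR0 ler_expR.
    by rewrite !mulr_ge0// ltW.
  rewrite -[leLHS]add0r lerD ?expR_ge0// -expR0 ler_expR mulNr oppr_ge0.
  by rewrite mulr_ge0_le0// mulr_ge0// ltW.
have a0 : 0 <= a.
  have := le_trans (normr_ge0 _) (dfa 0); rewrite pmulr_lge0//.
  by rewrite /E addr_gt0// expR_gt0.
have S0 : S 0 = 0 by rewrite /S !mulr0 expR0 subrr.
have SE : `|S t| <= E t / (2 * L).
  rewrite ler_norml /S /E mulrDl !(mulrC _^-1).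
  have p1 : 0 <= expR (2 * L * t) / (2 * L).
    by rewrite divr_ge0 ?expR_ge0// mulr_ge0// ltW.
  have p2 : 0 <= expR (- (2 * L) * t) / (2 * L).
    by rewrite divr_ge0 ?expR_ge0// mulr_ge0// ltW.
  by apply/andP; split; lra.
have daS (s : R) : is_derive s 1 (a \*: S) (a * E s) by exact: is_deriveZ.
have mono1 : {homo (a \*: S - f) : x y / x <= y}.
  apply: (@homo_of_derive_ge0 _ _ (fun s => a * E s - df s)) => s.
  by have := dfa s; rewrite ler_norml => /andP[]; lra.
have mono2 : {homo (a \*: S + f) : x y / x <= y}.
  apply: (@homo_of_derive_ge0 _ _ (fun s => a * E s + df s)) => s.
  by have := dfa s; rewrite ler_norml => /andP[]; lra.
have e1 s : (a \*: S - f) s = a * S s - f s by [].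
have e2 s : (a \*: S + f) s = a * S s + f s by [].
rewrite -mulrA; apply: le_trans (ler_wpM2l a0 SE).
rewrite -[X in X * `|S t|](ger0_norm a0) -normrM.
have [t0|/ltW t0] := leP 0 t.
  have := mono1 _ _ t0; have := mono2 _ _ t0; rewrite !e1 !e2 S0 f0.
  rewrite mulr0 addr0 subr0 => h1 h2.
  by rewrite (ger0_norm (_ : 0 <= a * S t)) ?ler_norml; [apply/andP; split|]; lra.
have := mono1 _ _ t0; have := mono2 _ _ t0; rewrite !e1 !e2 S0 f0.
rewrite mulr0 addr0 subr0 => h1 h2.
by rewrite (ler0_norm (_ : a * S t <= 0)) ?ler_norml; [apply/andP; split|]; lra.
Qed.

Section Picard.
Variables (m : nat) (X : 'rV[R]_m -> 'rV[R]_m) (x0 : 'rV[R]_m) (L M : R).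
Hypotheses (L0 : 0 < L) (XM : forall x, `|X x| <= M).
Hypothesis XL : forall x y, `|X x - X y| <= L * `|x - y|.

Let lip (y : R -> 'rV[R]_m) := forall s t, `|y s - y t| <= M * `|s - t|.

Let picard_image (y z : R -> 'rV[R]_m) := z 0 = x0 /\
  forall (t : R) i, is_derive t 1 (fun s => z s 0 i) (X (y t) 0 i).

Let M0 : 0 <= M. Proof. exact: le_trans (normr_ge0 _) (XM 0). Qed.

Let picard_lip y z : picard_image y z -> lip z.
Proof.
move=> [_ dz] s t; apply: norm_le_entries => [|i].
  by rewrite mulr_ge0.
rewrite !mxE; apply: (lipschitz_of_derive (dz^~ i)) => r.
exact: le_trans (entry_le_norm _ _) (XM _).
Qed.

Let lip_field y : lip y ->
  forall s t, `|X (y s) - X (y t)| <= L * (M * `|s - t|).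
Proof.
by move=> ly s t; rewrite (le_trans (XL _ _))// ler_wpM2l// ltW.
Qed.

Let picard_step y : lip y -> exists z, picard_image y z.
Proof.
move=> ly.
have cX i : continuous (fun t => X (y t) 0 i).
  move=> t; apply/cvgrPdist_le => e e0; near=> s.
  have := entry_le_norm (X (y t) - X (y s)) i; rewrite !mxE => /le_trans; apply.
  apply: (le_trans (lip_field ly t s)); rewrite mulrA.
  apply: (@le_trans _ _ ((L * M + 1) * `|t - s|)); first by rewrite ler_wpM2r// lerDl.
  rewrite mulrC -ler_pdivlMr; last by rewrite ltr_wpDl// mulr_ge0// ltW.
  near: s; apply: cvgr_dist_le; first exact: cvg_id.
  by rewrite divr_gt0// ltr_wpDl// mulr_ge0// ltW.
have [F dF] := choice (fun i => exists_primitive (cX i)).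
exists (fun t => \row_i (x0 0 i + (F i t - F i 0))); split.
  by apply/rowP => i; rewrite mxE subrr addr0.
move=> t i.
have -> : (fun s => (\row_i (x0 0 i + (F i s - F i 0))) 0 i) =
          cst (x0 0 i - F i 0) + F i.
  by apply/funext => s; rewrite mxE /= [RHS]/(_ + _) addrA addrAC.
rewrite -[X in is_derive _ _ _ X]add0r; exact: is_deriveD.
Unshelve. all: by end_near. Qed.

Let picard_contract y1 y2 z1 z2 (E : R -> R) :
  (forall (f df : R -> R) (a : R), (forall t : R, is_derive t 1 f (df t)) ->
      (forall t, `|df t| <= a * E t) -> f 0 = 0 ->
      forall t, `|f t| <= a * E t / (2 * L)) ->
  forall c, (forall t, `|X (y1 t) - X (y2 t)| <= c * E t) ->
  picard_image y1 z1 -> picard_image y2 z2 ->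
  forall t, `|z1 t - z2 t| <= c * E t / (2 * L).
Proof.
move=> hE c yc [z10 dz1] [z20 dz2] t; apply: norm_le_entries => [|i].
  apply: divr_ge0; first exact: le_trans (normr_ge0 _) (yc t).
  by rewrite mulr_ge0// ltW.
have -> : (z1 t - z2 t) 0 i =
   ((fun s => z1 s 0 i) - (fun s => z2 s 0 i)) t by rewrite !mxE.
apply: (hE _ (fun s => (X (y1 s) - X (y2 s)) 0 i)) => [s|s|].
- by rewrite !mxE; apply: is_deriveB.
- exact: le_trans (entry_le_norm _ _) (yc s).
- by rewrite -[LHS]/(z1 0 0 i - z2 0 0 i) z10 z20 subrr.
Qed.

(** The iterates satisfy [u (t + s) - u t = s *: X (u' t) + O(s ^ 2)] uniformly,
    with [u'] the previous iterate; this inequality passes to the pointwise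
    limit and is differentiability there. *)
Theorem global_flow : exists x : R -> 'rV[R]_m,
  x 0 = x0 /\ forall t : R, is_derive t 1 x (X (x t)).
Proof.
have /choice[step stepP] : forall y, exists z, lip y -> picard_image y z.
  move=> y.
  have [ly|nly] := pselect (lip y); last by exists y.
  by have [z] := picard_step ly; exists z.
pose u k := iter k step (cst x0).
have ulip k : lip (u k).
  elim: k => [|k IH]; last exact: picard_lip (stepP _ IH).
  by move=> s t; rewrite subrr normr0 mulr_ge0.
have uP k : picard_image (u k) (u k.+1) by exact: stepP.
have [E [E1 hE]] := derive_cosh_weight L0.
have E0 t : 0 <= E t by exact: le_trans (E1 t).
pose B := M / (2 * L).
have B0 : 0 <= B by rewrite divr_ge0// mulr_ge0// ltW.
have uS k t : `|u k.+1 t - u k t| <= B * E t / 2 ^+ k.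
  elim: k t => [|k IH] t.
    rewrite expr0 divr1 /B mulrAC; apply: norm_le_entries => [|i].
      by rewrite divr_ge0 ?mulr_ge0// ltW.
    have [u10 du1] := uP 0%N.
    have -> : (u 1%N t - u 0%N t) 0 i =
      ((fun s => u 1%N s 0 i) - cst (x0 0 i)) t by rewrite !mxE.
    apply: (hE _ (fun s => X (u 0%N s) 0 i - 0)) => [s|].
    - rewrite subr0 (le_trans (entry_le_norm _ _))// (le_trans (XM _))//.
      by rewrite ler_peMr.
    - by rewrite -[LHS]/(u 1%N 0 0 i - x0 0 i) u10 subrr.
  have -> : B * E t / 2 ^+ k.+1 = (L * (B / 2 ^+ k)) * E t / (2 * L).
    by rewrite exprS; field; rewrite gt_eqF//= expf_neq0.
  apply: (picard_contract hE _ (uP k.+1) (uP k)) => s.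
  apply: (le_trans (XL _ _)); rewrite -(mulrA L) ler_wpM2l ?(ltW L0)//.
  by rewrite mulrAC.
have /choice[l lP] : forall t, exists l : 'rV[R]_m,
    forall k, `|u k t - l| <= 2 * (B * E t) / 2 ^+ k.
  move=> t; have /choice[l lP] : forall i, exists l : R,
      forall k, `|u k t 0 i - l| <= 2 * (B * E t) / 2 ^+ k.
    move=> i; apply: geometric_limit => k.
    have := entry_le_norm (u k.+1 t - u k t) i; rewrite !mxE => /le_trans; apply.
    exact: uS.
  exists (\row_i l i) => k; apply: norm_le_entries => [|i]; last by rewrite !mxE; exact: lP.
  apply: divr_ge0; last exact: exprn_ge0.
  exact: mulr_ge0 (ler0n _ 2) (mulr_ge0 B0 (E0 t)).
exists l; split.
  apply/eqP; rewrite -subr_eq0 -normr_le0; apply: (@le_of_half_pow _ _ (B * E 0)) => k.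
  rewrite add0r distrC; have [u0 _] := uP k; have := lP 0 k.+1; rewrite u0.
  have -> : 2 * (B * E 0) / 2 ^+ k.+1 = (B * E 0) / 2 ^+ k.
    by rewrite exprS; field; rewrite expf_neq0.
  by [].
move=> t; apply: (@is_derive_of_quadratic _ _ _ _ (L * M)) => s.
pose C := B * E (t + s) + B * E t + `|s| * (L * (2 * (B * E t))).
apply: (@le_of_half_pow _ _ C) => k.
have q : `|u k.+1 (t + s) - u k.+1 t - s *: X (u k t)| <= L * M * s ^+ 2.
  apply: norm_le_entries => [|i]; first by apply: mulr_ge0 (sqr_ge0 s); apply: mulr_ge0 M0; exact: ltW.
  have [_ du] := uP k.
  pose g r := u k.+1 (r - - t) 0 i - r * X (u k t) 0 i.
  have -> : (u k.+1 (t + s) - u k.+1 t - s *: X (u k t)) 0 i = g s - g 0.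
    by rewrite /g !mxE !opprK add0r mul0r subr0 (addrC s) addrAC.
  rewrite -(real_normK (num_real s)) expr2 mulrA.
  apply: (@mean_value_from0 g (fun r => X (u k (r - - t)) 0 i - X (u k t) 0 i)).
    move=> r; have dsh := @is_derive_translate _ (fun z => u k.+1 z 0 i) r (- t) _ (du _ i).
    have -> : g = (fun r => u k.+1 (r - - t) 0 i) - X (u k t) 0 i \*: id.
      by apply/funext => z; rewrite /g [RHS]/(_ - _) /= mulrC.
    apply: is_deriveB; rewrite -[X in is_derive _ _ _ X]mulr1.
    exact: is_deriveZ.
  move=> r rs; have := entry_le_norm (X (u k (r - - t)) - X (u k t)) i.
  rewrite !mxE => /le_trans; apply.
  apply: (le_trans (lip_field (ulip k) _ _)).
  by rewrite !opprK addrK -mulrA !ler_wpM2l// ltW.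
have -> : l (t + s) - l t - s *: X (l t) =
   (u k.+1 (t + s) - u k.+1 t - s *: X (u k t)) - (u k.+1 (t + s) - l (t + s))
   + (u k.+1 t - l t) + s *: (X (u k t) - X (l t)).
  by rewrite scalerBr; apply/rowP => i; rewrite !mxE; ring.
have -> : L * M * s ^+ 2 + C / 2 ^+ k = L * M * s ^+ 2
   + 2 * (B * E (t + s)) / 2 ^+ k.+1 + 2 * (B * E t) / 2 ^+ k.+1
   + `|s| * (L * (2 * (B * E t) / 2 ^+ k)).
  by rewrite /C (exprS 2); field; rewrite expf_neq0.
apply: (le_trans (ler_normD _ _)); apply: lerD; last first.
  rewrite normrZ ler_wpM2l// (le_trans (XL _ _))// ler_wpM2l ?(ltW L0)//.
apply: (le_trans (ler_normD _ _)); apply: lerD => //.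
by apply: (le_trans (ler_normB _ _)); apply: lerD.
Qed.

End Picard.
End Flow.

(** * A positive trigonometric kernel and its exact quadrature *)

Section Kernel.
Context {R : realType}.

Lemma cosD_period (m : int) (x : R) : cos (x + 2 * pi * m%:~R) = cos x.
Proof.
have cn (k : nat) y : cos (y + 2 * pi * k%:R) = cos y :> R.
  rewrite -[RHS](periodicn (@cosD2pi R) k y); congr (cos (_ + _)).
  by rewrite -(mulr_natr (pi *+ 2) k) -(mulr_natl pi 2).
case: m => k; first by rewrite -[k%:~R]/(k%:R) cn.
by rewrite NegzE rmorphN/= mulrN -[LHS](cn k.+1) subrK.
Qed.

Lemma sinD_period (m : int) (x : R) : sin (x + 2 * pi * m%:~R) = sin x.
Proof.
rewrite -[LHS]opprK -[RHS]opprK -!cosDpihalf; congr (- _).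
by rewrite addrAC cosD_period.
Qed.

Lemma norm_sin_le (x : R) : `|sin x| <= `|x|.
Proof.
have := @mean_value_from0 R sin cos 1 x (fun r => is_derive_sin r).
rewrite sin0 subr0 mul1r; apply => r _; exact: cos_max.
Qed.

Lemma one_sub_cosE (x : R) : 1 - cos x = 2 * sin (x / 2) ^+ 2.
Proof.
rewrite {1}(_ : x = (x / 2) *+ 2); last by rewrite -mulr_natr; field.
by rewrite cos_mulr2n cos2sin2; ring.
Qed.

Lemma one_sub_cos_le (x : R) : 1 - cos x <= x ^+ 2 / 2.
Proof.
rewrite one_sub_cosE -(real_normK (num_real (sin _))).
apply: (@le_trans _ _ (2 * `|x / 2| ^+ 2)).
  by rewrite ler_wpM2l// lerXn2r ?nnegrE// norm_sin_le.
by rewrite real_normK ?num_real//; lra.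
Qed.

Lemma sub_sin_le (x : R) : `|x - sin x| <= x ^+ 2.
Proof.
have := @mean_value_from0 R (id - sin) (fun r => 1 - cos r) `|x| x.
have e z : (id - sin) z = z - sin z :> R by [].
rewrite !e sin0 !subr0.
rewrite -expr2 real_normK ?num_real//; apply => r rx.
rewrite ger0_norm ?subr_ge0 ?cos_le1// one_sub_cosE; apply: le_trans rx.
have h := norm_sin_le (r / 2); have h1 := sin_max (r / 2).
have := ler_pM (normr_ge0 _) (normr_ge0 _) h h1.
rewrite -expr2 real_normK ?num_real// normrM (ger0_norm (_ : 0 <= 2^-1))//.
by lra.
Qed.

(** A weak Jordan inequality: the mean value theorem with [cos >= 1/2] below [1],
    monotonicity of [sin] above. *)
Lemma sin_ge_quarter (y : R) : 0 <= y <= pi / 2 -> y / 4 <= sin y.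
Proof.
have small (z : R) : 0 <= z <= 1 -> z / 2 <= sin z.
  move=> /andP[z0 z1]; have [c /andP[c0 cz]] := @mean_value R sin cos 0 z z0 (fun r _ => is_derive_sin r).
  rewrite sin0 !subr0 => ->; rewrite mulrC ler_wpM2r//.
  have := one_sub_cos_le c; have : c ^+ 2 <= 1 by rewrite expr_le1//; lra.
  by lra.
move=> /andP[y0 ypi]; have [y1|/ltW y1] := leP y 1.
  by apply: le_trans (small y _); rewrite ?y0//; lra.
have pi2 := @pihalf_lt2 R.
have : sin 1 <= sin y.
  have p0 := @pi_gt0 R.
  have [->//|n1] := eqVneq y 1.
  apply: ltW; rewrite ltr_sin ?in_itv/=; first by rewrite lt_neqAle eq_sym n1.
    by apply/andP; split; lra.
  by apply/andP; split; lra.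
have := small 1; rewrite lexx ler01 => /(_ isT); lra.
Qed.

Lemma sq_le_one_sub_cos (c : R) : `|c| <= 2^-1 ->
  c ^+ 2 <= 2 * (1 - cos (2 * pi * c)).
Proof.
move=> ch; rewrite -(cos_norm (2 * pi * c)) normrM ger0_norm; last first.
  by rewrite mulr_ge0// pi_ge0.
rewrite -(real_normK (num_real c)); set b := `|c| in ch *.
have b0 : 0 <= b by rewrite /b.
have p2 := @pi_ge2 R; rewrite one_sub_cosE.
have -> : 2 * pi * b / 2 = pi * b by field.
have h : pi * b / 4 <= sin (pi * b).
  apply: sin_ge_quarter; rewrite mulr_ge0 ?pi_ge0//=.
  by rewrite ler_wpM2l ?pi_ge0.
have h2 : b / 2 <= sin (pi * b) by apply: le_trans h; nra.
by nra.
Qed.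

(** ** Averages of characters over the [N]-th roots of unity *)

(** Multiplied by twice the sine of half the step, the sum telescopes. *)
Lemma sum_cos_roots (N m : nat) (phi : R) : (0 < m < N)%N ->
  \sum_(p < N) cos (2 * pi * m%:R * (p%:R / N%:R) + phi) = 0.
Proof.
move=> /andP[m0 mN]; have N0 : N%:R != 0 :> R by rewrite pnatr_eq0 -lt0n (ltn_trans m0).
pose b : R := pi * (m%:R / N%:R).
have sb : 0 < sin b.
  have N0' : 0 < N%:R :> R by rewrite ltr0n (ltn_trans m0).
  apply: sin_gt0_pi; apply/andP; split.
    by rewrite mulr_gt0 ?pi_gt0// divr_gt0// ltr0n.
  by rewrite /b gtr_pMr ?pi_gt0// ltr_pdivrMr// mul1r ltr_nat.
apply: (mulIf (lt0r_neq0 sb)); apply: (mulfI (_ : 2 != 0 :> R)) => //.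
rewrite mul0r mulr0 mulr_suml mulr_sumr.
pose g p : R := sin (2 * b * p%:R - b + phi).
rewrite (eq_bigr (fun p : 'I_N => g p.+1 - g p)); last first.
  move=> p _; rewrite /g.
  have -> : 2 * pi * m%:R * (p%:R / N%:R) + phi = 2 * b * p%:R + phi.
    by rewrite /b; field.
  have -> : 2 * b * p.+1%:R - b + phi = (2 * b * p%:R + phi) + b.
    by rewrite -natr1; ring.
  have -> : 2 * b * p%:R - b + phi = (2 * b * p%:R + phi) - b by ring.
  by rewrite sinD sinB; ring.
rewrite -(big_mkord xpredT (fun p => g p.+1 - g p)) telescope_sumr// /g.
have -> : 2 * b * N%:R - b + phi = (2 * b * 0 - b + phi) + 2 * pi * m%:Z%:~R.
  by rewrite -[m%:Z%:~R]/(m%:R) /b; field.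
by rewrite sinD_period subrr.
Qed.

Lemma sum_cos_quadrature (N : nat) (m : int) (x phi : R) : (`|m| < N)%N ->
  \sum_(p < N) cos (2 * pi * m%:~R * (x - p%:R / N%:R) + phi) =
  (m == 0)%:R * (N%:R * cos phi).
Proof.
move=> mN; have [->|m0] := eqVneq m 0.
  under eq_bigr do rewrite mulr0 mul0r add0r.
  by rewrite sumr_const card_ord mul1r mulr_natl.
rewrite mul0r; case: m m0 mN => k k0 kN.
  rewrite -[k%:~R]/(k%:R) -[RHS](@sum_cos_roots N k (- (2 * pi * k%:R * x + phi))).
    by apply: eq_bigr => p _; rewrite -cosN; congr cos; ring.
  by rewrite lt0n k0.
rewrite NegzE rmorphN/= -[_%:~R]/(k.+1%:R).
rewrite -[RHS](@sum_cos_roots N k.+1 (- (2 * pi * k.+1%:R * x) + phi)).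
  by apply: eq_bigr => p _; congr cos; ring.
by move: kN; rewrite NegzE abszN absz_nat.
Qed.

(** ** The kernel *)

(** The first Dirichlet eigenvector of the discrete Laplacian: among profiles of
    this length it minimizes [1 - kernel_coef d 1], which is then of order
    [d ^- 2]. *)
Definition profile (d j : nat) : R := sin (pi * j.+1%:R / d.+2%:R).

Definition profile_mass (d : nat) : R := \sum_(j < d.+1) profile d j ^+ 2.

(** The squared modulus of the trigonometric polynomial with coefficients
    [profile d j], sampled at the points [x - p / N] and normalized to total mass
    [1]; the double sum is that square expanded. *)
Definition kernel_weight (d N : nat) (x : R) (p : nat) : R :=
  (N%:R * profile_mass d)^-1 * \sum_(j < d.+1) \sum_(l < d.+1)
    profile d j * profile d l *
      cos (2 * pi * (j%:Z - l%:Z)%:~R * (x - p%:R / N%:R)).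

(** The Fourier coefficient of order [m] of the kernel. *)
Definition kernel_coef (d : nat) (m : int) : R :=
  (profile_mass d)^-1 * \sum_(j < d.+1) \sum_(l < d.+1)
    profile d j * profile d l *
      (((m + (j%:Z - l%:Z) == 0)%:R + (m - (j%:Z - l%:Z) == 0)%:R) / 2).

Lemma profile_mass_gt0 d : 0 < profile_mass d.
Proof.
rewrite /profile_mass big_ord_recl; apply: ltr_wpDr.
  by apply: sumr_ge0 => j _; exact: sqr_ge0.
rewrite exprn_gt0// /profile /= mulr1; apply: sin_gt0_pi.
rewrite divr_gt0 ?pi_gt0//= gtr_pMr ?pi_gt0// invf_lt1//.
by rewrite (_ : 1 = 1%:R)// ltr_nat.
Qed.

Lemma kernel_weight_ge0 d N x p : 0 <= kernel_weight d N x p.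
Proof.
rewrite /kernel_weight mulr_ge0//.
  by rewrite invr_ge0 mulr_ge0// ltW// profile_mass_gt0.
set y := x - _.
have -> : \sum_(j < d.+1) \sum_(l < d.+1) profile d j * profile d l *
      cos (2 * pi * (j%:Z - l%:Z)%:~R * y) =
   (\sum_(j < d.+1) profile d j * cos (2 * pi * j%:R * y)) ^+ 2 +
   (\sum_(j < d.+1) profile d j * sin (2 * pi * j%:R * y)) ^+ 2.
  rewrite !expr2 !mulr_suml -big_split; apply: eq_bigr => j _ /=.
  rewrite !mulr_sumr -big_split; apply: eq_bigr => l _ /=.
  have -> : 2 * pi * (j%:Z - l%:Z)%:~R * y = 2 * pi * j%:R * y - 2 * pi * l%:R * y.
    by rewrite rmorphB/= -[j%:Z%:~R]/(j%:R) -[l%:Z%:~R]/(l%:R); ring.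
  by rewrite cosB; ring.
by rewrite addr_ge0// sqr_ge0.
Qed.

(** The kernel times the harmonic [m] has degree below [N], where the mean over
    the grid is exact. *)
Lemma kernel_quadrature d N (m : int) (x phi : R) : (`|m| + d < N)%N ->
  \sum_(p < N) kernel_weight d N x p *
     cos (2 * pi * m%:~R * (x - p%:R / N%:R) + phi) = kernel_coef d m * cos phi.
Proof.
move=> mdN; have N0 : N%:R != 0 :> R by rewrite pnatr_eq0; lia.
have Z0 : profile_mass d != 0 by rewrite gt_eqF// profile_mass_gt0.
pose y p : R := x - p%:R / N%:R.
pose t (j l : 'I_d.+1) p := (N%:R * profile_mass d)^-1 *
  (profile d j * profile d l) * (cos (2 * pi * (j%:Z - l%:Z)%:~R * y p) *
     cos (2 * pi * m%:~R * y p + phi)).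
rewrite (eq_bigr (fun p : 'I_N => \sum_j \sum_l t j l p)); last first.
  move=> p _; rewrite /kernel_weight mulr_sumr mulr_suml; apply: eq_bigr => j _.
  by rewrite mulr_sumr mulr_suml; apply: eq_bigr => l _; rewrite /t /y; ring.
rewrite exchange_big /kernel_coef mulr_sumr mulr_suml; apply: eq_bigr => j _ /=.
rewrite exchange_big mulr_sumr mulr_suml; apply: eq_bigr => l _ /=.
have jl : (`|j%:Z - l%:Z| <= d)%N by have := ltn_ord j; have := ltn_ord l; lia.
pose K := (N%:R * profile_mass d)^-1 * (profile d j * profile d l) / 2.
rewrite (eq_bigr (fun p : 'I_N => K *
    (cos (2 * pi * (m + (j%:Z - l%:Z))%:~R * y p + phi) +
     cos (2 * pi * (m - (j%:Z - l%:Z))%:~R * y p + phi)))); last first.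
  move=> p _; rewrite /t /K [(m + _)%:~R]rmorphD [(m - _)%:~R]rmorphB /=.
  set u := (j%:Z - l%:Z)%:~R; set v := m%:~R.
  have -> : 2 * pi * (v + u) * y p + phi = (2 * pi * v * y p + phi) + 2 * pi * u * y p.
    by ring.
  have -> : 2 * pi * (v - u) * y p + phi = (2 * pi * v * y p + phi) - 2 * pi * u * y p.
    by ring.
  set B := 2 * pi * v * y p + phi; rewrite (cosD B) (cosB B).
  by field; rewrite N0 Z0.
rewrite -mulr_sumr big_split /= !sum_cos_quadrature; [|lia|lia].
by rewrite /K; field; rewrite Z0.
Qed.

Lemma kernel_coef_high d (m : int) : (d < `|m|)%N -> kernel_coef d m = 0.
Proof.
move=> dm; rewrite /kernel_coef big1 ?mulr0// => j _; rewrite big1// => l _.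
have := ltn_ord j; have := ltn_ord l => lj ll.
have -> : m + (j%:Z - l%:Z) == 0 = false by apply/eqP; lia.
have -> : m - (j%:Z - l%:Z) == 0 = false by apply/eqP; lia.
by rewrite addr0 mul0r mulr0.
Qed.

Lemma kernel_coef0 d : kernel_coef d 0 = 1.
Proof.
rewrite /kernel_coef -[RHS](mulVf (lt0r_neq0 (profile_mass_gt0 d))).
congr (_ * _); apply: eq_bigr => j _; rewrite (bigD1 j)//= big1 ?addr0.
  have -> : 0 + (j%:Z - j%:Z) == 0 by apply/eqP; lia.
  have -> : 0 - (j%:Z - j%:Z) == 0 by apply/eqP; lia.
  by rewrite -[true%:R]/(1 : R); field.
move=> l lj; have lj' : (l : nat) <> j by move=> e; case/eqP: lj; exact: val_inj.
have -> : 0 + (j%:Z - l%:Z) == 0 = false by apply/eqP; lia.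
have -> : 0 - (j%:Z - l%:Z) == 0 = false by apply/eqP; lia.
by rewrite addr0 mul0r mulr0.
Qed.

(** The profile is an eigenvector: the mean of its two neighbours is
    [cos (pi / d.+2)] times its value, the boundary terms being [sin 0] and
    [sin pi]. *)
Lemma kernel_coef1 d : kernel_coef d 1 = cos (pi / d.+2%:R).
Proof.
have Z0 := lt0r_neq0 (profile_mass_gt0 d).
apply: (mulfI Z0); rewrite /kernel_coef mulVKf// mulr_suml.
pose al (k : nat) : R := sin (pi * k%:R / d.+2%:R).
have d20 : d.+2%:R != 0 :> R by rewrite pnatr_eq0.
apply: eq_bigr => j _.
have up : \sum_(l < d.+1) profile d l * (1 + (j%:Z - l%:Z) == 0)%:R = al j.+2.
  have [jd|dj] := ltnP j.+1 d.+1.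
    rewrite (bigD1 (Ordinal jd))//= big1 ?addr0.
      by rewrite (_ : _ == 0 = true) ?mulr1//; apply/eqP; lia.
    move=> l lj; rewrite (_ : _ == 0 = false) ?mulr0//; apply/eqP => e.
    by case/eqP: lj; apply: val_inj => /=; lia.
  rewrite big1 => [|l _]; last first.
    by rewrite (_ : _ == 0 = false) ?mulr0//; apply/eqP; have := ltn_ord l; lia.
  have -> : j.+2 = d.+2 by have := ltn_ord j; lia.
  by rewrite /al mulfK// sinpi.
have down : \sum_(l < d.+1) profile d l * (1 - (j%:Z - l%:Z) == 0)%:R = al j.
  have jd := ltn_ord j; case: j jd {up} => -[|j] /= jd jd'.
    rewrite big1 => [|l _]; last first.
      by rewrite (_ : _ == 0 = false) ?mulr0//; apply/eqP; lia.
    by rewrite /al mulr0 mul0r sin0.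
  have jd2 : (j < d.+1)%N by lia.
  rewrite (bigD1 (Ordinal jd2))//= big1 ?addr0.
    by rewrite (_ : _ == 0 = true) ?mulr1//; apply/eqP; lia.
  move=> l lj; rewrite (_ : _ == 0 = false) ?mulr0//; apply/eqP => e.
  by case/eqP: lj; apply: val_inj => /=; lia.
have -> : profile d j ^+ 2 * cos (pi / d.+2%:R) =
    profile d j / 2 * (al j.+2 + al j).
  rewrite /al /profile.
  have -> : pi * j.+2%:R / d.+2%:R = pi * j.+1%:R / d.+2%:R + pi / d.+2%:R :> R.
    by rewrite -(natr1 j.+1); field.
  have -> : pi * j%:R / d.+2%:R = pi * j.+1%:R / d.+2%:R - pi / d.+2%:R :> R.
    by rewrite -(natr1 j); field.
  by rewrite sinD sinB; field.
rewrite -up -down -big_split mulr_sumr; apply: eq_bigr => l _ /=.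
by field.
Qed.

(** ** The moments of the kernel *)

Lemma kernel_sum1 d N (x : R) : (d < N)%N -> \sum_(p < N) kernel_weight d N x p = 1.
Proof.
move=> dN; have := @kernel_quadrature d N 0 x 0; rewrite kernel_coef0 cos0 mulr1.
rewrite absz0 => /(_ dN) h; rewrite -[RHS]h.
by apply: eq_bigr => p _; rewrite mulr0 mul0r addr0 cos0 mulr1.
Qed.

Lemma kernel_sin d N (x : R) : (d.+1 < N)%N ->
  \sum_(p < N) kernel_weight d N x p * sin (2 * pi * (x - p%:R / N%:R)) = 0.
Proof.
move=> dN; have := @kernel_quadrature d N 1 x (- (pi / 2)).
rewrite cosN cos_pihalf mulr0 add1n => /(_ dN) h; rewrite -[RHS]h.
by apply: eq_bigr => p _; rewrite mulr1 cosBpihalf.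
Qed.

Lemma kernel_one_sub_cos d N (x : R) : (d.+1 < N)%N ->
  \sum_(p < N) kernel_weight d N x p * (1 - cos (2 * pi * (x - p%:R / N%:R)))
  <= 8 / d.+1%:R ^+ 2.
Proof.
move=> dN; under eq_bigr do rewrite mulrBr mulr1.
rewrite sumrB kernel_sum1 ?(ltn_trans _ dN)//.
have := @kernel_quadrature d N 1 x 0; rewrite cos0 mulr1 kernel_coef1 add1n => /(_ dN).
under eq_bigr do rewrite mulr1 addr0.
move=> ->; apply: (le_trans (one_sub_cos_le _)).
have d1 : 0 < d.+1%:R :> R by rewrite ltr0n.
have d2 : 0 < d.+2%:R :> R by rewrite ltr0n.
have p4 := @pihalf_lt2 R; have p0 := @pi_gt0 R.
have h1 : pi ^+ 2 / 2 <= 8 :> R by nra.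
have h2 : d.+1%:R ^+ 2 <= d.+2%:R ^+ 2 :> R by rewrite lerXn2r ?nnegrE ?ler0n// ler_nat.
have -> : (pi / d.+2%:R) ^+ 2 / 2 = (pi ^+ 2 / 2) / d.+2%:R ^+ 2 :> R.
  by field; rewrite gt_eqF.
apply: ler_pM => //; first by rewrite divr_ge0// sqr_ge0.
by rewrite lef_pV2// posrE exprn_gt0.
Qed.

End Kernel.

(** * Trigonometric approximation on the torus *)

Section Trigonometric.
Context {R : realType}.

Local Notation intv k := (map_mx intr k).

(** Phases make the class closed under products without complex exponentials. *)
Inductive trigpoly n (b : 'I_n -> nat) : ('rV[R]_n -> R) -> Prop :=
| trigpoly_cos (c phi : R) (k : 'rV[int]_n) : (forall i, (`|k ord0 i| <= b i)%N) ->
    trigpoly b (fun th => c * cos (2 * pi * scal (intv k) th + phi))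
| trigpoly_add F G : trigpoly b F -> trigpoly b G -> trigpoly b (fun th => F th + G th).

Lemma trigpoly_weaken n (b b' : 'I_n -> nat) F :
  (forall i, (b i <= b' i)%N) -> trigpoly b F -> trigpoly b' F.
Proof.
move=> bb'; elim=> [c phi k kb|G H _ IG _ IH]; last exact: trigpoly_add.
by apply: trigpoly_cos => i; exact: leq_trans (kb i) (bb' i).
Qed.

Lemma trigpoly_cst n (b : 'I_n -> nat) c : trigpoly b (fun=> c).
Proof.
have := @trigpoly_cos n b c 0 0.
have -> : (fun th : 'rV[R]_n => c * cos (2 * pi * scal (intv (0 : 'rV[int]_n)) th + 0))
    = (fun=> c).
  by apply/funext => th; rewrite map_mx0 scal0l mulr0 addr0 cos0 mulr1.
by apply => i; rewrite mxE.
Qed.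

Lemma trigpoly_scale n (b : 'I_n -> nat) a F :
  trigpoly b F -> trigpoly b (fun th => a * F th).
Proof.
elim=> [c phi k kb|G H _ IG _ IH].
  have -> : (fun th => a * (c * cos (2 * pi * scal (intv k) th + phi))) =
    (fun th => (a * c) * cos (2 * pi * scal (intv k) th + phi)).
    by apply/funext => th; rewrite mulrA.
  exact: trigpoly_cos.
have -> : (fun th => a * (G th + H th)) = (fun th => a * G th + a * H th).
  by apply/funext => th; rewrite mulrDr.
exact: trigpoly_add.
Qed.

Lemma trigpoly_sum n (b : 'I_n -> nat) (J : Type) (r : seq J) (F : J -> 'rV[R]_n -> R) :
  (forall j, trigpoly b (F j)) -> trigpoly b (fun th => \sum_(j <- r) F j th).
Proof.
move=> bF; elim: r => [|j r IH].
  under eq_fun do rewrite big_nil; exact: trigpoly_cst.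
by under eq_fun do rewrite big_cons; exact: trigpoly_add.
Qed.

Lemma trigpoly_mul n (b b' : 'I_n -> nat) F F' :
  trigpoly b F -> trigpoly b' F' ->
  trigpoly (fun i => b i + b' i)%N (fun th => F th * F' th).
Proof.
elim=> [c phi k kb|G H _ IG _ IH] bF'; last first.
  have -> : (fun th => (G th + H th) * F' th) = (fun th => G th * F' th + H th * F' th).
    by apply/funext => th; rewrite mulrDl.
  by apply: trigpoly_add; [exact: IG|exact: IH].
elim: bF' => [c' phi' k' kb'|G H _ IG _ IH]; last first.
  set F1 := (fun th => c * cos (2 * pi * scal (intv k) th + phi)) in IG IH *.
  have -> : (fun th => F1 th * (G th + H th)) = (fun th => F1 th * G th + F1 th * H th).
    by apply/funext => th; rewrite mulrDr.
  exact: trigpoly_add.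
have -> : (fun th => c * cos (2 * pi * scal (intv k) th + phi) *
     (c' * cos (2 * pi * scal (intv k') th + phi'))) =
   (fun th => c * c' / 2 * cos (2 * pi * scal (intv (k + k')) th + (phi + phi')) +
     c * c' / 2 * cos (2 * pi * scal (intv (k - k')) th + (phi - phi'))).
  apply/funext => th; rewrite map_mxD map_mxB scalDl scalBl.
  set u := scal _ th; set v := scal _ th.
  have -> : 2 * pi * (u + v) + (phi + phi') = (2 * pi * u + phi) + (2 * pi * v + phi').
    by ring.
  have -> : 2 * pi * (u - v) + (phi - phi') = (2 * pi * u + phi) - (2 * pi * v + phi').
    by ring.
  set x := 2 * pi * u + phi; set y := 2 * pi * v + phi'.
  by rewrite (cosD x) (cosB x); field.
apply: trigpoly_add; apply: trigpoly_cos => i; rewrite !mxE;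
  by move: (k ord0 i) (k' ord0 i) (kb i) (kb' i) => a a'; lia.
Qed.

Lemma kernel_weight_trigpoly n d N (i : 'I_n) p :
  trigpoly (fun j => if j == i then d else 0%N) (fun th => kernel_weight d N (th 0 i) p).
Proof.
rewrite /kernel_weight; apply: trigpoly_scale.
apply: trigpoly_sum => j; apply: trigpoly_sum => l; apply: trigpoly_scale.
have := @trigpoly_cos n (fun j => if j == i then d else 0%N) 1
  (- (2 * pi * (j%:Z - l%:Z)%:~R * (p%:R / N%:R))) ((j%:Z - l%:Z) *: delta_mx 0 i).
set F1 := fun th : 'rV[R]_n => _; set F2 := fun th : 'rV[R]_n => _.
have -> : F1 = F2.
  apply/funext => th; rewrite /F1 /F2 mul1r map_mxZ scalZl map_delta_mx.
  by rewrite scalC scal_basis1; congr cos; ring.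
apply=> q; rewrite !mxE eqxx /=; have := ltn_ord j; have := ltn_ord l.
by case: (q == i) => /=; lia.
Qed.

Lemma kernel_weight_prod_trigpoly n d N (P : 'I_n -> nat) :
  trigpoly (fun=> d) (fun th => \prod_i kernel_weight d N (th 0 i) (P i)).
Proof.
have h (r : seq 'I_n) : trigpoly (fun j => (count_mem j r * d)%N)
    (fun th => \prod_(i <- r) kernel_weight d N (th 0 i) (P i)).
  elim: r => [|i r IH].
    under [X in trigpoly _ X]eq_fun do rewrite big_nil; exact: trigpoly_cst.
  under [X in trigpoly _ X]eq_fun do rewrite big_cons.
  apply: trigpoly_weaken (trigpoly_mul (kernel_weight_trigpoly _ _ _ _) IH) => j /=.
  by rewrite mulnDl eq_sym; case: (i == j); rewrite ?mul1n ?mul0n.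
apply: trigpoly_weaken (h _) => j; rewrite count_uniq_mem ?index_enum_uniq//.
by rewrite mem_index_enum mul1n.
Qed.

(** ** Product weights *)

Lemma sum_prod_weights n N (w : 'I_n -> 'I_N -> R) :
  (forall i, \sum_p w i p = 1) ->
  \sum_(P : {ffun 'I_n -> 'I_N}) \prod_i w i (P i) = 1.
Proof. by move=> w1; rewrite -bigA_distr_bigA big1. Qed.

Lemma sum_prod_marginal n N (w : 'I_n -> 'I_N -> R) (i : 'I_n) (g : 'I_N -> R) :
  (forall i, \sum_p w i p = 1) ->
  \sum_(P : {ffun 'I_n -> 'I_N}) (\prod_i w i (P i)) * g (P i) = \sum_p w i p * g p.
Proof.
move=> w1; pose w' j p := w j p * (if j == i then g p else 1).
rewrite (eq_bigr (fun P : {ffun 'I_n -> 'I_N} => \prod_j w' j (P j))); last first.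
  move=> P _; rewrite /w' big_split /=; congr (_ * _).
  rewrite (bigD1 i)//= eqxx big1 ?mulr1// => j /negbTE -> //.
rewrite -bigA_distr_bigA (bigD1 i)//= [X in _ * X]big1 ?mulr1 => [|j ji].
  by apply: eq_bigr => p _; rewrite /w' eqxx.
by rewrite -[RHS](w1 j); apply: eq_bigr => p _; rewrite /w' (negbTE ji) mulr1.
Qed.

Lemma exists_centered (x : R) : exists k : int, `|x + k%:~R| <= 2^-1.
Proof.
exists (- Num.floor (x + 2^-1)); rewrite rmorphN /=.
have := floor_le_tmp (x + 2^-1); have := floorD1_gt (x + 2^-1).
rewrite rmorphD /= ler_norml => h1 h2; apply/andP; split; lra.
Qed.

(** The second-order Jackson theorem. The sampling operator has positive
    weights, so that only its action on [1], [sin] and [1 - cos] in each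
    variable matters: the sines, odd, remove the linear Taylor term. *)
Theorem jackson n d (f : 'rV[R]_n -> R) (G : 'rV[R]_n -> 'rV[R]_n) (A : R) :
  (forall th (k : 'rV[int]_n), f (th + intv k) = f th) ->
  (forall x y, `|f (x + y) - f x - scal (G x) y| <= A * `|y| ^+ 2) ->
  (forall x, `|G x| <= 1) -> 0 <= A ->
  exists2 F, trigpoly (fun=> d) F &
    forall th, `|f th - F th| <= 16 * n%:R * (A + 8) / d.+1%:R ^+ 2.
Proof.
move=> fper fT G1 A0; pose N := d.+2.
pose pt (P : {ffun 'I_n -> 'I_N}) : 'rV[R]_n := \row_i ((P i)%:R / N%:R).
pose w (th : 'rV[R]_n) i (p : 'I_N) := kernel_weight d N (th 0 i) p.
exists (fun th : 'rV[R]_n => \sum_P f (pt P) * \prod_i w th i (P i)).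
  apply: trigpoly_sum => P; apply: trigpoly_scale.
  exact: kernel_weight_prod_trigpoly.
move=> th; have dN : (d.+1 < N)%N by [].
have w1 i : \sum_p w th i p = 1 by apply: kernel_sum1; rewrite /N; lia.
pose W (P : {ffun 'I_n -> 'I_N}) := \prod_i w th i (P i : 'I_N).
have W0 P : 0 <= W P by apply: prodr_ge0 => i _; exact: kernel_weight_ge0.
have W1 : \sum_P W P = 1 by exact: sum_prod_weights.
pose s (P : {ffun 'I_n -> 'I_N}) i : R := - sin (2 * pi * (th 0 i - (P i : 'I_N)%:R / N%:R)) / (2 * pi).
pose q (P : {ffun 'I_n -> 'I_N}) i : R := 2 * (1 - cos (2 * pi * (th 0 i - (P i : 'I_N)%:R / N%:R))).
have pi0 := @pi_gt0 R; have tau0 : 2 * pi != 0 :> R by rewrite gt_eqF// mulr_gt0.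
have step P : `|f (pt P) - f th - \sum_i G th 0 i * s P i| <= (A + 8) * \sum_i q P i.
  have /choice[k kP] := fun i => exists_centered ((P i)%:R / N%:R - th 0 i).
  pose y : 'rV[R]_n := \row_i ((P i)%:R / N%:R - th 0 i + (k i)%:~R).
  have -> : f (pt P) = f (th + y).
    rewrite -(fper (pt P) (\row_i k i)); congr f.
    by apply/rowP => i; rewrite !mxE; ring.
  have yq i : y 0 i ^+ 2 <= q P i.
    rewrite /q; have := sq_le_one_sub_cos (c := y 0 i); rewrite mxE => /(_ (kP i)).
    suff -> : cos (2 * pi * ((P i)%:R / N%:R - th 0 i + (k i)%:~R)) =
        cos (2 * pi * (th 0 i - (P i)%:R / N%:R)) by [].
    rewrite mulrDr cosD_period -cosN; congr cos; ring.
  have q0 i : 0 <= q P i by apply: le_trans (yq i); exact: sqr_ge0.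
  have ys i : `|y 0 i - s P i| <= 8 * q P i.
    have -> : s P i = sin (2 * pi * y 0 i) / (2 * pi).
      rewrite /s mxE [in RHS]mulrDr sinD_period -sinN; congr (sin _ / _); ring.
    have -> : y 0 i - sin (2 * pi * y 0 i) / (2 * pi) =
       (2 * pi * y 0 i - sin (2 * pi * y 0 i)) / (2 * pi).
      by rewrite mulrBl (mulrC (2 * pi) (y 0 i)) mulfK.
    rewrite normrM (ger0_norm (_ : 0 <= (2 * pi)^-1)); last first.
      by rewrite invr_ge0 mulr_ge0// ltW.
    rewrite ler_pdivrMr ?mulr_gt0//; apply: (le_trans (sub_sin_le _)).
    have -> : (2 * pi * y 0 i) ^+ 2 = (y 0 i ^+ 2) * (2 * pi) * (2 * pi) by ring.
    apply: ler_wpM2r; first by apply: mulr_ge0 => //; exact: ltW.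
    have p4 := @pihalf_lt2 R.
    apply: (@le_trans _ _ (y 0 i ^+ 2 * 8)).
      by rewrite ler_wpM2l ?sqr_ge0//; lra.
    by rewrite mulrC ler_wpM2l.
  have ysq : `|y| ^+ 2 <= \sum_i q P i.
    apply: (le_trans (norm_sq_le_scal _)); apply: ler_sum => i _.
    by rewrite -expr2.
  have -> : f (th + y) - f th - \sum_i G th 0 i * s P i =
      (f (th + y) - f th - scal (G th) y) + \sum_i G th 0 i * (y 0 i - s P i).
    have -> : \sum_i G th 0 i * (y 0 i - s P i) =
        scal (G th) y - \sum_i G th 0 i * s P i.
      by rewrite /scal -sumrB; apply: eq_bigr => i _; rewrite mulrBr.
    by rewrite addrA subrK.
  rewrite mulrDl; apply: (le_trans (ler_normD _ _)); apply: lerD.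
    by apply: (le_trans (fT _ _)); rewrite ler_wpM2l.
  apply: (le_trans (ler_norm_sum _ _ _)); rewrite mulr_sumr; apply: ler_sum => i _.
  rewrite normrM -[leRHS]mul1r; apply: ler_pM => //.
  exact: le_trans (entry_le_norm _ _) (G1 _).
have sum_s i : \sum_P W P * s P i = 0.
  rewrite (sum_prod_marginal i (fun p : 'I_N =>
     - sin (2 * pi * (th 0 i - p%:R / N%:R)) / (2 * pi)) w1).
  rewrite (eq_bigr (fun p : 'I_N => - (2 * pi)^-1 *
     (w th i p * sin (2 * pi * (th 0 i - p%:R / N%:R))))); last first.
    by move=> p _; rewrite mulNr; ring.
  by rewrite -mulr_sumr kernel_sin// mulr0.
have sum_q i : \sum_P W P * q P i <= 16 / d.+1%:R ^+ 2.
  rewrite (sum_prod_marginal i (fun p : 'I_N =>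
     2 * (1 - cos (2 * pi * (th 0 i - p%:R / N%:R)))) w1).
  under eq_bigr do rewrite mulrCA.
  rewrite -mulr_sumr; have := @kernel_one_sub_cos R d N (th 0 i) dN.
  by rewrite (_ : 16 = 2 * 8) -?mulrA ?ler_pM2l//; ring.
have -> : f th - \sum_P f (pt P) * \prod_i w th i (P i) =
   - \sum_P W P * (f (pt P) - f th - \sum_i G th 0 i * s P i).
  have -> : \sum_P W P * (f (pt P) - f th - \sum_i G th 0 i * s P i) =
     \sum_P W P * f (pt P) - \sum_P W P * f th
     - \sum_P \sum_i G th 0 i * (W P * s P i).
    rewrite -!sumrB; apply: eq_bigr => P _; rewrite !mulrBr; congr (_ - _).
    by rewrite mulr_sumr; apply: eq_bigr => i _; rewrite mulrCA.
  have -> : \sum_P \sum_i G th 0 i * (W P * s P i) = 0.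
    by rewrite exchange_big big1 //= => i _; rewrite -mulr_sumr sum_s mulr0.
  rewrite -mulr_suml W1 mul1r subr0 opprB; congr (_ - _).
  by apply: eq_bigr => P _; rewrite mulrC.
rewrite normrN; apply: (le_trans (ler_norm_sum _ _ _)).
apply: (@le_trans _ _ (\sum_P (A + 8) * \sum_i (W P * q P i))).
  apply: ler_sum => P _; rewrite normrM ger0_norm// -mulr_sumr mulrCA.
  by rewrite ler_wpM2l.
rewrite -mulr_sumr exchange_big /= mulrC.
have -> : 16 * n%:R * (A + 8) / d.+1%:R ^+ 2 = n%:R * (16 / d.+1%:R ^+ 2) * (A + 8).
  by ring.
rewrite ler_wpM2r ?addr_ge0// mulr_natl -[n in leRHS](card_ord n) -sumr_const.
by apply: ler_sum => i _.
Qed.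

End Trigonometric.

(** * Averages in time that remove all frequencies above a threshold *)

Section TimeAverage.
Context {R : realType}.

Local Notation intv k := (map_mx intr k).

Definition time_average n m (w r : 'I_m -> R) (omega : 'rV[R]_n)
  (F : 'rV[R]_n -> R) (th : 'rV[R]_n) : R := \sum_j w j * F (th - r j *: omega).

Lemma cos_lipschitz (x y : R) : `|cos x - cos y| <= `|x - y|.
Proof.
rewrite -[leRHS]mul1r; apply: (lipschitz_of_derive (df := fun x => - sin x)) => z.
by rewrite normrN sin_max.
Qed.

(** The delays are the multiples of [L / M] for a large [M], brought back between
    [- L / 2] and [L / 2] and weighted by the kernel at degree about [eta * L]. Frequencies off the grid
    of multiples of [1 / L] are moved to it at a cost that vanishes with [1 / L],
    whereas the mean delay stays of order [1 / eta]. *)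
Lemma high_frequency_killer (eta Lam L : R) : 0 < eta -> 1 <= eta * L ->
  exists m (w r : 'I_m -> R), [/\ forall j, 0 <= w j, \sum_j w j = 1,
    \sum_j w j * `|r j| <= 8 / eta &
    forall lam A, eta <= `|lam| <= Lam ->
      `|\sum_j w j * cos (A - 2 * pi * lam * r j)| <= 32 / (eta * L)].
Proof.
move=> eta0 etaL.
have L0 : 0 < L by rewrite -(pmulr_rgt0 L eta0); apply: lt_le_trans etaL.
pose T := Num.truncn (eta * L).
have etaL0 : 0 <= eta * L by apply: le_trans etaL.
have /andP[T1 T2] : T%:R <= eta * L < T.+1%:R by exact: truncn_itv.
have Tgt0 : (0 < T)%N.
  by rewrite -(ltr_nat R) -(ltrD2r 1) add0r natr1; apply: le_lt_trans T2.
pose d := T.-1; have dT : d.+1 = T by rewrite prednK.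
have T0 : 0 < T%:R :> R by rewrite ltr0n.
have T2' : eta * L <= 2 * T%:R.
  apply: (le_trans (ltW T2)); rewrite -natr1.
  by have : 1 <= T%:R :> R by [rewrite ler1n]; lra.
pose M := (d + Num.truncn (`|Lam| * L) + 3)%N.
have /choice[k kP] := fun p : 'I_M => exists_centered (0 - p%:R / M%:R : R).
pose c (p : 'I_M) := 0 - p%:R / M%:R + (k p)%:~R : R.
pose w (p : 'I_M) : R := kernel_weight d M 0 p.
have w0 p : 0 <= w p by exact: kernel_weight_ge0.
have w1 : \sum_p w p = 1 by apply: kernel_sum1; rewrite /M; lia.
have c2 : \sum_p w p * c p ^+ 2 <= 16 / T%:R ^+ 2.
  rewrite -dT; have := @kernel_one_sub_cos R d M 0.
  have -> : (d.+1 < M)%N by rewrite /M; lia.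
  move=> /(_ isT) h.
  apply: (@le_trans _ _ (2 * (8 / d.+1%:R ^+ 2))); last by rewrite mulrA -natrM.
  apply: le_trans (ler_wpM2l _ h); last by [].
  rewrite mulr_sumr; apply: ler_sum => p _; rewrite [leRHS]mulrCA ler_wpM2l//.
  have := sq_le_one_sub_cos (kP p); rewrite -/(c p) (mulrDr (2 * pi)).
  by rewrite cosD_period.
have c1 : \sum_p w p * `|c p| <= 4 / T%:R.
  (* pointwise, |c| <= 2/T + (T/8) c^2 *)
  apply: (@le_trans _ _ (\sum_p (2 / T%:R * w p + T%:R / 8 * (w p * c p ^+ 2)))).
    apply: ler_sum => p _; rewrite [X in _ + X]mulrCA (mulrC _ (w p)) -mulrDr.
    rewrite ler_wpM2l// -(real_normK (num_real (c p))).
    rewrite -subr_ge0; have -> : 2 / T%:R + T%:R / 8 * `|c p| ^+ 2 - `|c p| =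
        2 / T%:R * (1 - T%:R / 4 * `|c p|) ^+ 2.
      by field; rewrite gt_eqF.
    by rewrite mulr_ge0 ?sqr_ge0// divr_ge0// ltW.
  have e1 : \sum_p 2 / T%:R * w p = 2 / T%:R by rewrite -[RHS]mulr1 -w1 mulr_sumr.
  have e2 : \sum_p T%:R / 8 * (w p * c p ^+ 2) = T%:R / 8 * \sum_p w p * c p ^+ 2.
    by rewrite mulr_sumr.
  rewrite big_split /= e1 e2.
  have h : T%:R / 8 * (\sum_p w p * c p ^+ 2) <= T%:R / 8 * (16 / T%:R ^+ 2).
    by rewrite ler_wpM2l// divr_ge0// ltW.
  apply: (le_trans (lerD (lexx _) h)).
  by rewrite le_eqVlt; apply/orP; left; apply/eqP; field; rewrite gt_eqF.
exists M, w, (fun p => L * c p); split => //.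
  have -> : \sum_p w p * `|L * c p| = L * \sum_p w p * `|c p|.
    rewrite mulr_sumr; apply: eq_bigr => p _.
    by rewrite normrM (gtr0_norm L0) mulrCA.
  apply: (le_trans (ler_wpM2l (ltW L0) c1)).
  rewrite ler_pdivlMr// mulrA mulrAC ler_pdivrMr//.
  by nra.
move=> lam A /andP[le lL].
have [m mL] : exists m : int, `|lam * L - m%:~R| <= 2^-1.
  by have [k0 k0P] := exists_centered (lam * L); exists (- k0); rewrite rmorphN opprK.
have absm : `|m%:~R : R| = (`|m|%N)%:R by rewrite -intr_norm -natr_absz.
have hm1 : (d < `|m|)%N.
  rewrite -(ltr_nat R) -absm -(ltrD2r 1) natr1 dT.
  have : eta * L <= `|lam * L| by rewrite normrM (gtr0_norm L0) ler_pM2r.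
  have := lerB_dist (lam * L) m%:~R.
  by lra.
have hm2 : (`|m| + d < M)%N.
  have h3 : `|lam * L| <= `|Lam| * L.
    by rewrite normrM (gtr0_norm L0) ler_pM2r// (le_trans lL)// ler_norm.
  have h4 : (`|m|%N)%:R < (Num.truncn (`|Lam| * L)).+3%:R :> R.
    rewrite -absm; have /andP[_ h5] : (Num.truncn (`|Lam| * L))%:R <= `|Lam| * L
        < (Num.truncn (`|Lam| * L)).+1%:R.
      by apply: truncn_itv; rewrite mulr_ge0// ltW.
    have := lerB_dist m%:~R (lam * L); rewrite distrC.
    have e3 : (Num.truncn (`|Lam| * L)).+3%:R =
        (Num.truncn (`|Lam| * L)).+1%:R + 2 :> R.
      by rewrite -natrD addn2.
    by rewrite e3; lra.
  rewrite ltr_nat in h4; move: h4; rewrite /M.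
  move: (Num.truncn _) (`|m|%N) => tr am; clear; lia.
have grid : \sum_p w p * cos (A - 2 * pi * m%:~R * c p) = 0.
  have := @kernel_quadrature R d M (- m) 0 A; rewrite abszN => /(_ hm2).
  have -> : kernel_coef d (- m) = 0 :> R by apply: kernel_coef_high; rewrite abszN.
  rewrite mul0r => h; rewrite -[RHS]h.
  apply: eq_bigr => p _; congr (_ * _).
  rewrite -(cosD_period (m * k p) (A - _)); congr cos.
  by rewrite /c rmorphN rmorphM /=; ring.
have -> : \sum_p w p * cos (A - 2 * pi * lam * (L * c p)) =
    \sum_p w p * (cos (A - 2 * pi * lam * (L * c p)) - cos (A - 2 * pi * m%:~R * c p)).
  by under [RHS]eq_bigr do rewrite mulrBr; rewrite sumrB grid subr0.
apply: (@le_trans _ _ (\sum_p 4 * (w p * `|c p|))).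
  apply: (le_trans (ler_norm_sum _ _ _)); apply: ler_sum => p _.
  rewrite normrM (ger0_norm (w0 p)) [leRHS]mulrCA ler_wpM2l//.
  apply: (le_trans (cos_lipschitz _ _)).
  have -> : A - 2 * pi * lam * (L * c p) - (A - 2 * pi * m%:~R * c p) =
     - (2 * pi * (lam * L - m%:~R) * c p) by ring.
  have p0 := @pi_gt0 R; have p4 := @pihalf_lt2 R.
  rewrite normrN !normrM ler_wpM2r// (ger0_norm (_ : 0 <= 2))//.
  rewrite (gtr0_norm p0); have := normr_ge0 (lam * L - m%:~R).
  by move: mL; set u := `|lam * L - _|; nra.
rewrite -mulr_sumr; apply: (le_trans (ler_wpM2l _ c1)) => //.
have -> : 4 * (4 / T%:R) = 16 / T%:R :> R by rewrite mulrA -natrM.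
rewrite ler_pdivrMr// mulrAC ler_pdivlMr ?mulr_gt0//.
by lra.
Qed.

(** The constant may depend on [F]: the error [delta] of the kernel will be chosen
    after [F], at the price of a longer window [L] but not of longer delays. *)
Lemma time_average_trigpoly n (b : 'I_n -> nat) (omega : 'rV[R]_n) (eta Lam : R) F :
  trigpoly b F ->
  (forall k : 'rV[int]_n, (forall i, (`|k ord0 i| <= b i)%N) ->
     scal (intv k) omega = 0 \/ eta <= `|scal (intv k) omega| <= Lam) ->
  exists2 C, 0 <= C & forall m (w r : 'I_m -> R) delta,
    (forall lam A, eta <= `|lam| <= Lam ->
      `|\sum_j w j * cos (A - 2 * pi * lam * r j)| <= delta) ->
    0 <= delta ->
    forall th z, (forall k : 'rV[int]_n, scal (intv k) omega = 0 -> scal (intv k) z = 0) ->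
      `|time_average w r omega F (th + z) - time_average w r omega F th| <= C * delta.
Proof.
move=> bF freq; elim: bF => [c phi k kb|G H _ [C1 C10 IG] _ [C2 C20 IH]]; last first.
  exists (C1 + C2) => [|m w r delta wr delta0 th z zP]; first exact: addr_ge0.
  have avD x : time_average w r omega (fun th => G th + H th) x =
      time_average w r omega G x + time_average w r omega H x.
    by rewrite /time_average -big_split; apply: eq_bigr => j _; rewrite mulrDr.
  rewrite !avD opprD addrACA mulrDl; apply: (le_trans (ler_normD _ _)).
  by apply: lerD; [exact: IG|exact: IH].
exists (2 * `|c|) => [|m w r delta wr delta0 th z zP]; first by rewrite mulr_ge0.
pose lam := scal (intv k) omega.
have avE x : time_average w r omega
     (fun th => c * cos (2 * pi * scal (intv k) th + phi)) x =
   c * \sum_j w j * cos (2 * pi * scal (intv k) x + phi - 2 * pi * lam * r j).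
  rewrite /time_average mulr_sumr; apply: eq_bigr => j _; rewrite mulrCA.
  by rewrite scalBr scalZr -/lam; congr (_ * (_ * cos _)); ring.
rewrite !avE -mulrBr normrM (_ : 2 * `|c| * delta = `|c| * (2 * delta)); last by ring.
rewrite ler_wpM2l//.
have [lam0|lamb] := freq k kb.
  by rewrite scalDr (zP _ lam0) addr0 subrr normr0 mulr_ge0.
apply: (le_trans (ler_normB _ _)).
rewrite (_ : 2 * delta = delta + delta); last by ring.
by apply: lerD; exact: wr.
Qed.

(** Resonant harmonics are unchanged by the translations [z], all others are
    removed. The bound [8 / eta] on the mean delay depends neither on the degree
    nor on the size of [F]. *)
Theorem bohr_average n (d : nat) (omega : 'rV[R]_n) (eta e : R) F :
  0 < eta -> 0 < e -> trigpoly (fun=> d) F ->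
  (forall k : 'rV[int]_n, (forall i, (`|k ord0 i| <= d)%N) ->
     scal (intv k) omega = 0 \/ eta <= `|scal (intv k) omega|) ->
  exists m (w r : 'I_m -> R), [/\ forall j, 0 <= w j, \sum_j w j = 1,
    \sum_j w j * `|r j| <= 8 / eta &
    forall th z, (forall k : 'rV[int]_n, scal (intv k) omega = 0 -> scal (intv k) z = 0) ->
      `|time_average w r omega F (th + z) - time_average w r omega F th| <= e].
Proof.
move=> eta0 e0 dF freq; pose Lam := n%:R * (d%:R * `|omega|).
have [k kd|C C0 hC] := time_average_trigpoly (eta := eta) (Lam := Lam) (omega := omega) dF.
  have [k0|ke] := freq k kd; [by left|right; rewrite ke /=].
  apply: (le_trans (norm_scal_le _ _)); rewrite ler_wpM2l// ler_wpM2r//.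
  apply: norm_le_entries => // i; rewrite mxE -intr_norm -natr_absz ler_nat.
  exact: kd.
pose L := (1 + 32 * C / e) / eta.
have Ce0 : 0 <= 32 * C / e by rewrite !mulr_ge0// invr_ge0 ltW.
have etaL : eta * L = 1 + 32 * C / e by rewrite /L mulrC divfK// gt_eqF.
have [|m [w [r [w0 w1 wr wcos]]]] := @high_frequency_killer eta Lam L eta0.
  by rewrite etaL lerDl.
exists m, w, r; split=> // th z zP.
have L1 : 0 < eta * L by rewrite etaL ltr_wpDr.
apply: (le_trans (hC _ _ _ (32 / (eta * L)) wcos _ th z zP)).
  by rewrite divr_ge0// ltW.
have h : e * (32 * C / e) = 32 * C by field; rewrite gt_eqF.
by rewrite mulrA ler_pdivrMr// etaL (mulrDr e) h; lra.
Qed.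

End TimeAverage.

(** * The rational structure of the resonance space *)

Section Resonance.
Context {R : realType}.

Local Notation intv k := (map_mx intr k).

Lemma scal_mulmx n (u v : 'rV[R]_n) : scal u v = (u *m v^T) 0 0.
Proof. by rewrite mxE; apply: eq_bigr => i _; rewrite mxE. Qed.

Lemma norm_intv n (k : 'rV[int]_n) i : `|(intv k : 'rV[R]_n) 0 i| = (`|k ord0 i|%N)%:R.
Proof. by rewrite mxE -intr_norm -natr_absz. Qed.

Lemma norm_Zn n (k : 'rV[R]_n) : Zn k -> 0 < `|k| -> exists2 q : nat, (0 < q)%N & `|k| = q%:R.
Proof.
move=> [k0 _ <-] kgt0; have [i ki] := norm_attained kgt0.
rewrite norm_intv in ki; exists `|k0 ord0 i|%N => //.
by rewrite -(ltr_nat R) -ki.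
Qed.

Lemma norm_mulmx_le n (M : 'M[R]_n) : exists2 K, 0 <= K &
  forall k : 'rV[R]_n, `|k *m M| <= K * `|k|.
Proof.
exists (n%:R * \sum_j `|(col j M)^T|) => [|k].
  by rewrite mulr_ge0// sumr_ge0.
apply: norm_le_entries => [|j]; first by rewrite !mulr_ge0// sumr_ge0.
have -> : (k *m M) 0 j = scal k (col j M)^T.
  by rewrite mxE; apply: eq_bigr => i _; rewrite !mxE.
apply: (le_trans (norm_scal_le _ _)); rewrite -mulrA ler_wpM2l// mulrC ler_wpM2r//.
by rewrite (bigD1 j)//= lerDl sumr_ge0.
Qed.

(** A maximal free family of integer vectors orthogonal to [omega]. *)
Lemma resonance_basis n (omega : 'rV[R]_n) :
  exists m (A : 'M[int]_(m, n)), [/\ row_free (intv A : 'M[R]_(m, n)),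
    forall i, scal (row i (intv A)) omega = 0 &
    forall k : 'rV[int]_n, scal (intv k) omega = 0 ->
      (intv k <= (intv A : 'M[R]_(m, n)))%MS].
Proof.
pose P m := `[< exists A : 'M[int]_(m, n), row_free (intv A : 'M[R]_(m, n)) /\
   forall i, scal (row i (intv A)) omega = 0 >].
have P0 : exists m, P m.
  exists 0%N; apply/asboolP; exists 0; split; last by case.
  by rewrite -row_leq_rank.
have Pn m : P m -> (m <= n)%N.
  by move=> /asboolP[A [fA _]]; rewrite -row_leq_rank in fA; exact: leq_trans fA (rank_leq_col _).
case: (ex_maxnP P0 Pn) => m /asboolP[A [fA rA]] mmax; exists m, A; split=> // k k0.
apply: contrapT => /negP kA.
have : P (1 + m)%N.
  apply/asboolP; exists (col_mx k A); split=> [|i].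
    rewrite map_col_mx -row_leq_rank -addsmxE.
    have lt : (intv A < intv k + (intv A : 'M[R]_(m, n)))%MS.
      rewrite ltmxE addsmxSr; apply: contra kA; apply: submx_trans.
      exact: addsmxSl.
    by have := rank_ltmx lt; move/eqP: fA => ->; rewrite add1n.
  rewrite map_col_mx; case: (split_ordP i) => j ->.
    by rewrite rowKu row_id.
  by rewrite rowKd.
by move=> /mmax; rewrite add1n ltnn.
Qed.

(** An integer vector [k] need not have an integral projection to the complement
    of [L]; [p] is a multiple of that projection, by a factor [a] that depends on
    [L] only in the construction below. *)
Definition denominator_bound n (L : set 'rV[R]_n) (N : R) : Prop :=
  1 <= N /\ forall k, Zn k -> exists (a : R) p,
    [/\ a != 0, `|a| <= N, Zn p /\ orthc L p, L (a *: k - p) & `|p| <= N * `|k|].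

(** With [A] a free family of integer rows spanning [Lambda_omega omega], the
    projection [x *m A^T *m invmx (A *m A^T) *m A] becomes integral after
    multiplication by the Gram determinant [\det (A *m A^T)]. *)
Lemma resonance_space n (omega : 'rV[R]_n) :
  (forall w, Lambda_omega omega w -> scal w omega = 0) /\
  (forall x, exists y v, [/\ x = y + v, Lambda_omega omega y & orthc (Lambda_omega omega) v]) /\
  (exists N, denominator_bound (Lambda_omega omega) N).
Proof.
set L := Lambda_omega omega.
have Lomega w : L w -> scal w omega = 0.
  move=> [m [a [u [uP ->]]]]; rewrite scalC /scal.
  rewrite (_ : \sum_i _ = \sum_j a j * scal (u j) omega).
    by rewrite big1// => j _; have [_ ->] := uP j; rewrite mulr0.
  under eq_bigr do rewrite summxE mulr_sumr.
  rewrite exchange_big; apply: eq_bigr => j _; rewrite /scal mulr_sumr.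
  by apply: eq_bigr => i _; rewrite mxE; ring.
have [m [A0 [fA rA kA]]] := resonance_basis omega.
set A := (intv A0 : 'M[R]_(m, n)) in fA rA kA.
have LA w : L w -> exists c : 'rV[R]_m, w = c *m A.
  move=> [q [a [u [uP ->]]]]; apply/submxP; apply: summx_sub => j _.
  by apply: scalemx_sub; have [[k _ <-]] := uP j; exact: kA.
have AL (c : 'rV[R]_m) : L (c *m A).
  exists m, (fun i => c 0 i), (fun i => row i A); split=> [i|].
    split; last exact: rA.
    by exists (row i A0) => //; rewrite map_row.
  by rewrite mulmx_sum_row.
pose B := A *m A^T.
have uB : B \in unitmx.
  rewrite -row_free_unit; apply: inj_row_free => v vB.
  have : scal (v *m A) (v *m A) = 0.
    by rewrite scal_mulmx trmx_mul mulmxA -(mulmxA v) -/B vB mul0mx mxE.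
  move/scal_self_eq0 => vA; apply: (row_free_inj fA).
  by rewrite vA mul0mx.
pose proj (x : 'rV[R]_n) := x *m A^T *m invmx B *m A.
have orth x w : L w -> scal (x - proj x) w = 0.
  move=> /LA[c ->]; rewrite scal_mulmx trmx_mul mulmxA mulmxBl.
  by rewrite /proj -!mulmxA -/B mulVmx// mulmx1 subrr mul0mx mxE.
split=> //; split=> [x|].
  exists (proj x), (x - proj x); split; [by rewrite addrC subrK|exact: AL|].
  by move=> w Lw; exact: orth.
pose B0 := A0 *m A0^T.
have BE : B = intv B0 by rewrite /B /B0 map_mxM -matrix.map_trmx.
pose a : R := \det B.
have a0 : a != 0 by rewrite -unitfE -unitmxE.
have [K K0 hK] := norm_mulmx_le (a *: (1%:M - A^T *m invmx B *m A)).
exists (1 + `|a| + K); split; first by rewrite -addrA lerDl addr_ge0.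
move=> k [k0 _ <-]; pose p : 'rV[R]_n := a *: (intv k0 - proj (intv k0)).
exists a, p; split=> //.
- by rewrite -addrA addrCA lerDl addr_ge0.
- split; last by move=> w Lw; rewrite scalZl orth// mulr0.
  exists (\det B0 *: k0 - k0 *m A0^T *m \adj B0 *m A0) => //.
  rewrite map_mxB map_mxZ !map_mxM map_mx_adj -matrix.map_trmx -det_map_mx -BE.
  rewrite /p scalerBr /proj /invmx uB -/a -scalemxAr -scalemxAl scalerA mulfV//.
  by rewrite scale1r.
- by rewrite /p scalerBr opprB addrC subrK /proj scalemxAl; exact: AL.
- have -> : p = intv k0 *m (a *: (1%:M - A^T *m invmx B *m A)).
    by rewrite -scalemxAr mulmxBr mulmx1 !mulmxA.
  by apply: (le_trans (hK _)); rewrite ler_wpM2r// lerDr addr_ge0.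
Qed.

End Resonance.

(** * Small divisors *)

Section SmallDivisors.
Context {R : realType} {n : nat}.
Variable omega : 'rV[R]_n.

Local Notation intv k := (map_mx intr k).
Local Notation L := (Lambda_omega omega).

Lemma Lambda_mem k : Zn k -> scal k omega = 0 -> L k.
Proof.
move=> kZ k0; exists 1%N, (fun=> 1), (fun=> k); split=> //.
by rewrite big_ord_recl big_ord0 addr0 scale1r.
Qed.

Lemma low_mode_nonresonant Q k : low_modes omega Q k -> scal k omega != 0.
Proof.
move=> [ko kZ k0 _]; apply: contraL (k0) => /eqP kw; rewrite -leNgt normr_le0.
by apply/eqP/scal_self_eq0/ko/Lambda_mem.
Qed.

Lemma low_modes_bounded Q :
  has_ubound [set `|scal k omega|^-1 | k in low_modes omega Q].
Proof.
pose M := Num.truncn `|Q|.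
pose vec (P : {ffun 'I_n -> 'I_(M + M).+1}) : 'rV[R]_n := \row_i ((P i)%:R - M%:R).
exists (\sum_P `|scal (vec P) omega|^-1) => _ [k [_ [k0 _ <-] _ kQ] <-].
have kM i : (`|k0 ord0 i| <= M)%N.
  have h1 : (`|k0 ord0 i|%N)%:R <= `|Q| :> R.
    by rewrite -norm_intv (le_trans (entry_le_norm _ _))// (le_trans kQ)// ler_norm.
  by rewrite /M truncn_ge_nat.
have Pi i : (`|(k0 ord0 i + M%:Z)%R| < (M + M).+1)%N.
  by have := kM i; move: (k0 ord0 i) => a; lia.
have -> : intv k0 = vec [ffun i => Ordinal (Pi i)].
  apply/rowP => i; rewrite !mxE ffunE /=.
  have -> : (`|(k0 ord0 i + M%:Z)%R|%N)%:R = (k0 ord0 i + M%:Z)%:~R :> R.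
    have := kM i; move: (k0 ord0 i) => a aM.
    rewrite -[LHS]/((`|(a + M%:Z)%R|%N)%:Z%:~R); congr (_%:~R); lia.
  by rewrite rmorphD /= addrK.
by rewrite (bigD1 [ffun i => Ordinal (Pi i)])//= lerDl sumr_ge0.
Qed.

Lemma Psi_ge Q k : low_modes omega Q k -> `|scal k omega|^-1 <= Psi_omega omega Q.
Proof.
by move=> kQ; apply: ub_le_sup; [exact: low_modes_bounded|exists k].
Qed.

Lemma low_modes_mono Q Q' k : Q <= Q' -> low_modes omega Q k -> low_modes omega Q' k.
Proof. by move=> QQ' [ko kZ k0 kQ]; split=> //; exact: le_trans QQ'. Qed.

Lemma denominator_scal (N : R) k a p : denominator_bound L N ->
  L (a *: k - p) -> scal p omega = a * scal k omega.
Proof.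
have [Lw _] := resonance_space omega.
move=> _ /Lw; rewrite scalBl scalZl => /eqP; rewrite subr_eq0 => /eqP //.
Qed.

Lemma low_mode_of_projection (N : R) (k : 'rV[R]_n) : denominator_bound L N ->
  Zn k -> scal k omega != 0 -> exists a p, [/\ 0 < `|a|, `|a| <= N,
    low_modes omega (N * `|k|) p & scal p omega = a * scal k omega].
Proof.
move=> hN kZ kw; have [N1 hk] := hN; have [a [p [a0 aN [pZ po] ap pN]]] := hk k kZ.
have pw := denominator_scal hN ap.
exists a, p; split=> //; first by rewrite normr_gt0.
split=> //; rewrite normr_gt0; apply: contraTneq (isT) => p0.
by move/eqP: pw; rewrite p0 scal0l eq_sym mulf_eq0 (negbTE a0) (negbTE kw).
Qed.

Lemma exists_low_mode : resonant omega -> exists Q k, low_modes omega Q k.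
Proof.
move=> [_ /existsNP[k /not_implyP[kZ /not_implyP[_ /eqP kw]]]].
have [_ [_ [N hN]]] := resonance_space omega.
have [a [p [_ _ plow _]]] := low_mode_of_projection hN kZ kw.
by exists (N * `|k|), p.
Qed.

(** A least nonzero mode exists since integer vectors have integer norms. *)
Lemma Q_omega_attained : resonant omega ->
  1 <= Q_omega omega /\ exists k, low_modes omega (Q_omega omega) k.
Proof.
move=> /exists_low_mode[Q0 [k0 k0low]].
pose P q := `[< exists k, low_modes omega q%:R k >].
have exP : exists q, P q.
  have [ko kZ kgt0 _] := k0low; have [q q0 kq] := norm_Zn kZ kgt0.
  by exists q; apply/asboolP; exists k0; split=> //; rewrite kq.
case: (ex_minnP exP) => q /asboolP[k klow] qmin.
have q1 : 1 <= q%:R :> R.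
  have [_ kZ kgt0 kq] := klow; have := lt_le_trans kgt0 kq.
  by rewrite ltr0n ler1n.
have lbq : lbound [set Q | 1 <= Q /\ low_modes omega Q !=set0] q%:R.
  move=> Q [Q1 [k' [ko kZ kgt0 kQ]]]; have [q' _ kq'] := norm_Zn kZ kgt0.
  apply: le_trans kQ; rewrite kq' ler_nat; apply: qmin; apply/asboolP; exists k'.
  by split=> //; rewrite kq'.
suff -> : Q_omega omega = q%:R by split=> //; exists k.
apply/eqP; rewrite eq_le; apply/andP; split.
  by apply: ge_inf; [exists q%:R|split=> //; exists k].
by apply: lb_le_inf => //; exists q%:R; split=> //; exists k.
Qed.

Lemma Psi_gt0 Q : resonant omega -> Q_omega omega <= Q -> 0 < Psi_omega omega Q.
Proof.
move=> res QQ; have [_ [k klow]] := Q_omega_attained res.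
have kQ := low_modes_mono QQ klow; apply: lt_le_trans (Psi_ge kQ).
by rewrite invr_gt0 normr_gt0 (low_mode_nonresonant kQ).
Qed.

Lemma Psi_lower Q : resonant omega -> Q_omega omega <= Q ->
  1 <= n%:R * `|omega| * Q_omega omega * Psi_omega omega Q.
Proof.
move=> res QQ; have [_ [k klow]] := Q_omega_attained res.
have kQ := low_modes_mono QQ klow; have kw := low_mode_nonresonant kQ.
have h1 : `|scal k omega| <= n%:R * `|omega| * Q_omega omega.
  apply: (le_trans (norm_scal_le _ _)); rewrite -mulrA ler_wpM2l// mulrC.
  by rewrite ler_wpM2l//; have [] := klow.
have nz : 0 < `|scal k omega| by rewrite normr_gt0.
rewrite -[leLHS](mulfV (lt0r_neq0 nz)).
by apply: ler_pM => //; exact: Psi_ge.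
Qed.

(** Integer vectors of size at most [Q / N] either are resonances or have a
    divisor controlled by [Psi]: pass to the projection along [Lambda]. *)
Lemma small_divisor (N Q : R) (k : 'rV[R]_n) : resonant omega ->
  denominator_bound L N -> Q_omega omega <= Q -> Zn k -> N * `|k| <= Q ->
  scal k omega = 0 \/ (N * Psi_omega omega Q)^-1 <= `|scal k omega|.
Proof.
move=> res hN QQ kZ kQ; have [->|kw] := eqVneq (scal k omega) 0; [by left|right].
have [a [p [a0 aN plow pw]]] := low_mode_of_projection hN kZ kw.
have pQ := low_modes_mono kQ plow; have := Psi_ge pQ; rewrite pw normrM invfM.
have k0 : 0 < `|scal k omega| by rewrite normr_gt0.
move=> h; rewrite -[leRHS]invrK lef_pV2 ?posrE ?invr_gt0 ?mulr_gt0 ?Psi_gt0//; last first.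
  exact: lt_le_trans aN.
rewrite -ler_pdivrMl ?(lt_le_trans a0)//; apply: le_trans h.
by rewrite ler_wpM2r ?invr_ge0// lef_pV2 ?posrE ?(lt_le_trans a0).
Qed.

(** The supremum [Delta_omega] need not be attained, whence the factors [2]. The
    two bounds on [sqrt eps] come from the lower bound [Psi_lower] on [Psi], and
    [kappa] is small enough to make the first of them [1]. *)
Lemma exists_cutoff (kappa eps : R) : resonant omega ->
  0 < kappa -> kappa * (n%:R * `|omega|) <= 1 ->
  Delta_defined omega kappa eps -> 0 < mu_omega omega kappa eps ->
  exists Q, [/\ Q_omega omega <= Q, Q^-1 <= 2 * mu_omega omega kappa eps,
    Num.sqrt eps * Psi_omega omega Q <= 2 * kappa * mu_omega omega kappa eps,
    Num.sqrt eps <= 1 &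
    Num.sqrt eps <= 2 * Q_omega omega * mu_omega omega kappa eps].
Proof.
move=> res kap0 kap1 [eps0 hdef] mu0; set s := Num.sqrt eps in hdef *.
have s0 : 0 < s by rewrite sqrtr_gt0.
set m := mu_omega omega kappa eps in mu0 *.
pose S := [set Q | Q_omega omega <= Q /\ Q * Psi_omega omega Q <= kappa * s^-1].
have D0 : 0 < sup S by rewrite -invr_gt0.
have [Q1 [k0 k0low]] := Q_omega_attained res.
have hasS : has_sup S.
  split; first by exists (Q_omega omega).
  exists (kappa * s^-1 * (n%:R * `|omega| * Q_omega omega)) => Q [QQ hQ].
  have Q0 : 0 <= Q by rewrite (le_trans _ QQ)// (le_trans _ Q1).
  have := Psi_lower res QQ; have := Psi_gt0 res QQ => P0 hP.
  set c := n%:R * `|omega| * Q_omega omega in hP *.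
  have c0 : 0 <= c by rewrite !mulr_ge0// (le_trans _ Q1).
  apply: le_trans (ler_wpM2r c0 hQ).
  have -> : Q * Psi_omega omega Q * c = Q * (c * Psi_omega omega Q) by ring.
  by rewrite ler_peMr.
have [|Q [QQ hQ] DQ] := @sup_adherent R S (sup S / 2) _ hasS; first by rewrite divr_gt0.
have Q0 : 0 < Q by rewrite (lt_le_trans _ QQ)// (lt_le_trans _ Q1).
have P0 := Psi_gt0 res QQ; have hP := Psi_lower res QQ.
have mE : m = (sup S)^-1 by [].
have QV : Q^-1 <= 2 * m.
  rewrite mE -[2]invrK -invfM lef_pV2 ?posrE ?mulr_gt0 ?invr_gt0//.
  by move: DQ; lra.
have sQ : s * (Q * Psi_omega omega Q) <= kappa.
  by rewrite (mulrC s) -ler_pdivlMr.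
have sQ2 : s * Q <= Q_omega omega.
  apply: (@le_trans _ _ (s * Q * (n%:R * `|omega| * Q_omega omega * Psi_omega omega Q))).
    by rewrite ler_peMr// mulr_ge0// ltW.
  have -> : s * Q * (n%:R * `|omega| * Q_omega omega * Psi_omega omega Q) =
     (s * (Q * Psi_omega omega Q)) * (n%:R * `|omega|) * Q_omega omega by ring.
  rewrite -[leRHS]mul1r ler_wpM2r//; first by rewrite (le_trans _ Q1).
  by apply: le_trans kap1; rewrite ler_wpM2r// mulr_ge0.
exists Q; split=> //.
- have -> : s * Psi_omega omega Q = (s * (Q * Psi_omega omega Q)) * Q^-1.
    by field; rewrite gt_eqF.
  have -> : 2 * kappa * m = kappa * (2 * m) by ring.
  by apply: ler_pM => //; rewrite ?invr_ge0 ?mulr_ge0// ltW.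
- rewrite -(ler_pM2r Q0) mul1r; exact: le_trans QQ.
- have -> : 2 * Q_omega omega * m = Q_omega omega * (2 * m) by ring.
  apply: (@le_trans _ _ (Q_omega omega * Q^-1)); first by rewrite ler_pdivlMr.
  by rewrite ler_wpM2l// (le_trans _ Q1).
Qed.

End SmallDivisors.

(** * Lipschitz and Taylor estimates from bounded partial derivatives *)

Section Partials.
Context {R : realType}.

Lemma sum_le_cst n (F : 'I_n -> R) c : (forall i, F i <= c) -> \sum_i F i <= n%:R * c.
Proof.
move=> Fc; rewrite mulr_natl -[n in leRHS]card_ord -sumr_const.
by apply: ler_sum => i _.
Qed.

Lemma is_derive_line {V : normedModType R} (g : V -> R) (x v : V) (s : R) :
  derivable g (x + s *: v) v ->
  is_derive s 1 (fun s : R => g (x + s *: v)) ('D_v g (x + s *: v)).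
Proof.
move=> gd.
have e : (fun h : R => h^-1 *: (((fun s : R => g (x + s *: v)) \o shift s) (h *: (1 : R))
      - g (x + s *: v))) =
    (fun h : R => h^-1 *: ((g \o shift (x + s *: v)) (h *: v) - g (x + s *: v))).
  apply/funext => h /=; congr (_ *: (g _ - _)).
  by rewrite [h *: 1]mulr1 scalerDl addrCA.
by split; rewrite /derivable /derive e.
Qed.

(** Satisfied by the whole space and by balls of the supremum norm; it allows
    coordinates to be moved one at a time. *)
Definition box_convex n (D : set 'rV[R]_n) : Prop :=
  forall x y z : 'rV[R]_n, D x -> D y ->
  (forall i, `|z 0 i| <= Num.max `|x 0 i| `|y 0 i|) -> D z.

Lemma box_convexT n : box_convex [set: 'rV[R]_n].
Proof. by []. Qed.

Lemma box_convex_unit_ball n : box_convex (@unit_ball R n).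
Proof.
move=> x y z; rewrite /unit_ball /= => x1 y1 zxy.
apply: norm_lt_entries => // i; apply: (le_lt_trans (zxy i)).
by rewrite gt_max !(le_lt_trans (entry_le_norm _ _)).
Qed.

(** Moving one coordinate at a time reduces the increment to the mean value
    theorem in one variable, for which partial derivatives suffice. *)
Lemma coordinatewise_mean_value n (D : set 'rV[R]_n) (g : 'rV[R]_n -> R) (x y : 'rV[R]_n) :
  box_convex D -> (forall (z : 'rV[R]_n) i, D z -> derivable g z (basis1 i)) -> D x -> D y ->
  exists xi : 'I_n -> 'rV[R]_n,
    (forall i, D (xi i) /\ `|xi i - x| <= `|y - x|) /\
    g y - g x = \sum_i 'D_(basis1 i) g (xi i) * (y 0 i - x 0 i).
Proof.
move=> Dbox gd Dx Dy.
pose z (k : nat) : 'rV[R]_n := \row_i (if (i < k)%N then y 0 i else x 0 i).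
have zS (i : 'I_n) : z i.+1 = z i + (1 * (y 0 i - x 0 i)) *: basis1 i.
  apply/rowP => j; rewrite !mxE eqxx /= ltnS leq_eqVlt.
  have [->|ji] := eqVneq j i; first by rewrite eqxx ltnn mulr1 mul1r addrC subrK.
  by rewrite -val_eqE /= in ji; rewrite (negbTE ji) mulr0 addr0.
have step (i : 'I_n) : exists xi, (D xi /\ `|xi - x| <= `|y - x|) /\
    g (z i.+1) - g (z i) = 'D_(basis1 i) g xi * (y 0 i - x 0 i).
  pose w s := z i + (s * (y 0 i - x 0 i)) *: basis1 i : 'rV[R]_n.
  have wj (s : R) j : 0 <= s <= 1 -> exists2 t, 0 <= t <= 1 & w s 0 j = x 0 j + t * (y 0 j - x 0 j).
    move=> s01; rewrite !mxE eqxx /=; have [->|ji] := eqVneq j i.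
      by exists s => //; rewrite ltnn mulr1.
    rewrite mulr0 addr0; case: ifP => _.
      by exists 1; [rewrite lexx ler01|rewrite mul1r addrC subrK].
    by exists 0; [rewrite lexx ler01|rewrite mul0r addr0].
  have wD (s : R) : 0 <= s <= 1 -> D (w s).
    move=> s01; apply: (Dbox x y) => // j; have [t /andP[t0 t1] ->] := wj s j s01.
    have -> : x 0 j + t * (y 0 j - x 0 j) = (1 - t) * x 0 j + t * y 0 j by ring.
    apply: (le_trans (ler_normD _ _)); rewrite !normrM (ger0_norm t0) ger0_norm ?subr_ge0//.
    set a := `|x 0 j|; set b := `|y 0 j|; have am : a <= Num.max a b by rewrite le_max lexx.
    have bm : b <= Num.max a b by rewrite le_max lexx orbT.
    by move: (Num.max a b) am bm => c am bm; nra.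
  have dw (s : R) : 0 <= s <= 1 -> is_derive s 1 (fun s => g (w s))
      ('D_(basis1 i) g (w s) * (y 0 i - x 0 i)).
    move=> s01; apply: (@is_derive1_comp _ (fun s : R => g (z i + s *: basis1 i))
        (fun s => s * (y 0 i - x 0 i))).
      by apply: is_derive_line; apply: gd; exact: wD.
    have -> : (fun s : R => s * (y 0 i - x 0 i)) = (y 0 i - x 0 i) \*: id.
      by apply/funext => r; rewrite /= mulrC.
    rewrite -[X in is_derive _ _ _ X]mulr1; exact: is_deriveZ.
  have [c c01 e] := mean_value ler01 dw.
  exists (w c); split; first split; first exact: wD.
    apply: norm_le_entries => // j; have [t /andP[t0 t1] wt] := wj c j c01.
    have -> : (w c - x) 0 j = w c 0 j - x 0 j by rewrite [LHS]mxE [X in _ + X]mxE.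
    rewrite wt.
    rewrite addrAC subrr add0r normrM ger0_norm//.
    have := entry_le_norm (y - x) j; rewrite !mxE; apply: le_trans.
    by rewrite ler_piMl.
  have -> : z i = w 0 by rewrite /w mul0r scale0r addr0.
  by rewrite zS -/(w 1) e subr0 mulr1.
have [xi xiP] := choice step.
exists xi; split=> [i|]; first by have [] := xiP i.
have -> : y = z n by apply/rowP => i; rewrite mxE ltn_ord.
have -> : g x = g (z 0%N) by congr g; apply/rowP => i; rewrite mxE.
rewrite -(telescope_sumr (fun k => g (z k)))// big_mkord; apply: eq_bigr => i _.
have [_ ->] := xiP i; rewrite mxE ltn_ord//.
Qed.

Lemma coordinatewise_lipschitz n (D : set 'rV[R]_n) (g : 'rV[R]_n -> R) x y :
  box_convex D -> (forall (z : 'rV[R]_n) i, D z -> derivable g z (basis1 i)) ->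
  (forall z i, D z -> `|'D_(basis1 i) g z| <= 1) -> D x -> D y ->
  `|g y - g x| <= n%:R * `|y - x|.
Proof.
move=> Dbox gd g1 Dx Dy; have [xi [xiP ->]] := coordinatewise_mean_value Dbox gd Dx Dy.
apply: (le_trans (ler_norm_sum _ _ _)).
apply: sum_le_cst => i.
rewrite normrM -[leRHS]mul1r; apply: ler_pM => //; first by apply: g1; case: (xiP i).
by have := entry_le_norm (y - x) i; rewrite !mxE.
Qed.

Lemma coordinatewise_taylor n (g : 'rV[R]_n -> R) :
  (forall (z : 'rV[R]_n) i, derivable g z (basis1 i)) ->
  (forall z z' i, `|'D_(basis1 i) g z - 'D_(basis1 i) g z'| <= n%:R * `|z - z'|) ->
  forall x y, `|g (x + y) - g x - scal (grad g x) y| <= n%:R ^+ 2 * `|y| ^+ 2.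
Proof.
move=> gd gl x y.
have [|xi [xiP ->]] := @coordinatewise_mean_value n setT g x (x + y) (@box_convexT n) _ I I.
  by move=> z i _; exact: gd.
rewrite /scal -sumrB; apply: (le_trans (ler_norm_sum _ _ _)).
have -> : n%:R ^+ 2 * `|y| ^+ 2 = n%:R * ((n%:R * `|y|) * `|y|) by ring.
apply: sum_le_cst => i.
rewrite !mxE addrAC subrr add0r -mulrBl normrM; apply: ler_pM => //; last exact: entry_le_norm.
apply: (le_trans (gl _ _ _)); rewrite ler_wpM2l//.
by have [_] := xiP i; rewrite (addrC x) addrK.
Qed.

(** ** Partial derivatives on the product of the torus and the ball *)

Lemma derive_fst {n : nat} (f : 'rV[R]_n * 'rV[R]_n -> R) th I i :
  (derivable f (th, I) (basis2 (inl i)) -> derivable (fun th => f (th, I)) th (basis1 i)) /\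
  'D_(basis1 i) (fun th => f (th, I)) th = 'D_(basis2 (inl i)) f (th, I).
Proof.
have e : (fun h : R => h^-1 *: (((fun th => f (th, I)) \o shift th) (h *: basis1 i) - f (th, I)))
    = (fun h : R => h^-1 *: ((f \o shift (th, I)) (h *: basis2 (inl i)) - f (th, I))).
  apply/funext => h /=; congr (_ *: (f _ - _)).
  by rewrite -[RHS]/(h *: basis1 i + th, h *: 0 + I) scaler0 add0r.
by split; rewrite /derivable /derive e.
Qed.

Lemma derive_snd {n : nat} (f : 'rV[R]_n * 'rV[R]_n -> R) th I i :
  (derivable f (th, I) (basis2 (inr i)) -> derivable (fun I => f (th, I)) I (basis1 i)) /\
  'D_(basis1 i) (fun I => f (th, I)) I = 'D_(basis2 (inr i)) f (th, I).
Proof.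
have e : (fun h : R => h^-1 *: (((fun I => f (th, I)) \o shift I) (h *: basis1 i) - f (th, I)))
    = (fun h : R => h^-1 *: ((f \o shift (th, I)) (h *: basis2 (inr i)) - f (th, I))).
  apply/funext => h /=; congr (_ *: (f _ - _)).
  by rewrite -[RHS]/(h *: 0 + th, h *: basis1 i + I) scaler0 add0r.
by split; rewrite /derivable /derive e.
Qed.

Lemma Ck_norm_bound {V : normedModType R} {J : Type} (e : J -> V) k D (g : V -> R) s x :
  (Ck_norm e k D g <= 1)%E -> (size s <= k)%N -> D x -> `|iter_partial e s g x| <= 1.
Proof.
move=> g1 sk Dx; rewrite -lee_fin; apply: le_trans g1; apply: ereal_sup_ubound.
by exists s, x.
Qed.

Lemma product_lipschitz n (f : 'rV[R]_n * 'rV[R]_n -> R) :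
  (forall x j, torus_ball x -> derivable f x (basis2 j)) ->
  (forall x j, torus_ball x -> `|'D_(basis2 j) f x| <= 1) ->
  forall x y, torus_ball x -> torus_ball y ->
    `|f x - f y| <= n%:R * (`|x.1 - y.1| + `|x.2 - y.2|).
Proof.
move=> fd f1 [th I] [th' I'] [_ /= BI] [_ /= BI'].
have -> : f (th, I) - f (th', I') = (f (th, I) - f (th', I)) + (f (th', I) - f (th', I')).
  by rewrite addrA subrK.
apply: (le_trans (ler_normD _ _)); rewrite mulrDr; apply: lerD.
  apply: (@coordinatewise_lipschitz n setT (fun th => f (th, I))) => // z i _.
    by apply: (derive_fst f z I i).1; exact: fd.
  by rewrite (derive_fst f z I i).2; exact: f1.
apply: (@coordinatewise_lipschitz n _ (fun I => f (th', I)) I' I (@box_convex_unit_ball n)) => // z i Bz.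
  by apply: (derive_snd f th' z i).1; exact: fd.
by rewrite (derive_snd f th' z i).2; exact: f1.
Qed.

Lemma unperturbed_bounds n (h : 'rV[R]_n -> R) :
  Ck basis1 2 unit_ball h -> (Ck_norm basis1 2 unit_ball h <= 1)%E ->
  (forall I, unit_ball I -> `|grad h I| <= 1) /\
  (forall I I', unit_ball I -> unit_ball I' -> `|grad h I - grad h I'| <= n%:R * `|I - I'|).
Proof.
move=> hC h1; split=> [I BI|I I' BI BI']; apply: norm_le_entries => [|i].
- by [].
- by rewrite mxE; exact: (@Ck_norm_bound _ _ _ _ _ _ [:: i] I h1).
- by rewrite mulr_ge0.
- rewrite !mxE.
  apply: (@coordinatewise_lipschitz n _ (fun x => 'D_(basis1 i) h x) I' I (@box_convex_unit_ball n)) => // z j Bz.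
    by have [_] := hC [:: i] isT z Bz; apply.
  exact: (@Ck_norm_bound _ _ _ _ _ _ [:: j; i] z h1).
Qed.

Lemma perturbation_bounds n (f : 'rV[R]_n * 'rV[R]_n -> R) :
  Ck basis2 3 torus_ball f -> (Ck_norm basis2 3 torus_ball f <= 1)%E ->
  [/\ forall x, torus_ball x -> `|f x| <= 1,
      forall x, torus_ball x -> `|grad_theta f x| <= 1 /\ `|grad_I f x| <= 1,
      forall x y, torus_ball x -> torus_ball y ->
        `|grad_theta f x - grad_theta f y| <= n%:R * (`|x.1 - y.1| + `|x.2 - y.2|) /\
        `|grad_I f x - grad_I f y| <= n%:R * (`|x.1 - y.1| + `|x.2 - y.2|) &
      forall th y, `|f (th + y, 0) - f (th, 0) - scal (grad_theta f (th, 0)) y|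
        <= n%:R ^+ 2 * `|y| ^+ 2].
Proof.
move=> fC f1.
have d1 x j : torus_ball x -> `|'D_(basis2 j) f x| <= 1.
  by move=> Tx; exact: (@Ck_norm_bound _ _ _ _ _ _ [:: j] x f1).
have l1 j x y : torus_ball x -> torus_ball y ->
    `|'D_(basis2 j) f x - 'D_(basis2 j) f y| <= n%:R * (`|x.1 - y.1| + `|x.2 - y.2|).
  apply: (@product_lipschitz n (fun x => 'D_(basis2 j) f x)) => z i Tz.
    by have [_] := fC [:: j] isT z Tz; apply.
  exact: (@Ck_norm_bound _ _ _ _ _ _ [:: i; j] z f1).
split=> [x Tx|x Tx|x y Tx Ty|th y].
- exact: (@Ck_norm_bound _ _ _ _ _ _ [::] x f1).
- by split; apply: norm_le_entries => // i; rewrite mxE; exact: d1.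
- have p0 : 0 <= n%:R * (`|x.1 - y.1| + `|x.2 - y.2|) by rewrite mulr_ge0// addr_ge0.
  by split; apply: norm_le_entries => // i; rewrite !mxE; exact: l1.
- have T0 z : torus_ball (z, 0 : 'rV[R]_n) by split=> //=; rewrite /unit_ball /= normr0.
  have <- : grad (fun th => f (th, 0)) th = grad_theta f (th, 0).
    by apply/rowP => i; rewrite !mxE (derive_fst f th 0 i).2.
  apply: coordinatewise_taylor => [z i|z z' i].
    by apply: (derive_fst f z 0 i).1; have [_] := fC [::] isT _ (T0 z); apply.
  rewrite !(derive_fst f _ 0 i).2; have := l1 (inl i) _ _ (T0 z) (T0 z').
  by rewrite /= subrr normr0 addr0.
Qed.

End Partials.

(** * The average along the frequency *)

Section Average.
Context {R : realType}.

Local Notation intv k := (map_mx intr k).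

Lemma wsum_close m (w a b : 'I_m -> R) (e : R) : (forall j, 0 <= w j) -> \sum_j w j = 1 ->
  (forall j, `|a j - b j| <= e) -> `|\sum_j w j * a j - \sum_j w j * b j| <= e.
Proof.
move=> w0 w1 ab; rewrite -sumrB; apply: (le_trans (ler_norm_sum _ _ _)).
rewrite -[leRHS]mul1r -w1 mulr_suml; apply: ler_sum => j _.
by rewrite -mulrBr normrM ger0_norm// ler_wpM2l.
Qed.

(** Averaging [Phi] over the delays moves it by no more than its speed times the
    mean delay; the increments of the averaged function are under control by
    hypothesis. *)
Lemma delay_increment m (w r : 'I_m -> R) (Phi dPhi : R -> R) (M c e T : R) :
  (forall j, 0 <= w j) -> \sum_j w j = 1 ->
  (forall t : R, is_derive t 1 Phi (dPhi t)) -> (forall t, `|dPhi t| <= M) -> 0 <= T ->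
  (forall t, 0 <= t <= T -> `|\sum_j w j * dPhi (t - r j) - c| <= e) ->
  `|Phi T - Phi 0 - c * T| <= e * T + 2 * M * \sum_j w j * `|r j|.
Proof.
move=> w0 w1 dP PM T0 avg; pose X t := \sum_j w j * Phi (t - r j).
have XP t : `|Phi t - X t| <= M * \sum_j w j * `|r j|.
  have -> : Phi t - X t = \sum_j w j * (Phi t - Phi (t - r j)).
    under eq_bigr do rewrite mulrBr.
    by rewrite sumrB -mulr_suml w1 mul1r.
  apply: (le_trans (ler_norm_sum _ _ _)); rewrite mulr_sumr; apply: ler_sum => j _.
  rewrite normrM ger0_norm// mulrCA ler_wpM2l//.
  have := lipschitz_of_derive dP PM t (t - r j).
  by rewrite (_ : t - (t - r j) = r j)//; ring.
have dX (t : R) : 0 <= t <= T ->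
    is_derive t 1 (X - c \*: id) (\sum_j w j * dPhi (t - r j) - c * 1).
  move=> tT; apply: is_deriveB.
  apply: (is_derive_wsum w (f := fun j t => Phi (t - r j))) => j.
  exact: is_derive_translate.
have h : `|X T - X 0 - c * T| <= e * T.
  have -> : X T - X 0 - c * T = (X - c \*: id) T - (X - c \*: id) 0.
    by rewrite -[RHS]/(X T - c * T - (X 0 - c * 0)); ring.
  rewrite -{2}(subr0 T); apply: (mean_value_le T0 dX) => t tT.
  by rewrite mulr1; exact: avg.
have -> : Phi T - Phi 0 - c * T = (X T - X 0 - c * T) + (Phi T - X T) - (Phi 0 - X 0).
  by ring.
apply: (le_trans (ler_normB _ _)); have h0 := XP 0; have hT := XP T.
have := ler_normD (X T - X 0 - c * T) (Phi T - X T); lra.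
Qed.

Lemma cvg_of_approx (u : R -> R) :
  (forall e, 0 < e -> exists c T0, forall T, T0 <= T -> `|u T - c| <= e) ->
  cvg (u T @[T --> +oo]).
Proof.
move=> h; apply/cauchy_cvgP/cauchy_exP => e e0.
have [|c [T0 hc]] := h (e / 2); first by rewrite divr_gt0.
exists c; suff : \forall T \near +oo, ball c e (u T) by [].
near=> T; rewrite -ball_normE /= distrC.
have TT : T0 <= T by near: T; apply: nbhs_pinfty_ge; rewrite num_real.
by apply: (le_lt_trans (hc _ TT)); rewrite ltr_pdivrMr// ltr_pMr// ltr1n.
Unshelve. all: by end_near. Qed.

(** If the difference quotients form a Lipschitz family in the step, each is close
    to their limit, the derivative. A nonzero derivative exists as a limit, since
    the default value of a missing limit is [0]. *)
Lemma derive_of_quotients {V : normedModType R} (a : V -> R) (th v : V) (B h : R) :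
  (forall h h' : R, h != 0 -> h' != 0 ->
    `|(a (th + h *: v) - a th) / h - (a (th + h' *: v) - a th) / h'| <= B * (`|h| + `|h'|)) ->
  0 <= B -> 'D_v a th != 0 -> h != 0 ->
  `|(a (th + h *: v) - a th) / h - 'D_v a th| <= B * `|h|.
Proof.
move=> aq B0 Dn0 h0.
have der : derivable a th v.
  by apply: contrapT => nd; case/eqP: Dn0; rewrite /derive (dvgP nd).
have cv : (k^-1 *: ((a \o shift th) (k *: v) - a th)) @[k --> 0^'] --> 'D_v a th by [].
apply/ler_addgt0Pr => e e0.
have [k [k0 kclose ksmall]] : exists k : R, [/\ k != 0,
    `|'D_v a th - k^-1 *: ((a \o shift th) (k *: v) - a th)| <= e / 2 &
    B * `|k| <= e / 2].
  near (dnbhs (0 : R)) => k; exists k; split.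
  - by near: k; exact: nbhs_dnbhs_neq.
  - by near: k; move/cvgrPdist_le : cv; apply; rewrite divr_gt0.
  - have kb : `|k| <= (B + 1)^-1 * (e / 2).
      near: k; apply: dnbhs0_le; apply: mulr_gt0; last by rewrite divr_gt0.
      by rewrite invr_gt0 ltr_wpDl.
    rewrite ler_pdivlMl in kb; last by rewrite ltr_wpDl.
    by apply: le_trans kb; rewrite ler_wpM2r// lerDl.
have := aq _ _ h0 k0.
have -> : (a (th + k *: v) - a th) / k = k^-1 *: ((a \o shift th) (k *: v) - a th).
  by rewrite /= (addrC th) mulrC.
move: kclose; set q := k^-1 *: _; set D := 'D_ _ _ _; set p := _ / h => kc pq.
clearbody q D p.
have -> : p - D = (p - q) - (D - q) by ring.
apply: (le_trans (ler_normB _ _)); lra.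
Unshelve. all: by end_near. Qed.

Variables (n : nat) (omega : 'rV[R]_n) (N : R).
Variables (f : 'rV[R]_n * 'rV[R]_n -> R).
Hypotheses (n0 : (0 < n)%N) (res : resonant omega).
Hypothesis (hN : denominator_bound (Lambda_omega omega) N).

Let f0 th := f (th, 0).
Let G th := grad_theta f (th, 0).

Hypothesis f0_periodic : forall th (k : 'rV[int]_n), f0 (th + intv k) = f0 th.
Hypothesis f0_le1 : forall th, `|f0 th| <= 1.
Hypothesis G_le1 : forall th, `|G th| <= 1.
Hypothesis G_lip : forall x y, `|G x - G y| <= n%:R * `|x - y|.
Hypothesis f0_taylor : forall x y,
  `|f0 (x + y) - f0 x - scal (G x) y| <= n%:R ^+ 2 * `|y| ^+ 2.

Definition average_const : R := (32 * n%:R * (n%:R ^+ 2 + 8) + 1) * N ^+ 2.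

(** Jackson approximation at degree [Q / N], then the kernel in time at the
    threshold given by [small_divisor]. *)
Lemma exists_time_average Q : Q_omega omega <= Q ->
  exists m (w r : 'I_m -> R), [/\ forall j, 0 <= w j, \sum_j w j = 1,
    \sum_j w j * `|r j| <= 8 * N * Psi_omega omega Q &
    forall th z, orthc (Lambda_omega omega) z ->
      `|time_average w r omega f0 (th + z) - time_average w r omega f0 th|
        <= average_const / Q ^+ 2].
Proof.
move=> QQ; have [N1 _] := hN; have [Q1 _] := Q_omega_attained res.
have Q0 : 0 < Q by rewrite (lt_le_trans _ QQ)// (lt_le_trans _ Q1).
have N0 : 0 < N by apply: lt_le_trans N1.
have P0 := Psi_gt0 res QQ.
pose d := Num.truncn (Q / N).
have /andP[dQ Qd] : d%:R <= Q / N < d.+1%:R.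
  by apply: truncn_itv; rewrite divr_ge0// ltW.
have [|F dF fF] := @jackson R n d f0 G _ f0_periodic f0_taylor G_le1; first by rewrite sqr_ge0.
have [|||m [w [r [w0 w1 wr wF]]]] := @bohr_average R n d omega (N * Psi_omega omega Q)^-1
    (Q ^+ 2)^-1 F _ _ dF.
- by rewrite invr_gt0 mulr_gt0.
- by rewrite invr_gt0 exprn_gt0.
- move=> k kd; apply: (small_divisor res hN QQ); first by exists k.
  rewrite mulrC -ler_pdivlMr//; apply: le_trans dQ.
  by apply: norm_le_entries => // i; rewrite norm_intv ler_nat; exact: kd.
exists m, w, r; split=> // [|th z zo]; first by rewrite invrK mulrA in wr.
set E := 16 * n%:R * (n%:R ^+ 2 + 8) / d.+1%:R ^+ 2 in fF.
have avE x : `|time_average w r omega f0 x - time_average w r omega F x| <= E.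
  by apply: wsum_close.
have := wF th z; have /[swap] /[apply] : forall k : 'rV[int]_n,
    scal (intv k) omega = 0 -> scal (intv k) z = 0.
  by move=> k k0; rewrite scalC; apply: zo; apply: Lambda_mem => //; exists k.
have a1 := avE (th + z); have a2 := avE th => a3.
have EQ : E <= 16 * n%:R * (n%:R ^+ 2 + 8) * (N ^+ 2 / Q ^+ 2).
  rewrite /E ler_wpM2l ?mulr_ge0 ?addr_ge0 ?sqr_ge0//.
  rewrite -expr_div_n -(invf_div Q N) exprVn lef_pV2 ?posrE ?exprn_gt0 ?divr_gt0//.
  by rewrite lerXn2r ?nnegrE ?divr_ge0 ?ltW.
have e2 : (Q ^+ 2)^-1 <= N ^+ 2 / Q ^+ 2.
  by rewrite -[leLHS]mul1r ler_wpM2r ?invr_ge0 ?sqr_ge0// expr_ge1// ltW.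
have -> : average_const / Q ^+ 2 = 2 * (16 * n%:R * (n%:R ^+ 2 + 8) * (N ^+ 2 / Q ^+ 2))
    + N ^+ 2 / Q ^+ 2 by rewrite /average_const; ring.
have -> : time_average w r omega f0 (th + z) - time_average w r omega f0 th =
  (time_average w r omega f0 (th + z) - time_average w r omega F (th + z)) +
  (time_average w r omega F (th + z) - time_average w r omega F th) -
  (time_average w r omega f0 th - time_average w r omega F th) by ring.
apply: (le_trans (ler_normB _ _)).
have := ler_normD (time_average w r omega f0 (th + z) - time_average w r omega F (th + z))
  (time_average w r omega F (th + z) - time_average w r omega F th).
lra.
Qed.

Lemma orthc_line t : orthc (Lambda_omega omega) (t *: omega).
Proof.
move=> w Lw; rewrite scalZl scalC.
by have [-> //] := resonance_space omega; rewrite mulr0.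
Qed.

Lemma f0_line_continuous th : continuous (fun s : R => f0 (th + s *: omega)).
Proof.
move=> s; have fd : forall s', `|f0 (th + (s + s') *: omega) - f0 (th + s *: omega)
    - s' *: scal (G (th + s *: omega)) omega| <= n%:R ^+ 2 * `|omega| ^+ 2 * s' ^+ 2.
  move=> s'; have := f0_taylor (th + s *: omega) (s' *: omega).
  rewrite scalZr -(addrA th) -scalerDl normrZ exprMn real_normK ?num_real//.
  by move=> h; rewrite -mulrA (mulrC (_ ^+ 2) (s' ^+ 2)).
exact: is_derive_continuous (is_derive_of_quadratic fd).
Qed.

Lemma primitive_average Q th : Q_omega omega <= Q ->
  exists c, forall T Phi, 0 < T ->
    (forall t : R, is_derive t 1 Phi (f0 (th + t *: omega))) ->
    `|T^-1 * (Phi T - Phi 0) - c| <=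
      average_const / Q ^+ 2 + 16 * N * Psi_omega omega Q / T.
Proof.
move=> QQ; have [m [w [r [w0 w1 wr wo]]]] := exists_time_average QQ.
exists (time_average w r omega f0 th) => T Phi T0 dP.
set c := time_average w r omega f0 th.
have avg t : 0 <= t <= T ->
    `|\sum_j w j * f0 (th + (t - r j) *: omega) - c| <= average_const / Q ^+ 2.
  move=> _; have -> : \sum_j w j * f0 (th + (t - r j) *: omega) =
      time_average w r omega f0 (th + t *: omega).
    by apply: eq_bigr => j _; rewrite scalerBl addrA.
  exact: wo (orthc_line t).
have h := delay_increment w0 w1 dP (fun t => f0_le1 _) (ltW T0) avg.
have -> : T^-1 * (Phi T - Phi 0) - c = (Phi T - Phi 0 - c * T) / T.
  by field; rewrite gt_eqF.
rewrite normrM normfV (gtr0_norm T0) ler_pdivrMr// mulrDl divfK ?gt_eqF//.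
apply: (le_trans h); rewrite lerD2l mulr1.
have -> : 16 * N * Psi_omega omega Q = 2 * (8 * N * Psi_omega omega Q) by ring.
by rewrite ler_wpM2l.
Qed.

Lemma average_const_ge0 : 0 <= average_const.
Proof.
apply: mulr_ge0; last exact: sqr_ge0.
by apply: addr_ge0 => //; rewrite mulr_ge0// addr_ge0// sqr_ge0.
Qed.

Lemma rate_small e : 0 < e -> exists Q T1, [/\ Q_omega omega <= Q, 0 < T1 &
  forall t, T1 <= t ->
    2 * average_const / Q ^+ 2 + 16 * N * Psi_omega omega Q / t <= e].
Proof.
move=> e0; have [N1 _] := hN; have [Q1 _] := Q_omega_attained res.
have A0 := average_const_ge0.
pose Q := Q_omega omega + 4 * average_const / e.
have Ae : 0 <= 4 * average_const / e.
  by apply: divr_ge0; [exact: mulr_ge0|exact: ltW].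
have QQ : Q_omega omega <= Q by rewrite lerDl.
have Q'1 : 1 <= Q by exact: le_trans QQ.
have Q0 : 0 < Q by apply: lt_le_trans Q'1.
have P0 := Psi_gt0 res QQ.
set B := 16 * N * Psi_omega omega Q.
have B0 : 0 <= B.
  by apply: mulr_ge0 (ltW P0); apply: mulr_ge0 => //; exact: le_trans N1.
have Be : 0 <= 2 * B / e by apply: divr_ge0; [exact: mulr_ge0|exact: ltW].
exists Q, (1 + 2 * B / e); split=> // [|t tT]; first by rewrite ltr_wpDr.
have t0 : 0 < t by lra.
have h1 : 2 * average_const / Q ^+ 2 <= e / 2.
  rewrite ler_pdivrMr ?exprn_gt0//.
  have : 4 * average_const / e <= Q by rewrite lerDr (le_trans _ Q1).
  rewrite ler_pdivrMr// => h1.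
  have : Q * 1 <= Q * Q by rewrite ler_pM2l.
  by rewrite expr2; nra.
have h2 : B / t <= e / 2.
  rewrite ler_pdivrMr//.
  have : 2 * B / e <= t by lra.
  by rewrite ler_pdivrMr//; lra.
by rewrite [leRHS]splitr; exact: lerD.
Qed.

(** Two primitive averages are close to one and the same constant; letting the
    time of the second one tend to infinity turns the constant into the limit. *)
Lemma average0_rate Q th T Phi : Q_omega omega <= Q -> 0 < T ->
  (forall t : R, is_derive t 1 Phi (f0 (th + t *: omega))) ->
  `|T^-1 * (Phi T - Phi 0) - average0 omega f th| <=
    2 * average_const / Q ^+ 2 + 16 * N * Psi_omega omega Q / T.
Proof.
move=> QQ T0 dP; have [N1 _] := hN.
have avgE : \forall t \near +oo, t^-1 * \int[lebesgue_measure]_(s in `[0, t])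
    f ((th, 0 : 'rV[R]_n).1 + s *: omega, (th, 0 : 'rV[R]_n).2) = t^-1 * (Phi t - Phi 0).
  near=> t; congr (_ * _).
  have t0 : 0 < t by near: t; apply: nbhs_pinfty_gt; rewrite num_real.
  exact: (Rintegral_of_primitive t0 (@f0_line_continuous th) dP).
pose u t := t^-1 * (Phi t - Phi 0).
have cu : cvg (u t @[t --> +oo]).
  apply: cvg_of_approx => e e0.
  have [Q' [T1 [QQ' T10 hT]]] := rate_small e0.
  have [c hc] := primitive_average th QQ'.
  exists c, T1 => t tT; have t0 : 0 < t by apply: lt_le_trans tT.
  apply: (le_trans (hc _ _ t0 dP)); apply: le_trans (hT t tT).
  rewrite lerD2r ler_wpM2r ?invr_ge0 ?sqr_ge0// ler_peMl ?average_const_ge0//.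
  by rewrite (_ : 1 = 1%:R)// ler_nat.
have uE : u t @[t --> +oo] --> average0 omega f th.
  rewrite /average0 /average.
  have -> : lim ((t^-1 * \int[lebesgue_measure]_(s in `[0, t])
    f ((th, 0 : 'rV[R]_n).1 + s *: omega, (th, 0 : 'rV[R]_n).2)) @[t --> +oo])
      = lim (u t @[t --> +oo]).
    congr (lim _); rewrite eqEsubset; split; apply: near_eq_cvg => //.
    by near do apply/esym.
  exact: cu.
have [c hc] := primitive_average th QQ.
apply/ler_addgt0Pr => e e0.
have h1 : \forall t \near +oo, `|average0 omega f th - u t| <= e / 2.
  by move/cvgrPdist_le : uE; apply; rewrite divr_gt0.
have B0 : 0 <= 16 * N * Psi_omega omega Q.
  apply: mulr_ge0; last exact: ltW (Psi_gt0 res QQ).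
  by apply: mulr_ge0 => //; exact: le_trans N1.
pose T1 := 1 + 2 * (16 * N * Psi_omega omega Q) / e.
have [t [T1t ht]] : exists t, T1 <= t /\ `|average0 omega f th - u t| <= e / 2.
  near (pinfty_nbhs R) => t; exists t; split; last by near: t.
  by near: t; apply: nbhs_pinfty_ge; rewrite num_real.
have Be : 0 <= 2 * (16 * N * Psi_omega omega Q) / e.
    by apply: divr_ge0; [exact: mulr_ge0|exact: ltW].
have t0 : 0 < t by rewrite /T1 in T1t; lra.
have a1 := hc _ _ T0 dP; have a2 := hc _ _ t0 dP.
have h2 : 16 * N * Psi_omega omega Q / t <= e / 2.
  rewrite ler_pdivrMr//.
  have : 2 * (16 * N * Psi_omega omega Q) / e <= t by rewrite /T1 in T1t; lra.
  by rewrite ler_pdivrMr//; lra.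
have -> : T^-1 * (Phi T - Phi 0) - average0 omega f th =
  (T^-1 * (Phi T - Phi 0) - c) - (u t - c) - (average0 omega f th - u t) by ring.
apply: (le_trans (ler_normB _ _)).
have := ler_normB (T^-1 * (Phi T - Phi 0) - c) (u t - c).
rewrite -/(u t) in a2.
by rewrite -mulrA; lra.
Unshelve. all: by end_near. Qed.

Lemma G_line_primitive th i : exists Xi : R -> R,
  forall t : R, is_derive t 1 Xi (G (th + t *: omega) 0 i).
Proof.
apply: exists_primitive => s; apply/cvgrPdist_le => e e0.
pose K := `|omega| * n%:R; have K0 : 0 <= K by rewrite mulr_ge0.
near=> t; have := entry_le_norm (G (th + s *: omega) - G (th + t *: omega)) i; rewrite !mxE.
move/le_trans; apply; apply: (le_trans (G_lip _ _)).
rewrite opprD addrACA subrr add0r -scalerBl normrZ mulrC -mulrA -/K.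
apply: (@le_trans _ _ (`|s - t| * (K + 1))); first by rewrite ler_wpM2l// lerDl.
rewrite -ler_pdivlMr; last by rewrite ltr_wpDl.
near: t; apply: cvgr_dist_le; first exact: cvg_id.
by rewrite divr_gt0// ltr_wpDl.
Unshelve. all: by end_near. Qed.

Lemma exists_line_primitive th : exists Phi : R -> R,
  forall t : R, is_derive t 1 Phi (f0 (th + t *: omega)).
Proof. exact: exists_primitive (@f0_line_continuous th). Qed.

(** Integrating the Taylor formula along the flow. *)
Lemma primitive_difference th i h T Phi Phi' Xi : 0 < T ->
  (forall t : R, is_derive t 1 Phi (f0 (th + t *: omega))) ->
  (forall t : R, is_derive t 1 Phi' (f0 (th + h *: basis1 i + t *: omega))) ->
  (forall t : R, is_derive t 1 Xi (G (th + t *: omega) 0 i)) ->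
  `|T^-1 * (Phi' T - Phi' 0) - T^-1 * (Phi T - Phi 0) - h * (T^-1 * (Xi T - Xi 0))|
    <= n%:R ^+ 2 * h ^+ 2.
Proof.
move=> T0 dP dP' dX.
pose D := Phi' - Phi - h \*: Xi.
have dD (t : R) : 0 <= t <= T -> is_derive t 1 D (f0 (th + h *: basis1 i + t *: omega)
    - f0 (th + t *: omega) - h * G (th + t *: omega) 0 i).
  by move=> _; apply: is_deriveB.
have -> : T^-1 * (Phi' T - Phi' 0) - T^-1 * (Phi T - Phi 0) - h * (T^-1 * (Xi T - Xi 0))
   = T^-1 * (D T - D 0).
  rewrite -[D T]/(Phi' T - Phi T - h * Xi T) -[D 0]/(Phi' 0 - Phi 0 - h * Xi 0); ring.
rewrite normrM normfV (gtr0_norm T0) ler_pdivrMl// [leRHS]mulrC -[X in _ * X](subr0 T).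
apply: (mean_value_le (ltW T0) dD) => t _; rewrite (addrAC th).
have := f0_taylor (th + t *: omega) (h *: basis1 i).
rewrite scalZr scal_basis1; move/le_trans; apply; rewrite ler_wpM2l ?sqr_ge0//.
rewrite -(real_normK (num_real h)) lerXn2r ?nnegrE// normrZ ler_piMr//.
exact: norm_basis1.
Qed.

Lemma average0_quotients th i h h' : h != 0 -> h' != 0 ->
  `|(average0 omega f (th + h *: basis1 i) - average0 omega f th) / h -
    (average0 omega f (th + h' *: basis1 i) - average0 omega f th) / h'|
    <= n%:R ^+ 2 * (`|h| + `|h'|).
Proof.
move=> h0 h'0; apply/ler_addgt0Pr => e e0.
have nh : 0 < `|h| by rewrite normr_gt0.
have nh' : 0 < `|h'| by rewrite normr_gt0.
pose d := e / (2 / `|h| + 2 / `|h'|).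
have dd : 0 < 2 / `|h| + 2 / `|h'| by rewrite addr_gt0// divr_gt0.
have d0 : 0 < d by rewrite divr_gt0.
have [Q [T [QQ T0 /(_ _ (lexx T)) hT]]] := rate_small d0.
have [P dP] := exists_line_primitive th.
have [P1 dP1] := exists_line_primitive (th + h *: basis1 i).
have [P2 dP2] := exists_line_primitive (th + h' *: basis1 i).
have [Xi dX] : exists Xi : R -> R, forall t : R, is_derive t 1 Xi (G (th + t *: omega) 0 i).
  exact: G_line_primitive.
have close th' Ph : (forall t : R, is_derive t 1 Ph (f0 (th' + t *: omega))) ->
    `|T^-1 * (Ph T - Ph 0) - average0 omega f th'| <= d.
  by move=> dPh; exact: le_trans (average0_rate QQ T0 dPh) hT.
have a0 := close _ _ dP; have a1 := close _ _ dP1; have a2 := close _ _ dP2.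
have t1 := primitive_difference T0 dP dP1 dX.
have t2 := primitive_difference T0 dP dP2 dX.
move: a0 a1 a2 t1 t2.
set u := T^-1 * (P T - P 0); set u1 := T^-1 * (P1 T - P1 0).
set u2 := T^-1 * (P2 T - P2 0); set x := T^-1 * (Xi T - Xi 0).
set v := average0 omega f th; set v1 := average0 omega f (th + h *: _).
set v2 := average0 omega f (th + h' *: _) => a0 a1 a2 t1 t2.
clearbody u u1 u2 x v v1 v2.
have quot k w1 y1 : k != 0 -> 0 < `|k| -> `|w1 - y1| <= d ->
    `|w1 - u - k * x| <= n%:R ^+ 2 * k ^+ 2 ->
    `|(y1 - v) / k - x| <= n%:R ^+ 2 * `|k| + 2 * d / `|k|.
  move=> k0 nk hw hk; have -> : (y1 - v) / k - x =
     ((w1 - u - k * x) - (w1 - y1) + (u - v)) / k by field.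
  rewrite normrM normfV ler_pdivrMr// mulrDl divfK ?gt_eqF//.
  rewrite -mulrA -expr2 real_normK ?num_real//.
  apply: (le_trans (ler_normD _ _)).
  have := ler_normB (w1 - u - k * x) (w1 - y1); lra.
have q1 := quot h u1 v1 h0 nh a1 t1; have q2 := quot h' u2 v2 h'0 nh' a2 t2.
have de : 2 * d / `|h| + 2 * d / `|h'| = e.
  rewrite -[RHS](divfK (lt0r_neq0 dd)) -/d; ring.
have -> : (v1 - v) / h - (v2 - v) / h' = ((v1 - v) / h - x) - ((v2 - v) / h' - x) by ring.
apply: (le_trans (ler_normB _ _)); lra.
Qed.

Lemma average0_taylor th i h : h != 0 ->
  'D_(basis1 i) (average0 omega f) th != 0 ->
  `|(average0 omega f (th + h *: basis1 i) - average0 omega f th) / h -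
     'D_(basis1 i) (average0 omega f) th| <= n%:R ^+ 2 * `|h|.
Proof.
move=> h0 D0; apply: derive_of_quotients => // [k k' k0 k'0].
exact: average0_quotients.
Qed.

(** The average is a limit of functions, whose derivatives are compared through
    finite differences of step [h = lambda / (8 * n ^ 2)]: the Taylor errors and
    the distance to the limit, [lambda / 8] each relative to the step, take at
    most half of [lambda]. *)
Lemma drift_lower_bound lambda th : `|grad (average0 omega f) th| = lambda -> 0 < lambda ->
  exists i, forall Q T Xi, Q_omega omega <= Q -> 0 < T ->
    2 * average_const / Q ^+ 2 + 16 * N * Psi_omega omega Q / T
      <= lambda ^+ 2 / (64 * n%:R ^+ 2) ->
    (forall t : R, is_derive t 1 Xi (G (th + t *: omega) 0 i)) ->
    lambda / 2 * T <= `|Xi T - Xi 0|.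
Proof.
move=> gl l0; have [|i gi] := @norm_attained _ _ (grad (average0 omega f) th).
  by rewrite gl.
exists i => Q T Xi QQ T0 hE dX; move: gi; rewrite gl mxE => gi.
set D := 'D_ _ _ _ in gi.
have D0 : D != 0 by rewrite -normr_gt0 -gi.
have n2 : 0 < n%:R ^+ 2 :> R by rewrite exprn_gt0// ltr0n.
pose h := lambda / (8 * n%:R ^+ 2).
have h0 : 0 < h by rewrite divr_gt0// mulr_gt0.
have [P dP] := exists_line_primitive th.
have [P1 dP1] := exists_line_primitive (th + h *: basis1 i).
have a0 := le_trans (average0_rate QQ T0 dP) hE.
have a1 := le_trans (average0_rate QQ T0 dP1) hE.
have t1 := primitive_difference T0 dP dP1 dX.
have t2 := average0_taylor (lt0r_neq0 h0) D0.
rewrite (gtr0_norm h0) in t2.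
move: a0 a1 t1 t2; rewrite -/D.
set u := T^-1 * (P T - P 0); set u1 := T^-1 * (P1 T - P1 0).
set x := T^-1 * (Xi T - Xi 0).
set v := average0 omega f th; set v1 := average0 omega f (th + h *: _).
set E := lambda ^+ 2 / _ => a0 a1 t1 t2.
clearbody u u1 v v1 D.
have b : n%:R ^+ 2 * h = lambda / 8.
  by rewrite /h; field; rewrite gt_eqF// ltr0n.
have Eh : E = lambda / 8 * h.
  by rewrite /E /h; field; rewrite gt_eqF// ltr0n.
have t3 : `|(v1 - v) - D * h| <= lambda / 8 * h.
  have -> : (v1 - v) - D * h = ((v1 - v) / h - D) * h by field; rewrite gt_eqF.
  by rewrite normrM (gtr0_norm h0) ler_wpM2r ?(ltW h0)// -b.
have t4 : `|u1 - u - h * x| <= lambda / 8 * h.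
  by have -> : lambda / 8 * h = n%:R ^+ 2 * h ^+ 2 by rewrite -b; ring.
rewrite Eh in a0 a1.
have key : lambda * h <= `|h * x| + 4 * (lambda / 8 * h).
  have -> : lambda * h = `|D * h| by rewrite normrM (gtr0_norm h0) -gi.
  have -> : D * h = h * x + (u1 - u - h * x) - (u1 - v1) + (u - v) - ((v1 - v) - D * h).
    by ring.
  apply: (le_trans (ler_normB _ _)).
  have := ler_normD (h * x + (u1 - u - h * x) - (u1 - v1)) (u - v).
  have := ler_normB (h * x + (u1 - u - h * x)) (u1 - v1).
  have := ler_normD (h * x) (u1 - u - h * x).
  lra.
rewrite normrM (gtr0_norm h0) in key.
have : lambda / 2 <= `|x|.
  by rewrite -(ler_pM2l h0); lra.
by rewrite /x normrM normfV (gtr0_norm T0) ler_pdivlMl// mulrC.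
Qed.

End Average.

(** * The clamped Hamiltonian flow *)

Section ClampedFlow.
Context {R : realType}.

Lemma is_derive_rowP m (x : R -> 'rV[R]_m) (t : R) (v : 'rV[R]_m) :
  is_derive t 1 x v <-> forall i, is_derive t 1 (fun s => x s 0 i) (v 0 i).
Proof.
split=> [[xd xv] i|xi].
  split; first exact: (derivable_mxP x t 1).1 xd 0 i.
  by rewrite -xv derive_mx// mxE.
have xd : derivable x t 1.
  by apply/derivable_mxP => i j; rewrite (ord1 i); have [] := xi j.
split=> //; apply/rowP => i; rewrite derive_mx// mxE.
by have [_ ->] := xi i.
Qed.

(** Clamping the actions in the vector field makes it bounded and Lipschitz, and
    keeps its frequency close to [omega] at all times: delayed positions may then
    be taken before time [0] and after the final time. *)
Definition clamp n (b : R) (I : 'rV[R]_n) : 'rV[R]_n :=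
  \row_i Num.max (- b) (Num.min b (I 0 i)).

Lemma clamp_bound n b (I : 'rV[R]_n) : 0 <= b -> `|clamp b I| <= b.
Proof.
move=> b0; apply: norm_le_entries => // i; rewrite mxE ler_norml.
by rewrite le_max lexx /= ge_max ge_min lexx /= andbT; lra.
Qed.

Lemma clamp_id n b (I : 'rV[R]_n) : `|I| <= b -> clamp b I = I.
Proof.
move=> Ib; apply/rowP => i; rewrite mxE.
have := le_trans (entry_le_norm I i) Ib; rewrite ler_norml => /andP[h1 h2].
by rewrite (min_r h2) (max_r h1).
Qed.

Lemma max_lipschitz (a u v : R) : `|Num.max a u - Num.max a v| <= `|u - v|.
Proof.
have := ler_norm (u - v); have := ler_norm (- (u - v)); rewrite normrN.
have := normr_ge0 (u - v); move: `|u - v| => d d0 h1 h2; rewrite ler_norml.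
by case: (leP a u) => au; case: (leP a v) => av; apply/andP; split; lra.
Qed.

Lemma min_lipschitz (a u v : R) : `|Num.min a u - Num.min a v| <= `|u - v|.
Proof.
have := ler_norm (u - v); have := ler_norm (- (u - v)); rewrite normrN.
have := normr_ge0 (u - v); move: `|u - v| => d d0 h1 h2; rewrite ler_norml.
by case: (leP a u) => au; case: (leP a v) => av; apply/andP; split; lra.
Qed.

Lemma clamp_lipschitz n b (I J : 'rV[R]_n) : `|clamp b I - clamp b J| <= `|I - J|.
Proof.
apply: norm_le_entries => // i; have := entry_le_norm (I - J) i; rewrite !mxE.
apply: le_trans; apply: (le_trans (max_lipschitz _ _ _)).
exact: min_lipschitz.
Qed.

Lemma clamped_flow n (h : 'rV[R]_n -> R) (f : 'rV[R]_n * 'rV[R]_n -> R)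
    (eps b : R) (th0 : 'rV[R]_n) : (0 < n)%N -> 0 < eps -> 0 <= b < 1 ->
  (forall I, unit_ball I -> `|grad h I| <= 1) ->
  (forall I I', unit_ball I -> unit_ball I' -> `|grad h I - grad h I'| <= n%:R * `|I - I'|) ->
  (forall x, torus_ball x -> `|grad_theta f x| <= 1 /\ `|grad_I f x| <= 1) ->
  (forall x y, torus_ball x -> torus_ball y ->
     `|grad_theta f x - grad_theta f y| <= n%:R * (`|x.1 - y.1| + `|x.2 - y.2|) /\
     `|grad_I f x - grad_I f y| <= n%:R * (`|x.1 - y.1| + `|x.2 - y.2|)) ->
  exists theta I : R -> 'rV[R]_n, [/\ theta 0 = th0, I 0 = 0 & forall t : R,
    is_derive t 1 theta (grad h (clamp b (I t)) + eps *: grad_I f (theta t, clamp b (I t))) /\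
    is_derive t 1 I (- (eps *: grad_theta f (theta t, clamp b (I t))))].
Proof.
move=> n0 eps0 /andP[b0 b1] h1 hl f1 fl.
have cB (I : 'rV[R]_n) : unit_ball (clamp b I).
  by rewrite /unit_ball /=; apply: le_lt_trans b1; exact: clamp_bound.
have cT th (I : 'rV[R]_n) : torus_ball (th, clamp b I) by split=> //; exact: cB.
pose X (x : 'rV[R]_(n + n)) : 'rV[R]_(n + n) :=
  row_mx (grad h (clamp b (rsubmx x)) + eps *: grad_I f (lsubmx x, clamp b (rsubmx x)))
    (- (eps *: grad_theta f (lsubmx x, clamp b (rsubmx x)))).
have row_bound (u v : 'rV[R]_n) a : `|u| <= a -> `|v| <= a -> `|row_mx u v| <= a.
  move=> ua va; apply: norm_le_entries; first exact: le_trans ua.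
  move=> i; case: (split_ordP i) => j ->; rewrite ?row_mxEl ?row_mxEr.
    exact: le_trans (entry_le_norm _ _) ua.
  exact: le_trans (entry_le_norm _ _) va.
have lsub_le (x : 'rV[R]_(n + n)) : `|lsubmx x| <= `|x|.
  by apply: norm_le_entries => // i; rewrite mxE entry_le_norm.
have rsub_le (x : 'rV[R]_(n + n)) : `|rsubmx x| <= `|x|.
  by apply: norm_le_entries => // i; rewrite mxE entry_le_norm.
have XM x : `|X x| <= 1 + eps.
  have [ft fI] := f1 _ (cT (lsubmx x) (rsubmx x)).
  apply: row_bound.
    apply: (le_trans (ler_normD _ _)); apply: lerD; first exact: h1.
    by rewrite normrZ gtr0_norm//; exact: ler_piMr (ltW eps0) fI.
  rewrite normrN normrZ gtr0_norm//.
  apply: (@le_trans _ _ eps); last by rewrite -[leLHS]add0r lerD2r.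
  exact: ler_piMr (ltW eps0) ft.
pose L := n%:R * (1 + 2 * eps).
have L0 : 0 < L by rewrite mulr_gt0// ?ltr0n// addr_gt0// mulr_gt0.
have XL x y : `|X x - X y| <= L * `|x - y|.
  have cl : `|clamp b (rsubmx x) - clamp b (rsubmx y)| <= `|x - y|.
    apply: (le_trans (clamp_lipschitz _ _ _)).
    by have := rsub_le (x - y); rewrite linearB.
  have ll : `|lsubmx x - lsubmx y| <= `|x - y|.
    by have := lsub_le (x - y); rewrite linearB.
  have [/= lt lI] := fl _ _ (cT (lsubmx x) (rsubmx x)) (cT (lsubmx y) (rsubmx y)).
  have s2 : n%:R * (`|lsubmx x - lsubmx y| + `|clamp b (rsubmx x) - clamp b (rsubmx y)|)
      <= n%:R * (2 * `|x - y|).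
    by rewrite ler_wpM2l// mulr_natl mulr2n; exact: lerD.
  rewrite /X opp_row_mx add_row_mx; apply: row_bound.
    set u1 := grad h _; set u2 := grad h _; set w1 := grad_I f _; set w2 := grad_I f _.
    have -> : u1 + eps *: w1 - (u2 + eps *: w2) = (u1 - u2) + eps *: (w1 - w2).
      by rewrite opprD addrACA scalerBr.
    have -> : L * `|x - y| = n%:R * `|x - y| + eps * (n%:R * (2 * `|x - y|)).
      by rewrite /L; ring.
    apply: (le_trans (ler_normD _ _)); apply: lerD.
      by apply: (le_trans (hl _ _ (cB _) (cB _))); rewrite ler_wpM2l.
    rewrite normrZ gtr0_norm// ler_wpM2l ?(ltW eps0)//.
    exact: le_trans lI s2.
  rewrite -opprD normrN -scalerBr normrZ gtr0_norm//.
  have -> : L * `|x - y| = n%:R * `|x - y| + eps * (n%:R * (2 * `|x - y|)).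
    by rewrite /L; ring.
  apply: (@le_trans _ _ (eps * (n%:R * (2 * `|x - y|)))); last by rewrite lerDr mulr_ge0.
  by rewrite ler_wpM2l ?(ltW eps0)//; exact: le_trans lt s2.
have [x [x0 dx]] := global_flow (row_mx th0 0) L0 XM XL.
exists (fun t => lsubmx (x t)), (fun t => rsubmx (x t)); split.
- by rewrite x0 row_mxKl.
- by rewrite x0 row_mxKr.
- move=> t; have /is_derive_rowP dxt := dx t; split; apply/is_derive_rowP => i.
    have -> : (fun s => lsubmx (x s) 0 i) = (fun s => x s 0 (lshift n i)).
      by apply/funext => s; rewrite mxE.
    by have := dxt (lshift n i); rewrite row_mxEl.
  have -> : (fun s => rsubmx (x s) 0 i) = (fun s => x s 0 (rshift n i)).
    by apply/funext => s; rewrite mxE.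
  by have := dxt (rshift n i); rewrite row_mxEr.
Qed.

End ClampedFlow.

(** * Drift along and across the resonance space *)

Section Drift.
Context {R : realType} {n : nat}.
Variables (omega : 'rV[R]_n) (eps K b : R) (theta I c : R -> 'rV[R]_n).
Variables (g : 'rV[R]_n * 'rV[R]_n -> 'rV[R]_n) (G : 'rV[R]_n -> 'rV[R]_n).
Hypotheses (eps0 : 0 < eps).
Hypothesis dI : forall t : R, is_derive t 1 I (- (eps *: g (theta t, c t))).
Hypothesis theta_line : forall t s, `|theta t - theta s - (t - s) *: omega| <= K * `|t - s|.
Hypothesis gG : forall x y t, `|g (x, c t) - G y| <= n%:R * (`|x - y| + b).

(** The curve is compared with the line through [theta 0], on which [Xi] is a
    primitive of the [i]-th component of the force. *)
Lemma drift_along i T (Xi : R -> R) : 0 <= T -> 0 <= K ->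
  (forall t : R, is_derive t 1 Xi (G (theta 0 + t *: omega) 0 i)) ->
  eps * (`|Xi T - Xi 0| - T * (n%:R * (K * T + b))) <= `|I T - I 0|.
Proof.
move=> T0 K0 dX; pose Y := (fun s => I s 0 i) + eps \*: Xi.
have dY (t : R) : 0 <= t <= T -> is_derive t 1 Y
    (- (eps * g (theta t, c t) 0 i) + eps * G (theta 0 + t *: omega) 0 i).
  move=> _; have /is_derive_rowP /(_ i) := dI t; rewrite !mxE => dIi.
  by apply: is_deriveD; exact: is_deriveZ.
have YT : `|Y T - Y 0| <= eps * (n%:R * (K * T + b)) * T.
  rewrite -[X in _ * X]subr0; apply: (mean_value_le T0 dY) => t /andP[t0 tT].
  rewrite -mulrN -mulrDr normrM gtr0_norm// ler_wpM2l ?(ltW eps0)//.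
  have := entry_le_norm (G (theta 0 + t *: omega) - g (theta t, c t)) i.
  rewrite !mxE addrC => /le_trans; apply; rewrite distrC.
  apply: (le_trans (gG _ _ _)); rewrite ler_wpM2l// lerD2r opprD addrA.
  have := theta_line t 0; rewrite subr0 => /le_trans; apply.
  by rewrite ger0_norm// ler_wpM2l.
have := entry_le_norm (I T - I 0) i; rewrite !mxE; apply: le_trans.
have -> : I T 0 i - I 0 0 i = (Y T - Y 0) - eps * (Xi T - Xi 0).
  by rewrite -[Y T]/(I T 0 i + eps * Xi T) -[Y 0]/(I 0 0 i + eps * Xi 0); ring.
rewrite mulrBr; have -> : eps * `|Xi T - Xi 0| = `|eps * (Xi T - Xi 0)|.
  by rewrite normrM gtr0_norm.
have := lerB_dist (eps * (Xi T - Xi 0)) (Y T - Y 0); rewrite distrC.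
apply: le_trans; rewrite lerD2l lerN2; apply: (le_trans YT).
by rewrite le_eqVlt; apply/orP; left; apply/eqP; ring.
Qed.

Variables (f0 : 'rV[R]_n -> R) (m : nat) (w r : 'I_m -> R) (a : R).
Hypotheses (w0 : forall j, 0 <= w j) (w1 : \sum_j w j = 1).
Hypothesis avg : forall th z, orthc (Lambda_omega omega) z ->
  `|time_average w r omega f0 (th + z) - time_average w r omega f0 th| <= a.
Hypothesis f0_taylor : forall x y,
  `|f0 (x + y) - f0 x - scal (G x) y| <= n%:R ^+ 2 * `|y| ^+ 2.
Hypothesis g1 : forall x t, `|g (x, c t)| <= 1.

(** The finite difference of step [h] replaces [v . G], so that invariance of
    the time average, known without any derivative, suffices. *)
Lemma drift_across v h t : orthc (Lambda_omega omega) v -> `|v| <= 1 -> 0 < h -> 0 <= t ->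
  0 <= K ->
  `|scal v (I t) - scal v (I 0)| <=
    eps * (t * (n%:R ^+ 2 * (K * (\sum_j w j * `|r j|) + b) + n%:R ^+ 2 * h + a / h)
           + 2 * n%:R * \sum_j w j * `|r j|).
Proof.
move=> vo v1 h0 t0 K0; set S := \sum_j w j * `|r j|.
pose dPhi s := - (eps * scal v (g (theta s, c s))).
have dP (s : R) : is_derive s 1 (fun s => scal v (I s)) (dPhi s).
  have -> : dPhi s = \sum_i v 0 i * (- (eps *: g (theta s, c s))) 0 i.
    by rewrite /dPhi -mulNr -scalZr scaleNr.
  apply: is_derive_wsum => i; have /is_derive_rowP := dI s; exact.
have scal_le (u : 'rV[R]_n) d : `|u| <= d -> `|scal v u| <= n%:R * d.
  move=> ud; apply: (le_trans (norm_scal_le _ _)); rewrite ler_wpM2l//.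
  by rewrite -[leRHS]mul1r ler_pM.
have PM s : `|dPhi s| <= eps * n%:R.
  rewrite normrN normrM gtr0_norm// ler_wpM2l ?(ltW eps0)//.
  by rewrite -[leRHS]mulr1; apply: scal_le.
set e := n%:R ^+ 2 * (K * S + b) + n%:R ^+ 2 * h + a / h.
have avge s : 0 <= s <= t -> `|\sum_j w j * dPhi (s - r j) - 0| <= eps * e.
  move=> _; rewrite subr0.
  pose q x := (f0 (x + h *: v) - f0 x) / h.
  pose x j := theta s - r j *: omega.
  have cmp j : `|scal v (g (theta (s - r j), c (s - r j))) - q (x j)|
      <= n%:R ^+ 2 * (K * `|r j| + b) + n%:R ^+ 2 * h.
    have s1 : `|scal v (g (theta (s - r j), c (s - r j))) - scal v (G (x j))|
        <= n%:R * (n%:R * (K * `|r j| + b)).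
      rewrite -scalBr; apply: scal_le; apply: (le_trans (gG _ _ _)).
      rewrite ler_wpM2l// lerD2r; have := theta_line (s - r j) s.
      rewrite (_ : s - r j - s = - r j); last by ring.
      rewrite normrN; have -> : theta (s - r j) - theta s - (- r j) *: omega =
          theta (s - r j) - x j.
        by rewrite /x scaleNr opprK opprB (addrC (_ *: _)) addrA.
      by [].
    have s2 : `|scal v (G (x j)) - q (x j)| <= n%:R ^+ 2 * h.
      have -> : scal v (G (x j)) - q (x j) =
         - ((f0 (x j + h *: v) - f0 (x j) - scal (G (x j)) (h *: v)) / h).
        by rewrite /q scalZr scalC; field; rewrite gt_eqF.
      rewrite normrN normrM normfV (gtr0_norm h0) ler_pdivrMr//.
      apply: (le_trans (f0_taylor _ _)).
      have -> : n%:R ^+ 2 * h * h = n%:R ^+ 2 * h ^+ 2 by ring.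
      rewrite ler_wpM2l ?sqr_ge0// normrZ (gtr0_norm h0).
      by rewrite lerXn2r ?nnegrE ?mulr_ge0 ?(ltW h0)// ler_piMr// ltW.
    have -> : scal v (g (theta (s - r j), c (s - r j))) - q (x j) =
      (scal v (g (theta (s - r j), c (s - r j))) - scal v (G (x j)))
      + (scal v (G (x j)) - q (x j)) by ring.
    apply: (le_trans (ler_normD _ _)); apply: lerD => //.
    by rewrite expr2 -mulrA.
  have qsum : `|\sum_j w j * q (x j)| <= a / h.
    have -> : \sum_j w j * q (x j) = (time_average w r omega f0 (theta s + h *: v)
        - time_average w r omega f0 (theta s)) / h.
      rewrite /time_average -sumrB mulr_suml; apply: eq_bigr => j _.
      by rewrite /q /x (addrAC _ (h *: v)); ring.
    rewrite normrM normfV (gtr0_norm h0) ler_wpM2r ?invr_ge0 ?(ltW h0)//.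
    by apply: avg => u Lu; rewrite scalZl vo// mulr0.
  have -> : \sum_j w j * dPhi (s - r j) =
      - (eps * \sum_j w j * scal v (g (theta (s - r j), c (s - r j)))).
    by rewrite mulr_sumr -sumrN; apply: eq_bigr => j _; rewrite /dPhi; ring.
  rewrite normrN normrM gtr0_norm// ler_wpM2l ?(ltW eps0)//.
  have -> : \sum_j w j * scal v (g (theta (s - r j), c (s - r j))) =
     \sum_j w j * (scal v (g (theta (s - r j), c (s - r j))) - q (x j))
     + \sum_j w j * q (x j).
    by rewrite -big_split; apply: eq_bigr => j _ /=; ring.
  apply: (le_trans (ler_normD _ _)); apply: lerD => //.
  apply: (le_trans (ler_norm_sum _ _ _)).
  apply: (@le_trans _ _ (\sum_j (n%:R ^+ 2 * K * (w j * `|r j|)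
      + (n%:R ^+ 2 * b + n%:R ^+ 2 * h) * w j))).
    apply: ler_sum => j _; rewrite normrM ger0_norm//.
    have -> : n%:R ^+ 2 * K * (w j * `|r j|) + (n%:R ^+ 2 * b + n%:R ^+ 2 * h) * w j
      = w j * (n%:R ^+ 2 * (K * `|r j| + b) + n%:R ^+ 2 * h) by ring.
    by rewrite ler_wpM2l.
  rewrite big_split /= -mulr_sumr -mulr_sumr w1 -/S.
  by rewrite le_eqVlt; apply/orP; left; apply/eqP; ring.
have := delay_increment w0 w1 dP PM t0 avge.
rewrite mul0r subr0 -/S => /le_trans; apply.
by rewrite le_eqVlt; apply/orP; left; apply/eqP; ring.
Qed.

End Drift.

Section Distance.
Context {R : realType} {n : nat}.

Lemma set_dist_le (x y : 'rV[R]_n) (S : set 'rV[R]_n) : S y -> set_dist x S <= `|x - y|.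
Proof.
move=> Sy; apply: ge_inf; last by exists y.
by exists 0 => _ [z _ <-].
Qed.

(** The orthogonal component of [x] is detected by its own direction. *)
Lemma set_dist_resonance (omega x : 'rV[R]_n) d : 0 <= d ->
  (forall v, orthc (Lambda_omega omega) v -> `|v| <= 1 -> `|scal v x| <= d) ->
  set_dist x (Lambda_omega omega) <= d.
Proof.
move=> d0 xd; have [_ [dec _]] := resonance_space omega.
have [y [v [xyv Ly vo]]] := dec x.
apply: (le_trans (set_dist_le x Ly)); rewrite {1}xyv addrC addKr.
have [->//|v0] := eqVneq v 0; first by rewrite normr0.
have nv : 0 < `|v| by rewrite normr_gt0.
have vx : scal v x = scal v v by rewrite xyv scalDr vo// add0r.
have := xd (`|v|^-1 *: v); rewrite scalZl vx normrM normfV normr_id => h.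
have {}h : `|v|^-1 * `|scal v v| <= d.
  apply: h; first by move=> u Lu; rewrite scalZl vo// mulr0.
  by rewrite normrZ normfV normr_id mulVf// gt_eqF.
apply: le_trans h; rewrite ler_pdivlMl// -expr2.
exact: le_trans (norm_sq_le_scal v) (ler_norm _).
Qed.

End Distance.

(** * The instability theorem *)

Section Constants.
Context {R : realType}.
Implicit Types (n s d l m A N k S t h b : R).

(** In these inequalities [n], [s], [d], [l], [m], [k], [q], [P], [S] and [h] are
    the dimension, [sqrt eps], [delta], [lambda], [mu], [kappa], [Q_omega],
    [Psi Q], the mean delay and [1 / Q]; [A / Q ^ 2] bounds the defect of
    invariance of the delayed averages. *)
Lemma drift_along_numeric n s d l X : 0 < s <= 1 -> 0 < d -> 1 <= n ->
  n * d <= 2^-1 -> n * d <= l / 16 -> l / 2 * (d / s) <= X ->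
  l / 4 * d * s <=
    s ^+ 2 * (X - d / s * (n * ((n * d * s + s ^+ 2) * (d / s) + d * s))).
Proof.
move=> /andP[s0 s1] d0 n1 nd ndl hX.
apply: (@le_trans _ _ (s ^+ 2 * (l / 2 * (d / s)
    - d / s * (n * ((n * d * s + s ^+ 2) * (d / s) + d * s))))); last first.
  by rewrite ler_wpM2l ?sqr_ge0// lerD2r.
have -> : s ^+ 2 * (l / 2 * (d / s) - d / s * (n * ((n * d * s + s ^+ 2) * (d / s) + d * s)))
   = (l / 2 - (n * d) * (n * d) - 2 * (n * d) * s) * d * s.
  by field; rewrite gt_eqF.
rewrite ler_wpM2r ?(ltW s0)// ler_wpM2r ?(ltW d0)//.
have nd0 : 0 <= n * d by rewrite mulr_ge0 ?(ltW d0)// (le_trans _ n1).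
set x := n * d in nd ndl nd0 *.
have p1 : x * x <= 2^-1 * (l / 16) by apply: ler_pM.
have p2 : x * s <= l / 16 * 1 by apply: ler_pM => //; exact: ltW.
lra.
Qed.

Lemma drift_across_numeric n s d m A N q P S t h k : 0 < s <= 1 -> 0 < d -> 1 <= n ->
  n * d <= 2^-1 -> 0 <= A -> 1 <= N -> 0 <= m -> 0 <= S -> 0 <= k <= 1 -> 0 <= q ->
  0 <= t <= d / s -> S <= 8 * N * P -> s * P <= 2 * k * m -> 0 < h <= 2 * m ->
  s <= 2 * q * m ->
  s ^+ 2 * (t * (n ^+ 2 * ((n * d * s + s ^+ 2) * S + d * s) + n ^+ 2 * h + A * h ^+ 2 / h)
     + 2 * n * S)
  <= (64 * n ^+ 2 * N + 2 * n ^+ 2 * q + 2 * (n ^+ 2 + A)) * s * m.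
Proof.
move=> /andP[s0 s1] d0 n1 nd A0 N1 m0 S0 /andP[k0 k1] q0 /andP[t0 td] SP sP /andP[h0 hm] sq.
have n0 : 0 < n by apply: lt_le_trans n1.
have N0 : 0 < N by apply: lt_le_trans N1.
have d1 : d <= 2^-1 by apply: le_trans nd; rewrite ler_peMl// ltW.
have st : s * t <= 2^-1.
  by apply: le_trans d1; rewrite mulrC -ler_pdivlMr.
have sS : s * S <= 16 * N * m.
  apply: (@le_trans _ _ (8 * N * (s * P))).
    have -> : 8 * N * (s * P) = s * (8 * N * P) by ring.
    by rewrite ler_wpM2l// ltW.
  have -> : 16 * N * m = 8 * N * (2 * 1 * m) by ring.
  rewrite ler_wpM2l ?mulr_ge0 ?(ltW N0)//; apply: (le_trans sP).
  by rewrite ler_wpM2r// ler_wpM2l.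
have sS0 : 0 <= s * S by rewrite mulr_ge0// ltW.
have -> : s ^+ 2 * (t * (n ^+ 2 * ((n * d * s + s ^+ 2) * S + d * s) + n ^+ 2 * h
      + A * h ^+ 2 / h) + 2 * n * S) =
   s * ((s * t) * (n ^+ 2 * ((n * d + s) * (s * S) + d * s) + (n ^+ 2 + A) * h)
     + 2 * n * (s * S)).
  by field; rewrite gt_eqF.
have -> : (64 * n ^+ 2 * N + 2 * n ^+ 2 * q + 2 * (n ^+ 2 + A)) * s * m =
  s * ((64 * n ^+ 2 * N + 2 * n ^+ 2 * q + 2 * (n ^+ 2 + A)) * m) by ring.
rewrite ler_wpM2l ?(ltW s0)//.
have n20 : 0 <= n ^+ 2 by exact: sqr_ge0.
have KS : (n * d + s) * (s * S) <= 2 * (16 * N * m).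
  by apply: ler_pM => //; [rewrite addr_ge0 ?mulr_ge0 ?ltW|lra].
have ds : d * s <= 2^-1 * (2 * q * m) by apply: ler_pM => //; exact: ltW.
have h1 : n ^+ 2 * ((n * d + s) * (s * S) + d * s) + (n ^+ 2 + A) * h <=
   n ^+ 2 * (2 * (16 * N * m) + 2^-1 * (2 * q * m)) + (n ^+ 2 + A) * (2 * m).
  by apply: lerD; [rewrite ler_wpM2l// lerD|rewrite ler_wpM2l// addr_ge0].
have h2 : n * (s * S) <= n ^+ 2 * (16 * N * m).
  by apply: ler_pM => //; [exact: ltW|rewrite expr2 ler_peMl// ltW].
have h3 : (s * t) * (n ^+ 2 * ((n * d + s) * (s * S) + d * s) + (n ^+ 2 + A) * h) <=
  2^-1 * (n ^+ 2 * (2 * (16 * N * m) + 2^-1 * (2 * q * m)) + (n ^+ 2 + A) * (2 * m)).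
  apply: ler_pM => //; first by rewrite mulr_ge0// ltW.
  have nds0 : 0 <= n * d + s by apply: addr_ge0; [apply: mulr_ge0|]; exact: ltW.
  have ds0 : 0 <= d * s by apply: mulr_ge0; exact: ltW.
  apply: addr_ge0; last by apply: mulr_ge0; [exact: addr_ge0|exact: ltW].
  by apply: mulr_ge0 => //; apply: addr_ge0 => //; exact: mulr_ge0.
have e1 : 0 <= n ^+ 2 * (N * m).
  by apply: mulr_ge0 => //; apply: mulr_ge0 => //; exact: ltW.
have e2 : 0 <= n ^+ 2 * (q * m) by apply: mulr_ge0 => //; exact: mulr_ge0.
have e3 : 0 <= (n ^+ 2 + A) * m by apply: mulr_ge0 => //; exact: addr_ge0.
apply: (@le_trans _ _ (2^-1 * (n ^+ 2 * (2 * (16 * N * m) + 2^-1 * (2 * q * m))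
    + (n ^+ 2 + A) * (2 * m)) + 2 * (n ^+ 2 * (16 * N * m)))).
  by apply: lerD => //; rewrite -(mulrA 2) ler_wpM2l.
rewrite -subr_ge0.
have -> : (64 * n ^+ 2 * N + 2 * n ^+ 2 * q + 2 * (n ^+ 2 + A)) * m -
  (2^-1 * (n ^+ 2 * (2 * (16 * N * m) + 2^-1 * (2 * q * m)) + (n ^+ 2 + A) * (2 * m))
   + 2 * (n ^+ 2 * (16 * N * m))) =
   16 * (n ^+ 2 * (N * m)) + 3 / 2 * (n ^+ 2 * (q * m)) + (n ^+ 2 + A) * m by field.
by rewrite !addr_ge0// mulr_ge0.
Qed.

Lemma rate_numeric s d m A N P Q k B : 0 < s -> 0 < d -> 0 <= A -> 0 <= N -> 0 < m ->
  0 <= k -> 1 <= Q -> Q^-1 <= 2 * m -> s * P <= 2 * k * m ->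
  m <= B / (4 * A + 32 * N * k / d + 1) ->
  2 * A / Q ^+ 2 + 16 * N * P / (d / s) <= B.
Proof.
move=> s0 d0 A0 N0 m0 k0 Q1 Qm sP mB.
have Q0 : 0 < Q by apply: lt_le_trans Q1.
have D0 : 0 <= 32 * N * k / d by rewrite divr_ge0 ?mulr_ge0// ltW.
have D1 : 0 < 4 * A + 32 * N * k / d + 1 by rewrite ltr_wpDl// addr_ge0// mulr_ge0.
rewrite ler_pdivlMr// in mB; apply: le_trans mB.
have h1 : 2 * A / Q ^+ 2 <= 2 * A * (2 * m).
  rewrite ler_wpM2l ?mulr_ge0//; apply: le_trans Qm.
  by rewrite lef_pV2 ?posrE ?exprn_gt0// expr2 ler_peMl// ltW.
have h2 : 16 * N * P / (d / s) <= 16 * N / d * (2 * k * m).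
  have -> : 16 * N * P / (d / s) = 16 * N / d * (s * P).
    by field; rewrite !gt_eqF.
  by rewrite ler_wpM2l// divr_ge0 ?mulr_ge0// ltW.
apply: (le_trans (lerD h1 h2)); rewrite -subr_ge0.
have -> : m * (4 * A + 32 * N * k / d + 1) - (2 * A * (2 * m) + 16 * N / d * (2 * k * m)) = m.
  by field; rewrite gt_eqF.
exact: ltW.
Qed.

End Constants.

(** A choice that depends on [L] only, so that constants built from it depend on
    [omega] through its resonance space. *)
Definition denominator {R : realType} {n : nat} (L : set 'rV[R]_n) : R :=
  xget 1 [set N | denominator_bound L N].

Lemma denominatorP {R : realType} {n : nat} (omega : 'rV[R]_n) :
  denominator_bound (Lambda_omega omega) (denominator (Lambda_omega omega)).
Proof.
have [_ [_ [N hN]]] := resonance_space omega.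
exact: (@xgetPex _ 1 [set N | denominator_bound (Lambda_omega omega) N]) (ex_intro _ N hN).
Qed.

Lemma denominator_ge1 {R : realType} {n : nat} (L : set 'rV[R]_n) : 1 <= denominator L.
Proof. by rewrite /denominator; case: xgetP => // N -> []. Qed.

(** [Q_omega] as a function of the resonance space alone. *)
Definition least_mode_size {R : realType} {n : nat} (L : set 'rV[R]_n) : R :=
  inf [set Q | 1 <= Q /\
    [set k | [/\ orthc L k, Zn k, 0 < `|k| & `|k| <= Q]] !=set0].

Theorem theorem1 (R : realType) (n : nat) (hn : (2 <= n)%N) :
  exists (kappa C : R -> set 'rV[R]_n -> R)
         (mu0 : R -> set 'rV[R]_n -> R -> R)
         (c delta : R -> set 'rV[R]_n -> R),
    (forall r L l,
       [/\ 0 < kappa r L, 0 < C r L, 0 < mu0 r L l, 0 < c l L & 0 < delta l L]) /\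
    forall (h : 'rV[R]_n -> R) (f : 'rV[R]_n * 'rV[R]_n -> R)
           (eps lambda : R) (omega : 'rV[R]_n),
      0 <= eps ->
      torus_periodic f ->
      Ck basis2 3 torus_ball (hamiltonian h f eps) ->
      Ck basis1 2 unit_ball h ->
      (Ck_norm basis1 2 unit_ball h <= 1)%E ->
      Ck basis2 3 torus_ball f ->
      (Ck_norm basis2 3 torus_ball f <= 1)%E ->
      omega = grad h 0 ->
      resonant omega ->
      (exists theta_star, `|grad (average0 omega f) theta_star| = lambda) ->
      0 < lambda ->
      let kap := kappa `|omega| (Lambda_omega omega) in
      let C' := C `|omega| (Lambda_omega omega) in
      let m := mu_omega omega kap eps in
      let tau := delta lambda (Lambda_omega omega) / Num.sqrt eps in
      Delta_defined omega kap eps ->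
      0 < m <= mu0 `|omega| (Lambda_omega omega) lambda ->
      exists theta I : R -> 'rV[R]_n,
        [/\ solution h f eps tau theta I,
            c lambda (Lambda_omega omega) * Num.sqrt eps <= `|I tau - I 0|,
            `|I 0 - 0| <= C' * Num.sqrt eps * m &
            forall t, 0 <= t <= tau ->
              set_dist (I t - I 0) (Lambda_omega omega) <= C' * Num.sqrt eps * m].
Proof.
have n0 : (0 < n)%N by apply: leq_trans hn.
have n1 : 1 <= n%:R :> R by rewrite ler1n.
have nR : 0 < n%:R :> R by rewrite ltr0n.
pose A (L : set 'rV[R]_n) : R := average_const n (denominator L).
have A0 L : 0 <= A L by exact: average_const_ge0.
pose pos (l : R) : R := if 0 < l then l else 1.
have pos0 l : 0 < pos l by rewrite /pos; case: ifP.
pose kappa (r : R) (L : set 'rV[R]_n) : R := (n%:R * (`|r| + 1))^-1.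
have kappa0 r L : 0 < kappa r L by rewrite invr_gt0 mulr_gt0// ltr_wpDl.
have kappa1 r L : kappa r L <= 1.
  by rewrite invf_le1 ?mulr_gt0 ?ltr_wpDl//; apply: mulr_ege1 => //; rewrite lerDr.
pose delta (l : R) (L : set 'rV[R]_n) : R := Num.min (2 * n%:R)^-1 (pos l / (16 * n%:R)).
have delta0 l L : 0 < delta l L.
  by rewrite lt_min invr_gt0 mulr_gt0//= divr_gt0// mulr_gt0.
pose C (r : R) (L : set 'rV[R]_n) : R := 64 * n%:R ^+ 2 * denominator L
  + 2 * n%:R ^+ 2 * `|least_mode_size L| + 2 * (n%:R ^+ 2 + A L).
have den0 (L : set 'rV[R]_n) : 0 < denominator L.
  exact: lt_le_trans (denominator_ge1 L).
pose mu0 (r : R) (L : set 'rV[R]_n) (l : R) : R := pos l ^+ 2 / (64 * n%:R ^+ 2)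
  / (4 * A L + 32 * denominator L * kappa r L / delta l L + 1).
have C0 r L : 0 < C r L.
  rewrite /C -addrA ltr_pwDl//; first by rewrite !mulr_gt0// exprn_gt0.
  by rewrite addr_ge0 ?mulr_ge0 ?sqr_ge0// addr_ge0 ?sqr_ge0.
have mu0_gt0 r L l : 0 < mu0 r L l.
  apply: divr_gt0; first by rewrite divr_gt0 ?mulr_gt0 ?exprn_gt0.
  apply: ltr_wpDl => //; apply: addr_ge0; first exact: mulr_ge0.
  apply: divr_ge0; last exact: ltW.
  by apply: mulr_ge0; [apply: mulr_ge0 => //|]; exact: ltW.
exists kappa, C, mu0, (fun l L => pos l / 4 * delta l L), delta.
split=> [r L l|]; first by split=> //; rewrite mulr_gt0// divr_gt0.
move=> h f eps lambda omega _ fper _ hC h1 fC f1 omegaE res [ths gths] lambda0.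
set L := Lambda_omega omega; rewrite /=.
set kap := kappa _ _; set m := mu_omega _ _ _; set s := Num.sqrt eps.
move=> hdef /andP[m0 mmu].
have eps0 : 0 < eps by case: hdef.
have s0 : 0 < s by rewrite sqrtr_gt0.
have epsE : eps = s ^+ 2 by rewrite sqr_sqrtr// ltW.
have posl : pos lambda = lambda by rewrite /pos lambda0.
have [Q [QQ Qm sP s1 sq]] : exists Q, [/\ Q_omega omega <= Q, Q^-1 <= 2 * m,
    s * Psi_omega omega Q <= 2 * kap * m, s <= 1 & s <= 2 * Q_omega omega * m].
  apply: exists_cutoff => //; first exact: kappa0.
  rewrite /kap /kappa normr_id ler_pdivrMl ?mulr_gt0 ?ltr_wpDl// mulr1.
  by rewrite ler_wpM2l// lerDl.
have hN := denominatorP omega; rewrite -/L in hN.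
have [hg hgl] := unperturbed_bounds hC h1.
have [fb fg fgl ftay] := perturbation_bounds fC f1.
pose G th := grad_theta f (th, 0).
have T0 th : torus_ball (th, 0 : 'rV[R]_n) by split=> //=; rewrite /unit_ball /= normr0.
have f0per th (k : 'rV[int]_n) : f (th + map_mx intr k, 0) = f (th, 0).
  by apply: fper; [exists k|rewrite /unit_ball /= normr0].
have f0b th : `|f (th, 0)| <= 1 by exact: fb.
have Gb th : `|grad_theta f (th, 0)| <= 1 := (fg _ (T0 th)).1.
have Gl x y : `|grad_theta f (x, 0) - grad_theta f (y, 0)| <= n%:R * `|x - y|.
  by have [h2 _] := fgl _ _ (T0 x) (T0 y); rewrite /= subrr normr0 addr0 in h2.
pose d := delta lambda L; have d0 : 0 < d by exact: delta0.
have nd : n%:R * d <= 2^-1.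
  rewrite mulrC -ler_pdivlMr// -invfM ge_min; apply/orP; left.
  by rewrite mulrC.
have ndl : n%:R * d <= lambda / 16.
  rewrite mulrC -ler_pdivlMr// -mulrA -invfM ge_min posl lexx orbT//.
pose b := d * s; have b0 : 0 <= b by rewrite mulr_ge0// ltW.
have d1 : d <= 2^-1 by apply: le_trans nd; rewrite ler_peMl// ltW.
have b1 : b < 1.
  by apply: (@le_lt_trans _ _ (2^-1 * 1)); [apply: ler_pM => //; exact: ltW|lra].
have b01 : 0 <= b < 1 by rewrite b0.
have [theta [I [th0 I0 flow]]] := clamped_flow ths n0 eps0 b01 hg hgl fg fgl.
exists theta, I.
have cB t : unit_ball (clamp b (I t)).
  by rewrite /unit_ball /=; apply: le_lt_trans b1; exact: clamp_bound.
have cT x t : torus_ball (x, clamp b (I t)) by split=> //; exact: cB.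
have dI (t : R) : is_derive t 1 I (- (eps *: grad_theta f (theta t, clamp b (I t)))).
  by have [_] := flow t.
pose K := n%:R * d * s + s ^+ 2.
have K0 : 0 <= K by rewrite addr_ge0 ?sqr_ge0// !mulr_ge0// ltW.
have tau0 : 0 <= d / s by rewrite divr_ge0// ltW.
have theta_line t u : `|theta t - theta u - (t - u) *: omega| <= K * `|t - u|.
  apply: norm_le_entries => [|i]; first by rewrite mulr_ge0.
  pose y v := theta v 0 i - omega 0 i * v.
  have dy (v : R) : is_derive v 1 y
      ((grad h (clamp b (I v)) + eps *: grad_I f (theta v, clamp b (I v))) 0 i - omega 0 i * 1).
    have [/is_derive_rowP/(_ i) dth _] := flow v.
    have -> : y = (fun v => theta v 0 i) - omega 0 i \*: id by [].
    by apply: is_deriveB.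
  have -> : (theta t - theta u - (t - u) *: omega) 0 i = y t - y u.
    by rewrite /y !mxE; ring.
  apply: (lipschitz_of_derive dy) => v.
  set w := eps *: _; have -> : (grad h (clamp b (I v)) + w) 0 i - omega 0 i * 1 =
      (grad h (clamp b (I v)) - grad h 0 + w) 0 i by rewrite omegaE !mxE; ring.
  apply: (le_trans (entry_le_norm _ _)); apply: (le_trans (ler_normD _ _)).
  rewrite /K; apply: lerD.
    have B0 : unit_ball (0 : 'rV[R]_n) by rewrite /unit_ball /= normr0.
    apply: (le_trans (hgl _ _ (cB v) B0)); rewrite subr0 -mulrA ler_wpM2l//.
    exact: clamp_bound.
  have [_ fI] := fg _ (cT (theta v) v).
  rewrite /w normrZ gtr0_norm// -epsE; exact: ler_piMr (ltW eps0) fI.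
have gG x y t : `|grad_theta f (x, clamp b (I t)) - grad_theta f (y, 0)|
    <= n%:R * (`|x - y| + b).
  have [h2 _] := fgl _ _ (cT x t) (T0 y); apply: (le_trans h2).
  by rewrite /= subr0 ler_wpM2l// lerD2l clamp_bound.
have g1 x t : `|grad_theta f (x, clamp b (I t))| <= 1 := (fg _ (cT x t)).1.
have Q1 : 1 <= Q by apply: le_trans QQ; have [] := Q_omega_attained res.
have Q0 : 0 < Q by apply: lt_le_trans Q1.
have CE : C `|omega| L * s * m = (64 * n%:R ^+ 2 * denominator L
    + 2 * n%:R ^+ 2 * Q_omega omega + 2 * (n%:R ^+ 2 + A L)) * s * m.
  rewrite /C ger0_norm//; rewrite -[least_mode_size L]/(Q_omega omega).
  by have [h2 _] := Q_omega_attained res; exact: le_trans h2.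
have Csm0 : 0 <= C `|omega| L * s * m.
  by apply: mulr_ge0 (ltW m0); apply: mulr_ge0; exact: ltW.
split.
- move=> t /andP[t0 tt].
  have It : `|I t| <= b.
    apply: norm_le_entries => // i.
    have dIi (v : R) := (is_derive_rowP _ _ _).1 (dI v) i.
    have := @mean_value_le R (fun v => I v 0 i) _ eps 0 t t0 (fun v _ => dIi v).
    rewrite I0 mxE !subr0 => h2.
    apply: (@le_trans _ _ (eps * t)).
      apply: h2 => v _; rewrite !mxE normrN normrM gtr0_norm//.
      apply: ler_piMr (ltW eps0) _.
      have := le_trans (entry_le_norm _ i) (g1 (theta v) v).
      by rewrite mxE.
    apply: (le_trans (ler_wpM2l (ltW eps0) tt)).
    rewrite epsE /b -/d; have -> : s ^+ 2 * (d / s) = d * s by field; rewrite gt_eqF.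
    exact: lexx.
  have [dth dIt] := flow t; rewrite (clamp_id It) in dth dIt.
  by split=> //; rewrite /unit_ball /=; apply: le_lt_trans b1.
- have [i hi] := drift_lower_bound n0 res hN f0per f0b Gb Gl ftay gths lambda0.
  have [Xi dXi] := G_line_primitive omega Gl ths i.
  have tau1 : 0 < d / s by rewrite divr_gt0.
  have rate : 2 * average_const n (denominator L) / Q ^+ 2
      + 16 * denominator L * Psi_omega omega Q / (d / s) <= lambda ^+ 2 / (64 * n%:R ^+ 2).
    apply: (rate_numeric s0 d0 (A0 L) (ltW (den0 L)) m0 (ltW (kappa0 `|omega| L)) Q1 Qm sP).
    by move: mmu; rewrite /mu0 posl.
  have XT := hi Q (d / s) Xi QQ tau1 rate dXi.
  have dXi' (t : R) : is_derive t 1 Xi (grad_theta f (theta 0 + t *: omega, 0) 0 i).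
    by rewrite th0.
  have := drift_along eps0 dI theta_line gG tau0 K0 dXi'.
  apply: le_trans; rewrite posl epsE.
  by apply: drift_along_numeric => //; rewrite s0.
- by rewrite I0 subrr normr0.
- move=> t /andP[t0 tt]; apply: set_dist_resonance => // v vo v1.
  have [q [w [r [w0 w1 wr avg]]]] :=
    exists_time_average res hN f0per Gb ftay QQ.
  have Qi0 : 0 < Q^-1 by rewrite invr_gt0.
  rewrite scalBr; apply: (le_trans (drift_across eps0 dI theta_line gG w0 w1 avg ftay g1
    vo v1 Qi0 t0 K0)).
  rewrite CE epsE -exprVn.
  apply: (@drift_across_numeric _ _ _ _ _ _ _ _ (Psi_omega omega Q) _ _ _ kap) => //.
  + by rewrite s0.
  + exact: A0.
  + exact: denominator_ge1.
  + exact: ltW.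
  + by rewrite sumr_ge0// => j _; rewrite mulr_ge0.
  + by rewrite (ltW (kappa0 `|omega| L)) kappa1.
  + by have [h2 _] := Q_omega_attained res; exact: le_trans h2.
  + by rewrite t0.
  + by rewrite Qi0.
Qed.
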